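(* Let $\beta\in\mathbb R$. (1) Let $1<p<\infty$ and $\Omega\subset\mathbb R^{2n+1}$ open; if $2n+\beta<0$ assume also $\Omega\subset(\mathbb R^{2n}\setminus\{0\})\times\mathbb R$. Then for every $u\in C^1_0(\Omega)$, $$\Big(\frac{|2n+\beta|}{p}\Big)^p\int_\Omega|u|^pr^\beta d\xi\le\int_\Omega|\nabla_Lu|^pr^{p+\beta}d\xi,$$ and in particular $\big(\frac{|2n-p|}{p}\big)^p\int_\Omega\frac{|u|^p}{N^p}d\xi\le\big(\frac{|2n-p|}{p}\big)^p\int_\Omega\frac{|u|^p}{r^p}d\xi\le\int_\Omega|\nabla_Lu|^pd\xi$. If $(B^{2n}_\rho\setminus\{0\})\times B^1_\rho\subset\Omega$ for some $\rho>0$, the constant $(|2n+\beta|/p)^p$ is sharp. (2) Let $p=2n$, $R>0$, $\Omega=\{(x,y,t):|(x,y)|<R\}$, $\beta<-1$. Then for every $u\in C^1_0(\Omega)$, $$\Big(\frac{|\beta+1|}{p}\Big)^p\int_\Omega\frac{|u|^p}{r^p}\Big(\ln\frac Rr\Big)^\beta d\xi\le\int_\Omega|\nabla_Lu|^p\Big(\ln\frac Rr\Big)^{p+\beta}d\xi,$$ in particular $\big(\frac{p-1}{p}\big)^p\int_\Omega\frac{|u|^p}{(r\ln(R/r))^p}d\xi\le\int_\Omega|\nabla_Lu|^pd\xi$; the constant $(|\beta+1|/p)^p$ is sharp.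
   Context: Let $\xi=(x,y,t)\in\mathbb R^n\times\mathbb R^n\times\mathbb R$, $r=|(x,y)|$, $\gamma\ge1$. The Heisenberg–Greiner vector fields are $X_i=\partial_{x_i}+2\gamma y_ir^{2\gamma-2}\partial_t$, $Y_i=\partial_{y_i}-2\gamma x_ir^{2\gamma-2}\partial_t$, and $\nabla_L=(X_1,\dots,X_n,Y_1,\dots,Y_n)$. $N(x,y,t)=(r^{4\gamma}+t^2)^{1/(4\gamma)}$. $B^s_\rho$ is the Euclidean ball in $\mathbb R^s$ of radius $\rho$ centred at the origin. ''Sharp'' means the constant cannot be replaced by any larger one. *)

(* Defs.v *)
From HB Require Import structures.
From mathcomp Require Import all_boot all_order all_algebra.
From mathcomp Require Import all_classical all_reals all_analysis.
Set Implicit Arguments. Unset Strict Implicit. Unset Printing Implicit Defensive.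
Import Order.TTheory GRing.Theory Num.Theory.
Import numFieldNormedType.Exports.
Local Open Scope classical_set_scope.
Local Open Scope ring_scope.

Section HG.
Variable R : realType.

(* Points of R^m are row vectors 'rV[R]_m.  For m = 2n+1 the coordinates are
   x_i = xi 0 i (i < n), y_i = xi 0 (n+i) (i < n), t = xi 0 (2n). *)

Definition upd m (xi : 'rV[R]_m) (k : nat) (s : R) : 'rV[R]_m :=
  \row_j (if (j : nat) == k then s else xi ord0 j).

Fixpoint iint m (k : nat) (f : 'rV[R]_m -> \bar R) (xi : 'rV[R]_m) : \bar R :=
  match k with
  | 0 => f xi
  | k'.+1 => (\int[lebesgue_measure]_(s in setT) iint k' f (upd xi k' s))%E
  end.

(* Lebesgue integral over Omega in R^m of a nonnegative real function f
   (by Tonelli, the iterated integral of the nonnegative integrand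
   equals the integral w.r.t. m-dimensional Lebesgue measure). *)
Definition integral_on m (Omega : set 'rV[R]_m) (f : 'rV[R]_m -> R) : \bar R :=
  iint m (fun xi => if xi \in Omega then (f xi)%:E else 0%E) 0.

Definition partial m (k : 'I_m) (u : 'rV[R]_m -> R) (xi : 'rV[R]_m) : R :=
  derive1 (fun s => u (upd xi k s)) (xi ord0 k).

Definition C1_0 m (Omega : set 'rV[R]_m) (u : 'rV[R]_m -> R) : Prop :=
  [/\ (forall (k : 'I_m) xi, derivable (fun s => u (upd xi k s)) (xi ord0 k) 1),
      (forall k : 'I_m, continuous (partial k u)),
      compact (closure [set xi | u xi != 0]) &
      closure [set xi | u xi != 0] `<=` Omega].

Definition rr n (xi : 'rV[R]_(n.*2.+1)) : R :=
  Num.sqrt (\sum_(i < n.*2) (xi ord0 (widen_ord (leqnSn _) i)) ^+ 2).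

Definition tt n (xi : 'rV[R]_(n.*2.+1)) : R := xi ord0 ord_max.

Definition xc n (xi : 'rV[R]_(n.*2.+1)) (i : nat) : R := xi ord0 (inord i).
Definition yc n (xi : 'rV[R]_(n.*2.+1)) (i : nat) : R := xi ord0 (inord (n + i)).

Definition HG_X (gamma : R) n (i : nat) (u : 'rV[R]_(n.*2.+1) -> R) xi : R :=
  partial (inord i) u xi + 2 * gamma * yc xi i * (rr xi `^ (2 * gamma - 2)) * partial ord_max u xi.
Definition HG_Y (gamma : R) n (i : nat) (u : 'rV[R]_(n.*2.+1) -> R) xi : R :=
  partial (inord (n + i)) u xi - 2 * gamma * xc xi i * (rr xi `^ (2 * gamma - 2)) * partial ord_max u xi.

Definition gradL_norm (gamma : R) n (u : 'rV[R]_(n.*2.+1) -> R) xi : R :=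
  Num.sqrt (\sum_(i < n) (HG_X gamma i u xi ^+ 2 + HG_Y gamma i u xi ^+ 2)).

Definition NN (gamma : R) n (xi : 'rV[R]_(n.*2.+1)) : R :=
  (rr xi `^ (4 * gamma) + tt xi ^+ 2) `^ (4 * gamma)^-1.

End HG.

(* Main.v *)
Require Import Defs.
From HB Require Import structures.
From mathcomp Require Import all_boot all_order all_algebra.
From mathcomp Require Import all_classical all_reals all_analysis.
From mathcomp Require Import measurable_realfun.
From mathcomp Require Import ring lra.
Import Order.TTheory GRing.Theory Num.Theory.
Import numFieldNormedType.Exports.
Local Open Scope classical_set_scope.
Local Open Scope ring_scope.
Set Implicit Arguments. Unset Strict Implicit. Unset Printing Implicit Defensive.

(* Write z = (x, y) and E = z . grad_z.  The t-components of the vector fields cancel in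
   z . nabla_L, so |E u| <= r |nabla_L u|.  For a radial weight V = tau W with
   r V' + 2n V >= p c W, integrating
     div_z (z V |u|^p) = (r V' + 2n V) |u|^p + p V |u|^(p-2) u E u
   and applying Young's inequality gives
     c^p int |u|^p W <= int |nabla_L u|^p r^p tau^p W.
   Part (1) is W = r^beta, tau = 1, and part (2) is W = r^(-p) ln(R/r)^beta, tau = ln(R/r).
   The vanishing of div-integrals is obtained from the dilations (z, t) |-> (l z, t).
   A weight that is singular on r = 0 is multiplied by a cutoff, which is removed by monotone
   convergence.

   For the sharpness let y' = - 1 / (r tau), that is y = - ln r in part (1) and
   y = ln (ln (R/r)) in part (2).  The function e^(c y), with c the critical exponent, is
   the virtual extremal; truncating it to u = e^(c y) eta((y - 2L) / L) eta(t / T)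
   changes the quotient by O(1/L) and O(sup (tau r^(2 gamma)) / T), the supremum being over the
   support, because the layers j d <= y < (j + 1) d (d = 1, resp. d = ln 2) all have the same
   measure up to a factor 2. *)

(** * Iterated Lebesgue integrals *)

(** The integrals of the theorem are iterated, and the energy may be infinite. Every comparison
    therefore runs through nonnegative jointly measurable integrands, and the sign-changing
    divergence enters only through its positive and negative parts, which have the same finite
    integral and cancel. The form V = tau W is dictated by Young's inequality for a = tau r |nabla_L
    u| and b = c |u|: weighted by W, its cross term is a multiple of tau W |u|^(p-1) r |nabla_L u|,
    the bound for the term of the divergence that contains E u. A cutoff contributes its own
    derivative to r V'. This term has to be nonnegative, so the cutoff must increase with r; the
    opposite sign of the inequality for V cannot be treated in this way. On r = 0 powers, inverses
    and logarithms take default values, so pointwise inequalities can fail there; the axis is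
    removed as a null set. For sharpness the t-derivative of the test function is an error that is
    beaten in two different ways: in part (1) the height T is bounded by Omega and the support is
    moved towards r = 0; in part (2) Omega is unbounded in t and T is taken large. *)

Section scaling.
Context {R : realType}.
Local Notation mu := (@lebesgue_measure R).

(** Lebesgue measure is [l] times its image under multiplication by [l]: the two measures agree on
    half-open intervals, and uniqueness of Lebesgue measure does the rest. *)
Lemma ge0_integral_scale (l : R) (f : R -> \bar R) : 0 < l ->
  measurable_fun setT (f : measurableTypeR R -> \bar R) -> (forall x, 0 <= f x)%E ->
  (\int[mu]_(s in setT) f (l * s)%R = l^-1%:E * \int[mu]_(s in setT) f s)%E.
Proof.
move=> l0 mf f0.
pose phi : measurableTypeR R -> measurableTypeR R := *%R l.
have mphi : measurable_fun setT phi by apply: measurable_funM.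
pose nu : {measure set (measurableTypeR R) -> \bar R} :=
  [the {measure set (measurableTypeR R) -> \bar R} of
    mscale (NngNum (ltW l0))
      [the {measure set (measurableTypeR R) -> \bar R} of measure_function_pushforward__canonical__measure_function_Measure mu mphi]].
have munu (A : set (measurableTypeR R)) : measurable A -> mu A = nu A.
  apply: lebesgue_measure_unique => _ [[a b] _ <-].
  rewrite /= /mscale /= /pushforward /=.
  have -> : phi @^-1` `]a, b]%classic = `](a / l), (b / l)]%classic.
    apply/seteqP; split => x /=; rewrite !in_itv /= ltr_pdivrMr // ler_pdivlMr //;
    by rewrite /phi mulrC.
  rewrite !lebesgue_measure_itv /= !lte_fin ltr_pM2r ?invr_gt0 //.
  case: ifP => _; last by rewrite mule0.
  by rewrite -!EFinD -EFinM; congr EFin; field; rewrite gt_eqF.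
have -> : (\int[mu]_(s in setT) f s = l%:E * \int[mu]_(s in setT) f (l * s)%R)%E.
  transitivity (\int[nu]_(s in setT) f s)%E.
    by apply: eq_measure_integral => A mA _; exact: munu.
  rewrite /nu ge0_integral_mscale //= ge0_integral_pushforward //.
by rewrite muleA -EFinM mulVf ?gt_eqF // mul1e.
Qed.

End scaling.

Section iterated.
Context {R : realType} (m : nat).
Implicit Types (f g : 'rV[R]_m -> \bar R) (xi : 'rV[R]_m).
Local Notation mR := (measurableTypeR R).

Definition rV_of_tuple (x : m.-tuple mR) : 'rV[R]_m := \row_j tnth x j.
Definition tuple_of_rV (xi : 'rV[R]_m) : m.-tuple mR := [tuple xi ord0 j | j < m].

Lemma tuple_of_rVK : cancel tuple_of_rV rV_of_tuple.
Proof. by move=> xi; apply/rowP => j; rewrite mxE tnth_mktuple. Qed.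

(** Measurability on row vectors is read off the product sigma-algebra of tuples. Joint
    measurability, rather than measurability of single slices, is what Tonelli's theorem passes on
    from one integration of [iint] to the next. *)
Definition rV_measurable f := measurable_fun setT (fun x : m.-tuple mR => f (rV_of_tuple x)).

Definition rV_rmeasurable (f : 'rV[R]_m -> R) :=
  measurable_fun setT (fun x : m.-tuple mR => f (rV_of_tuple x)).

Lemma rV_measurable_EFin (f : 'rV[R]_m -> R) :
  rV_rmeasurable f -> rV_measurable (fun xi => (f xi)%:E).
Proof. by move=> mf; exact/measurable_EFinP. Qed.

Lemma rV_measurable_comp d (T : measurableType d) (h : T -> 'rV[R]_m) f :
  rV_measurable f ->
  (forall j, measurable_fun setT (fun x => h x ord0 j : mR)) ->
  measurable_fun setT (f \o h).
Proof.
move=> mf mh.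
rewrite (_ : f \o h = (f \o rV_of_tuple) \o (tuple_of_rV \o h)); last first.
  by apply/funext => x /=; rewrite tuple_of_rVK.
apply: measurableT_comp => //.
apply/measurable_fun_tnthP => j.
rewrite (_ : _ \o _ = (fun x => h x ord0 j : mR)) //.
by apply/funext => x /=; rewrite tnth_mktuple.
Qed.

Lemma rV_measurable_coord (j : 'I_m) :
  rV_rmeasurable (fun xi => xi ord0 j).
Proof.
rewrite /rV_rmeasurable.
rewrite (_ : (fun _ => _) = (fun x : m.-tuple mR => tnth x j)); last first.
  by apply/funext => x /=; rewrite mxE.
exact: measurable_tnth.
Qed.

Lemma rV_measurable_endo f (h : 'rV[R]_m -> 'rV[R]_m) :
  rV_measurable f -> (forall j, rV_rmeasurable (fun xi => h xi ord0 j)) ->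
  rV_measurable (f \o h).
Proof.
move=> mf mh.
apply: (@rV_measurable_comp _ _ (h \o rV_of_tuple) _ mf) => j.
exact: (mh j).
Qed.

Lemma upd_measurable f (k : nat) :
  rV_measurable f ->
  measurable_fun setT (fun xs : m.-tuple mR * mR => f (upd (rV_of_tuple xs.1) k xs.2)).
Proof.
move=> mf.
apply: (@rV_measurable_comp _ _ (fun xs : m.-tuple mR * mR => upd (rV_of_tuple xs.1) k xs.2) _ mf) => j.
have [jk|jk] := eqVneq (j : nat) k.
  rewrite (_ : (fun _ => _) = snd) //; last first.
    by apply/funext => x; rewrite /upd mxE jk eqxx.
rewrite (_ : (fun _ => _) = (fun x : m.-tuple mR => tnth x j) \o fst); last first.
  by apply/funext => x; rewrite /upd mxE (negbTE jk) /= mxE.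
apply: measurableT_comp => //.
exact: measurable_tnth.
Qed.

Lemma upd_measurable_slice f (k : nat) xi :
  rV_measurable f -> measurable_fun setT (fun s : mR => f (upd xi k s)).
Proof.
move=> mf.
apply: (@rV_measurable_comp _ _ (fun s : mR => upd xi k s) _ mf) => j.
rewrite /upd; under eq_fun do rewrite mxE.
case: eqP => _; [exact: measurable_id|exact: measurable_cst].
Qed.

Lemma iint_ge0 k f xi : (forall x, 0 <= f x)%E -> (0 <= iint k f xi)%E.
Proof.
move=> f0; elim: k xi => [//|k IH] xi /=.
by apply: integral_ge0 => s _.
Qed.

Lemma iint_measurable k f : (forall x, 0 <= f x)%E ->
  rV_measurable f -> rV_measurable (iint k f).
Proof.
move=> f0 mf; elim: k => [//|k IH] /=.
rewrite /rV_measurable.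
have := @measurable_fun_fubini_tonelli_F _ _ (m.-tuple mR) mR R
  lebesgue_measure (fun xs => iint k f (upd (rV_of_tuple xs.1) k xs.2)).
apply.
- exact: upd_measurable.
- by move=> x; exact: iint_ge0.
Qed.

Lemma iint_slice_measurable k f xi : (forall x, 0 <= f x)%E ->
  rV_measurable f -> measurable_fun setT (fun s : mR => iint k f (upd xi k s)).
Proof. by move=> f0 mf; apply: upd_measurable_slice; exact: iint_measurable. Qed.

Lemma le_iint k f g xi : (forall x, 0 <= f x)%E ->
  rV_measurable f -> rV_measurable g -> (forall x, f x <= g x)%E ->
  (iint k f xi <= iint k g xi)%E.
Proof.
move=> f0 mf mg fg.
have g0 x : (0 <= g x)%E by exact: le_trans (fg x).
elim: k xi => [//|k IH] xi /=.
by apply: ge0_le_integral => //; [move=> *; exact: iint_ge0|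
  exact: iint_slice_measurable|exact: iint_slice_measurable].
Qed.

Lemma iintD k f g xi : (forall x, 0 <= f x)%E -> (forall x, 0 <= g x)%E ->
  rV_measurable f -> rV_measurable g ->
  iint k (fun x => f x + g x)%E xi = (iint k f xi + iint k g xi)%E.
Proof.
move=> f0 g0 mf mg; elim: k xi => [//|k IH] xi /=.
under eq_integral do rewrite IH.
by rewrite ge0_integralD //; first [move=> *; exact: iint_ge0|exact: iint_slice_measurable].
Qed.

Lemma iint0 k xi : iint k (fun=> 0%E) xi = 0%E :> \bar R.
Proof.
elim: k xi => [//|k IH] xi /=.
by under eq_integral do rewrite IH; rewrite integral0.
Qed.

Lemma iintZl k (c : R) f xi : (0 <= c)%R -> (forall x, 0 <= f x)%E ->
  rV_measurable f ->
  iint k (fun x => c%:E * f x)%E xi = (c%:E * iint k f xi)%E.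
Proof.
move=> c0 f0 mf; elim: k xi => [//|k IH] xi /=.
under eq_integral do rewrite IH.
rewrite ge0_integralZl_EFin //; first [by move=> *; exact: iint_ge0|exact: iint_slice_measurable].
Qed.

(** Coordinate 0 is integrated innermost, and on each of its lines the hyperplane x_0 = 0 is a
    single point. Since r = 0 forces x_0 = 0, the values of integrands on the axis r = 0 do not
    count. *)
Lemma eq_iint_off0 k f g xi : (0 < m)%N -> (0 < k)%N ->
  (forall x, 0 <= f x)%E -> (forall x, 0 <= g x)%E ->
  rV_measurable f -> rV_measurable g ->
  (forall x : 'rV[R]_m, (forall j : 'I_m, (j : nat) = 0%N -> x ord0 j != 0) -> f x = g x) ->
  iint k f xi = iint k g xi.
Proof.
move=> m0 k0 f0 g0 mf mg fg; case: k k0 => // k _.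
elim: k xi => [|k IH] xi; last first.
  by rewrite /=; apply: eq_integral => s _; exact: IH.
rewrite /=; apply: ge0_ae_eq_integral => //=.
- exact: upd_measurable_slice.
- exact: upd_measurable_slice.
- exists [set 0]; split => //; first exact: lebesgue_measure_set1.
move=> s /= /not_implyP[_ nfg]; apply: contrapT => s0; apply: nfg.
apply: fg => j j0; rewrite /upd mxE j0 eqxx; exact/eqP.
Qed.

Lemma iint_cvg k (F : nat -> 'rV[R]_m -> \bar R) f xi :
  (forall i x, 0 <= F i x)%E -> (forall i, rV_measurable (F i)) ->
  (forall x, nondecreasing_seq (F ^~ x)) ->
  (forall x, F ^~ x @ \oo --> f x) ->
  iint k (F i) xi @[i --> \oo] --> iint k f xi.
Proof.
move=> F0 mF ndF Ff.
elim: k xi => [//|k IH] xi /=.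
rewrite (_ : (\int[_]_(s in _) _)%E =
  (\int[lebesgue_measure]_(s in setT) limn (fun i => iint k (F i) (upd xi k s)))%E); last first.
  by apply: eq_integral => s _; apply/esym/cvg_lim => //; exact: IH.
apply: cvg_monotone_convergence => //.
- by move=> i; exact: iint_slice_measurable.
- by move=> i s _; exact: iint_ge0.
- move=> s _ i j ij; apply: le_iint => // x; exact: ndF.
Qed.

Definition dil (l : 'I_m -> R) xi : 'rV[R]_m := \row_j (l j * xi ord0 j).

Lemma dil_upd l xi (j : 'I_m) s : dil l (upd xi j s) = upd (dil l xi) j (l j * s).
Proof. by apply/rowP => i; rewrite !mxE; case: eqP => // /val_inj ->. Qed.

Lemma rV_measurable_dil f l : rV_measurable f -> rV_measurable (f \o dil l).
Proof.
move=> mf; apply: rV_measurable_endo => // j.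
rewrite /rV_rmeasurable; under eq_fun do rewrite mxE.
apply: measurable_funM => //.
exact: rV_measurable_coord.
Qed.

(** Each integration contributes one factor 1 / l_j. Coordinates of index at least [k] are not yet
    integrated and are only scaled in the base point. *)
Lemma iint_dil k f l xi : (forall j, 0 < l j) -> (k <= m)%N ->
  (forall x, 0 <= f x)%E -> rV_measurable f ->
  iint k (f \o dil l) xi = ((\prod_(j < m | (j < k)%N) l j)^-1%:E * iint k f (dil l xi))%E.
Proof.
move=> l0 + f0 mf; elim: k xi => [|k IH] xi km.
  by rewrite /= big_pred0 // invr1 mul1e.
have mdf := rV_measurable_dil l mf.
rewrite [LHS]/=; under eq_integral do rewrite IH 1?ltnW //.
pose j0 := Ordinal km.
under eq_integral do rewrite (dil_upd l xi j0).
rewrite ge0_integralZl_EFin //; last 3 first.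
- by move=> s _; exact: iint_ge0.
- apply: (@measurableT_comp _ _ _ _ _ _ (fun s : mR => iint k f (upd (dil l xi) k s))).
    exact: iint_slice_measurable.
  exact: measurable_funM.
- by rewrite invr_ge0; apply: prodr_ge0 => j _; exact: ltW.
rewrite (@ge0_integral_scale R (l j0) (fun s => iint k f (upd (dil l xi) k s))) //; last 2 first.
- exact: iint_slice_measurable.
- by move=> s; exact: iint_ge0.
rewrite muleA -EFinM -invfM; congr (_^-1%:E * _)%E.
rewrite [RHS](bigD1 j0) //= mulrC; congr (_ * _); apply: eq_bigl => j.
by rewrite ltnS -val_eqE /= andbC -ltn_neqAle.
Qed.

Lemma iint_prod k (phi : 'I_m -> R -> R) (I : 'I_m -> R) xi : (k <= m)%N ->
  (forall j s, 0 <= phi j s) -> (forall j, measurable_fun setT (phi j : mR -> R)) ->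
  (forall j, \int[lebesgue_measure]_(s in setT) (phi j s)%:E = (I j)%:E)%E ->
  (forall j, 0 <= I j) ->
  iint k (fun x => (\prod_j phi j (x ord0 j))%:E) xi
  = (\prod_(j < m) (if (j < k)%N then I j else phi j (xi ord0 j)))%:E.
Proof.
move=> + phi0 mphi Iphi I0; elim: k xi => [|k IH] xi km.
  by rewrite /=; congr EFin; apply: eq_bigr.
rewrite [LHS]/=; under eq_integral do rewrite IH 1?ltnW //.
pose j0 := Ordinal km.
pose c := \prod_(j < m | j != j0) (if (j < k)%N then I j else phi j (xi ord0 j)).
have c0 : 0 <= c by apply: prodr_ge0 => j _; case: ifP.
transitivity (\int[lebesgue_measure]_(s in setT) (c%:E * (phi j0 s)%:E))%E.
  apply: eq_integral => s _; rewrite -EFinM; congr EFin.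
  rewrite (bigD1 j0) //= ltnn mxE eqxx mulrC; congr (_ * _).
  apply: eq_bigr => j jj0; rewrite mxE; case: eqP => // jk.
  by move: jj0; rewrite -val_eqE /= jk eqxx.
rewrite ge0_integralZl_EFin //; last 2 first.
- by move=> s _; rewrite lee_fin.
- by apply/measurable_EFinP; exact: mphi.
rewrite Iphi -EFinM; congr EFin.
rewrite [RHS](bigD1 j0) //= ltnSn mulrC; congr (_ * _).
apply: eq_bigr => j jj0; congr (if _ then _ else _).
by rewrite ltnS [RHS]leq_eqVlt; move: jj0; rewrite -val_eqE /= => /negbTE ->.
Qed.

(** Rounding every coordinate down to the grid of step 1/(i+1) gives functions that are constant on
    countably many measurable cells; by continuity they converge pointwise to [f]. *)
Lemma continuous_rV_rmeasurable (f : 'rV[R]_m -> R) : continuous f -> rV_rmeasurable f.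
Proof.
move=> cf.
pose q (i : nat) (x : 'rV[R]_m) : 'rV[R]_m :=
  \row_j ((Num.floor (i.+1%:R * x ord0 j))%:~R / i.+1%:R).
have qcvg x : q i x @[i --> \oo] --> x.
  apply/cvgrPdist_le => e e0; near=> i.
  rewrite /Num.norm /= mx_normrE; apply: bigmax_le => [|[a j] _]; first exact: ltW.
  have p0 : 0 < i.+1%:R :> R by [].
  have -> : (x - q i x) (a, j).1 (a, j).2 =
      (i.+1%:R * x ord0 j - (Num.floor (i.+1%:R * x ord0 j))%:~R) / i.+1%:R.
    by rewrite !mxE /= (ord1 a); field; rewrite gt_eqF.
  rewrite normrM ger0_norm ?subr_ge0 ?floor_le // gtr0_norm ?invr_gt0 //.
  apply: (@le_trans _ _ (1 / i.+1%:R)).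
    rewrite ler_pM2r ?invr_gt0 // lerBlDl; apply: ltW.
    by rewrite -[1]/(1%:~R) -intrD floorD1_gt.
  rewrite div1r; apply: ltW; near: i; exact: (near_infty_natSinv_lt (PosNum e0)).
apply: (@measurable_fun_cvg _ _ _ setT (fun i x => f (q i (rV_of_tuple x)))); last first.
  move=> x _; apply: continuous_cvg; [exact: cf|exact: qcvg].
move=> i _ B mB; rewrite setTI.
(* The grid cell with integer corner [z], kept if the value of [f] at that corner lies in [B] and
   replaced by the empty set otherwise. *)
pose F (z : 'rV[int]_m) : set (m.-tuple mR) :=
  [set x | f (\row_j ((z ord0 j)%:~R / i.+1%:R)) \in B] `&`
  \bigcap_(j in [set: 'I_m]) [set x | Num.floor (i.+1%:R * tnth x j) = z ord0 j].
rewrite (_ : _ @^-1` B = \bigcup_z F z); last first.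
  apply/seteqP; split => [x /= Bx|x [z _ [/= fz] zx]].
    exists (\row_j Num.floor (i.+1%:R * tnth x j)) => //; split => /=.
      rewrite inE; congr (B (f _)): Bx; apply/rowP => j; rewrite !mxE //.
    by move=> j _ /=; rewrite mxE.
  move: fz; rewrite inE /=; congr (B (f _)); apply/rowP => j; rewrite !mxE.
  by rewrite (zx j I).
apply: countable_bigcupT_measurable => [|z]; first exact: countableP.
apply: measurableI.
  by case: (_ \in B); rewrite ?set_true ?set_false.
apply: fin_bigcap_measurable => // j _.
rewrite (_ : [set _ | _] =
  (fun x : m.-tuple mR => (i.+1%:R * tnth x j : mR)) @^-1` `[(z ord0 j)%:~R, (z ord0 j + 1)%:~R[%classic).
  rewrite -[X in measurable X]setTI.
  have : measurable_fun setT (fun x : m.-tuple mR => (i.+1%:R * tnth x j : mR)).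
    by apply: measurable_funM => //; exact: measurable_tnth.
  by apply => //; exact: measurable_itv.
by apply/seteqP; split => x /=; rewrite in_itv /= -floor_eq => /eqP.
Unshelve. all: by end_near.
Qed.

End iterated.

(** * Calculus of C1 functions and dilations *)

Section real_derivatives.
Context {R : realType}.
Implicit Types (f df : R -> R).

Lemma is_derive_near_le f (x d : R) :
  (forall e, 0 < e -> \forall h \near (0 : R), `|f (x + h) - f x - d * h| <= e * `|h|) ->
  is_derive x 1 f d.
Proof.
move=> fd.
have H : h^-1 *: ((f \o shift x) (h *: 1) - f x) @[h --> 0^'] --> d.
  apply/cvgrPdist_le => e e0; near=> h.
  have h0 : h != 0 by near: h; exact: nbhs_dnbhs_neq.
  have : `|f (x + h) - f x - d * h| <= e * `|h|.
    by near: h; apply: nbhs_dnbhs; exact: fd.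
  rewrite /= -(ler_pM2l (_ : 0 < `|h|^-1)) ?invr_gt0 ?normr_gt0 //.
  rewrite [X in _ <= X -> _]mulrCA mulVf ?normr_eq0 // mulr1 -normfV -normrM.
  rewrite -normrN; congr (`|_| <= _).
  rewrite /GRing.scale /= mulr1 [h + x]addrC; field; exact: h0.
split; first by apply/cvg_ex; exists d.
exact: cvg_lim.
Unshelve. all: by end_near.
Qed.

Lemma mean_value f df (a b : R) : (forall x : R, is_derive x 1 f (df x)) ->
  exists2 c, `|c - a| <= `|b - a| & f b - f a = df c * (b - a).
Proof.
move=> fdf.
have cf (A : set R) : {within A, continuous f}.
  apply: continuous_subspaceT => x.
  apply: differentiable_continuous; apply/derivable1_diffP.
  exact: (@ex_derive _ _ _ _ _ _ _ (fdf x)).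
have [ab|/ltW ba] := leP a b.
  have [c] := @MVT_segment _ f df a b ab (fun x _ => fdf x) (cf _).
  rewrite in_itv /= => /andP[ac cb] e; exists c => //.
  by rewrite !ger0_norm ?subr_ge0 // lerB.
have [c] := @MVT_segment _ f df b a ba (fun x _ => fdf x) (cf _).
rewrite in_itv /= => /andP[ac cb] e; exists c.
  by rewrite !ler0_norm ?subr_le0 // lerN2 lerB.
by rewrite -opprB e -mulrN opprB.
Qed.

Lemma is_derive1_continuous f (x d : R) : is_derive x 1 f d -> {for x, continuous f}.
Proof.
move=> fd; apply: differentiable_continuous; apply/derivable1_diffP.
exact: (@ex_derive _ _ _ _ _ _ _ fd).
Qed.

End real_derivatives.

Lemma cvg_sumr {R : realType} (T I : Type) (F : set_system T) (FF : Filter F)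
  (s : seq I) (P : pred I) (f : I -> T -> R) (l : I -> R) :
  (forall i, f i @ F --> l i) ->
  \sum_(i <- s | P i) f i x @[x --> F] --> \sum_(i <- s | P i) l i.
Proof.
move=> fl; elim: s => [|i s IH].
  by rewrite big_nil; under eq_fun do rewrite big_nil; exact: cvg_cst.
rewrite big_cons; under eq_fun do rewrite big_cons.
by case: ifP => // _; apply: cvgD.
Qed.

Section rV_analysis.
Context {R : realType} (m : nat).
Implicit Types (u : 'rV[R]_m -> R) (x y : 'rV[R]_m).

Lemma cvg_rV (T : Type) (F : set_system T) (FF : Filter F) (f : T -> 'rV[R]_m) y :
  (forall j, f x ord0 j @[x --> F] --> y ord0 j) -> f @ F --> y.
Proof.
move=> fy; apply/cvgrPdist_le => e e0.
have : \forall x \near F, forall j, `|y ord0 j - f x ord0 j| <= e.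
  by apply: filter_forall => j; have /cvgrPdist_le /(_ e e0) := fy j.
apply: filterS => x H.
rewrite /Num.norm /= mx_normrE; apply: bigmax_le => [|[a j] _]; first exact: ltW.
by rewrite !mxE (ord1 a).
Qed.

Lemma upd_id x (k : 'I_m) : upd x k (x ord0 k) = x.
Proof. by apply/rowP => j; rewrite mxE; case: eqP => // /val_inj ->. Qed.

Lemma upd_upd x k (s t : R) : upd (upd x k s) k t = upd x k t.
Proof. by apply/rowP => j; rewrite !mxE; case: eqP. Qed.

Lemma updE x (k : 'I_m) s : upd x k s ord0 k = s.
Proof. by rewrite mxE eqxx. Qed.

Section C1.
Variable u : 'rV[R]_m -> R.
Hypothesis du : forall (k : 'I_m) x, derivable (fun s => u (upd x k s)) (x ord0 k) 1.
Hypothesis cu : forall k : 'I_m, continuous (partial k u).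

Lemma is_derive_upd (k : 'I_m) x (s : R) :
  is_derive s 1 (fun s => u (upd x k s)) (partial k u (upd x k s)).
Proof.
have := @du k (upd x k s); rewrite /partial updE.
rewrite (_ : (fun s0 => u (upd (upd x k s) k s0)) = (fun s0 => u (upd x k s0))); last first.
  by apply/funext => t; rewrite upd_upd.
by move=> d; rewrite derive1E; exact: derivableP.
Qed.

Let hyb x0 x k : 'rV[R]_m := \row_j (if (j < k)%N then x ord0 j else x0 ord0 j).

(** Continuous partial derivatives give a total differential. The point moves from [x0] to [x] one
    coordinate at a time through [hyb x0 x k]; each increment is a mean value, taken at a point no
    farther from [x0] than [x] in the sup norm, so its partial derivative is within [e] of the one
    at [x0]. *)
Lemma C1_taylor x0 e : 0 < e -> \forall x \near x0,
  `|u x - u x0 - \sum_k partial k u x0 * (x ord0 k - x0 ord0 k)| <=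
  e * \sum_k `|x ord0 k - x0 ord0 k|.
Proof.
move=> e0.
have : \forall y \near x0, forall k, `|partial k u x0 - partial k u y| <= e.
  apply: (filter_forall (nbhs_filter x0)) => k.
  exact: (cvgrPdist_le _ _).1 (@cu k x0) e e0.
move=> /nbhs_ballP[d /= d0 dP].
apply/nbhs_ballP; exists d => //= x [_ x0x].
have -> : u x - u x0 = \sum_(k < m) (u (hyb x0 x k.+1) - u (hyb x0 x k)).
  rewrite -(big_mkord xpredT (fun k => u (hyb x0 x k.+1) - u (hyb x0 x k))).
  rewrite telescope_sumr //; congr (u _ - u _); apply/rowP => j; rewrite mxE //.
  by rewrite ltn_ord.
rewrite -sumrB mulr_sumr; apply: le_trans (ler_norm_sum _ _ _) _.
apply: ler_sum => k _.
have [c ck] := @mean_value _ _ _ (x0 ord0 k) (x ord0 k) (is_derive_upd k (hyb x0 x k)).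
have -> : upd (hyb x0 x k) k (x ord0 k) = hyb x0 x k.+1.
  apply/rowP => j; rewrite !mxE; case: eqP => [/val_inj ->|]; first by rewrite ltnSn.
  by rewrite ltnS => /eqP jk; rewrite [(j <= k)%N]leq_eqVlt (negbTE jk).
have -> : upd (hyb x0 x k) k (x0 ord0 k) = hyb x0 x k.
  by apply/rowP => j; rewrite !mxE; case: eqP => [/val_inj ->|//]; rewrite ltnn.
move=> ->; rewrite -mulrBl normrM ler_wpM2r // -normrN opprB; apply: dP.
split => // i j; rewrite (ord1 i) !mxE.
case: eqP => [/val_inj ->|_]; last first.
  by case: ifP => _; [have := x0x ord0 j|exact: ballxx].
rewrite /ball /= -normrN opprB; apply: le_lt_trans ck _.
by have := x0x ord0 k; rewrite /ball /= -normrN opprB.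
Qed.

(** [C1_0] speaks of partial derivatives only; continuity of [u] itself is read off the first-order
    estimate. *)
Lemma C1_continuous : continuous u.
Proof.
suff H (x0 : 'rV[R]_m) : u @ x0 --> u x0 by move=> x0; exact: H.
have FF : ProperFilter (nbhs x0) := nbhs_pfilter x0.
have FF' : Filter (nbhs x0) := nbhs_filter x0.
apply/cvgrPdist_le => e e0.
pose h x := `|\sum_k partial k u x0 * (x ord0 k - x0 ord0 k)| +
  1 * \sum_k `|x ord0 k - x0 ord0 k| : R.
have ch : h @ x0 --> (0 : R).
  have cc k : (fun x : 'rV[R]_m => x ord0 k - x0 ord0 k) @ x0 --> (0 : R).
    rewrite -(subrr (x0 ord0 k)); apply: cvgB; last exact: cvg_cst.
    exact: (@coord_continuous R 1 m ord0 k x0).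
  have -> : (0 : R) = `|\sum_k partial k u x0 * 0| + 1 * \sum_(k < m) `|0 : R|.
    rewrite [X in _ = `|X| + _]big1 ?[X in _ = _ + 1 * X]big1 ?normr0 ?mulr0 ?addr0 //.
    by move=> k _; rewrite mulr0.
  apply: cvgD.
    apply: cvg_norm; apply: cvg_sumr => k; apply: cvgM; [exact: cvg_cst|exact: cc].
  apply: cvgM; first exact: cvg_cst.
  by apply: cvg_sumr => k; apply: cvg_norm; exact: cc.
near=> x.
apply: (@le_trans _ _ (h x)).
  rewrite -normrN opprB /h; set S := \sum_k _ * _.
  rewrite -[u x - u x0](subrK S) addrC; apply: le_trans (ler_normD _ _) _.
  rewrite lerD2l /S {S}; near: x; exact: C1_taylor.
apply: le_trans (ler_norm _) _.
rewrite -[h x]subr0 -normrN opprB.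
by near: x; have /cvgrPdist_le := ch; apply.
Unshelve. all: by end_near.
Qed.

Lemma is_derive_affine (z w : 'rV[R]_m) (a : R) :
  is_derive a 1 (fun b => u (w + b *: z)) (\sum_k z ord0 k * partial k u (w + a *: z)).
Proof.
apply: is_derive_near_le => e e0.
pose M := \sum_k `|z ord0 k| + 1.
have M0 : 0 < M by rewrite ltr_wpDl // sumr_ge0.
have cg : w + (a + h) *: z @[h --> (0 : R)] --> w + a *: z.
  apply: cvgD; first exact: cvg_cst.
  apply: cvgZl; rewrite -[X in _ --> X]addr0; apply: cvgD; [exact: cvg_cst|exact: cvg_id].
have : \forall h \near (0 : R), _ := cg _ (@C1_taylor (w + a *: z) (e / M) (divr_gt0 e0 M0)).
apply: filterS => h /=.
have zE k : (w + (a + h) *: z) ord0 k - (w + a *: z) ord0 k = h * z ord0 k.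
  by rewrite !mxE; ring.
under eq_bigr do rewrite zE.
under [X in _ <= _ * X]eq_bigr do rewrite zE normrM.
rewrite -mulr_sumr mulr_suml => H.
rewrite (_ : \sum_(i < m) _ * _ * h = \sum_k partial k u (w + a *: z) * (h * z ord0 k)); last first.
  by apply: eq_bigr => k _; ring.
apply: le_trans H _.
rewrite mulrC -mulrA mulrC ler_wpM2r // mulrA ler_pdivrMr // mulrC ler_pM2l //.
by rewrite /M lerDl.
Qed.

End C1.

Lemma partial_supp u x (k : 'I_m) : ~ closure [set x | u x != 0] x -> partial k u x = 0.
Proof.
move=> nx.
have : \forall y \near x, u y = 0.
  have : open (~` closure [set x | u x != 0]) by apply: closed_openC; exact: closed_closure.
  rewrite openE => /(_ _ nx); apply: filterS => y ny.
  apply/eqP; apply: contrapT => /negP uy; apply: ny; exact: subset_closure.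
move=> u0.
have cg : upd x k s @[s --> x ord0 k] --> x.
  apply: cvg_rV => j; rewrite /upd; under eq_fun do rewrite mxE.
  by case: eqP => [/val_inj ->|_]; [exact: cvg_id|exact: cvg_cst].
rewrite /partial derive1E.
rewrite (@near_eq_derive _ _ _ _ (cst 0)) ?derive_cst //.
exact: cg u0.
Qed.

End rV_analysis.

(** * Boxes and integrals of compactly supported functions *)

Section box.
Context {R : realType} (m : nat).

Lemma continuous_rV_intro (T : topologicalType) (u : 'rV[R]_m -> T) :
  (forall x : 'rV[R]_m, ProperFilter (nbhs x) -> u @ x --> u x) -> continuous u.
Proof. by move=> H x; apply: H; exact: nbhs_pfilter. Qed.

Lemma continuous_max0 (u : 'rV[R]_m -> R) : continuous u -> continuous (fun x => Num.max (u x) 0).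
Proof. by move=> cu x; apply: continuous_max; [exact: cu|exact: cst_continuous]. Qed.

Definition box (M : R) : set 'rV[R]_m := [set x | forall j, `|x ord0 j| <= M].

Lemma box_compact M : compact (box M).
Proof.
have := @rV_compact R m (fun=> `[- M, M]%classic) (fun=> @segment_compact _ _ _).
congr compact; apply/seteqP; split => x /= xM j; have := xM j;
  by rewrite in_itv /= -ler_norml.
Qed.

(** A product of one-variable indicators, so that its integral factorizes. *)
Definition box_indic (M : R) (x : 'rV[R]_m) : R := \prod_j \1_(`[- M, M]%classic) (x ord0 j).

Lemma box_indic_ge0 M x : 0 <= box_indic M x.
Proof. by apply: prodr_ge0. Qed.

Lemma box_indicT M x : box M x -> box_indic M x = 1.
Proof.
move=> xM; rewrite /box_indic big1 // => j _; rewrite indicE mem_set //=.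
by rewrite in_itv /= -ler_norml.
Qed.

Lemma rV_rmeasurable_prod (phi : 'I_m -> R -> R) :
  (forall j, measurable_fun setT (phi j : measurableTypeR R -> R)) ->
  rV_rmeasurable (fun x => \prod_j phi j (x ord0 j)).
Proof.
move=> mphi; rewrite /rV_rmeasurable.
apply: measurable_prod => j _; apply: measurableT_comp; first exact: mphi.
exact: rV_measurable_coord.
Qed.

Lemma box_indic_measurable M : rV_rmeasurable (box_indic M).
Proof. exact: (rV_rmeasurable_prod (phi := fun=> \1_(`[- M, M]%classic))). Qed.

Lemma iint_box_indic M xi : 0 <= M ->
  iint m (fun x => (box_indic M x)%:E) xi = ((M *+ 2) ^+ m)%:E.
Proof.
move=> M0; rewrite /box_indic (@iint_prod R m m (fun=> \1_(`[- M, M]%classic)) (fun=> M *+ 2)) //.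
- congr EFin; rewrite -[X in _ ^+ X]card_ord -prodr_const; apply: eq_bigr => j _.
  by rewrite ltn_ord.
- move=> j; rewrite integral_indic //= setIT lebesgue_measure_itv /= lte_fin.
  rewrite -EFinD opprK -mulr2n; case: ltP => // MM.
  by have -> : M = 0; [lra|rewrite mul0rn].
- by move=> j; rewrite mulrn_wge0.
Qed.

Lemma continuous_rV_measurable (g : 'rV[R]_m -> R) :
  continuous g -> rV_measurable (fun x => (g x)%:E).
Proof. by move=> cg; apply: rV_measurable_EFin; exact: continuous_rV_rmeasurable. Qed.

(** Naming the finite integral as a real number makes subtraction and division of integrals
    available. *)
Definition has_iint (f : 'rV[R]_m -> R) (I : R) :=
  [/\ forall x, 0 <= f x, rV_rmeasurable f & iint m (fun x => (f x)%:E) 0 = I%:E].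

Lemma has_iintD f g I J : has_iint f I -> has_iint g J -> has_iint (fun x => f x + g x) (I + J).
Proof.
move=> [f0 mf fI] [g0 mg gJ]; split.
- by move=> x; exact: addr_ge0.
- exact: measurable_funD.
- by rewrite EFinD -fI -gJ -iintD //; exact: rV_measurable_EFin.
Qed.

Lemma has_iintZ f I (c : R) : 0 <= c -> has_iint f I -> has_iint (fun x => c * f x) (c * I).
Proof.
move=> c0 [f0 mf fI]; split.
- by move=> x; exact: mulr_ge0.
- exact: measurable_funM.
- by rewrite EFinM -fI -iintZl //; exact: rV_measurable_EFin.
Qed.

Lemma le_has_iint f g I J : has_iint f I -> has_iint g J -> (forall x, f x <= g x) -> I <= J.
Proof.
move=> [f0 mf fI] [g0 mg gJ] fg; rewrite -lee_fin -fI -gJ.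
apply: le_iint => [x|||x]; rewrite ?lee_fin //; exact: rV_measurable_EFin.
Qed.

Lemma has_iint_box M : 0 <= M -> has_iint (box_indic M) ((M *+ 2) ^+ m).
Proof.
by split; [exact: box_indic_ge0|exact: box_indic_measurable|exact: iint_box_indic].
Qed.

(** By compactness [g] is bounded on the box, hence dominated by a multiple of the indicator of the
    box. *)
Lemma iint_fin (g : 'rV[R]_m -> R) (M : R) xi : 0 <= M ->
  (forall x, 0 <= g x) -> continuous g -> (forall x, g x != 0 -> box M x) ->
  exists2 I : R, 0 <= I & iint m (fun x => (g x)%:E) xi = I%:E.
Proof.
move=> M0 g0 cg gM.
have [K Kg] : exists K, forall x, g x <= K * box_indic M x.
  have /compact_bounded [K [_ HK]] : compact (g @` box M).
    apply: continuous_compact; last exact: box_compact.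
    exact: continuous_subspaceT.
  exists (K + 1) => x; have [gx0|gx0] := eqVneq (g x) 0; last first.
    rewrite box_indicT ?mulr1; last exact: gM.
    apply: le_trans (ler_norm _) _; apply: (HK (K + 1)); first by rewrite ltrDl.
    by exists x => //; exact: gM.
  rewrite gx0; have [xM|xM] := pselect (box M x).
    rewrite box_indicT // mulr1 -gx0.
    apply: le_trans (ler_norm _) _; apply: (HK (K + 1)); first by rewrite ltrDl.
    by exists x.
  suff -> : box_indic M x = 0 by rewrite mulr0.
  move/existsNP : xM => [j xj]; rewrite /box_indic (bigD1 j) //= indicE memNset ?mul0r //=.
  by rewrite in_itv /= -ler_norml.
have K0 : 0 <= `|K| by [].
have gK x : ((g x)%:E <= `|K|%:E * (box_indic M x)%:E)%E.
  rewrite -EFinM lee_fin; apply: le_trans (Kg x) _.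
  by rewrite ler_wpM2r ?box_indic_ge0 // ler_norm.
have mg : rV_measurable (fun x => (g x)%:E).
  exact: continuous_rV_measurable.
have mb := rV_measurable_EFin (box_indic_measurable M).
have : (iint m (fun x => (g x)%:E) xi < +oo)%E.
  apply: (@le_lt_trans _ _ (`|K| * (M *+ 2) ^+ m)%:E); last exact: ltry.
  rewrite EFinM -(iint_box_indic xi) // -iintZl //; last by move=> x; rewrite lee_fin box_indic_ge0.
  apply: le_iint => //.
  by apply: emeasurable_funM => //; exact: mb.
have : (0 <= iint m (fun x => (g x)%:E) xi)%E by apply: iint_ge0 => x; rewrite lee_fin.
by case: iint => // I I0 _; exists I => //; rewrite -lee_fin.
Qed.

End box.

(** * A divergence identity from dilations in z *)

Section radial.
Context {R : realType} (n : nat).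
Local Notation N := n.*2.
Local Notation m := (n.*2.+1).
Implicit Types x : 'rV[R]_m.

Definition dilzt (a b : R) : 'rV[R]_m -> 'rV[R]_m :=
  dil (fun j : 'I_m => if (j < N)%N then a else b).

Lemma iint_dilzt (f : 'rV[R]_m -> \bar R) (a b : R) : 0 < a -> 0 < b ->
  (forall x, 0 <= f x)%E -> rV_measurable f ->
  iint m (f \o dilzt a b) 0 = ((a ^+ N * b)^-1%:E * iint m f 0)%E.
Proof.
move=> a0 b0 f0 mf; rewrite /dilzt iint_dil //; last by move=> j; case: ifP.
set x0 := dil _ 0; have -> : x0 = 0 by apply/rowP => j; rewrite !mxE mulr0.
congr (_^-1%:E * _)%E.
rewrite (eq_bigl xpredT) => [|j]; last by rewrite ltn_ord.
rewrite big_ord_recr /= ltnn; congr (_ * _).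
rewrite -[X in _ ^+ X](card_ord N) -prodr_const; apply: eq_bigr => j _.
by rewrite ltn_ord.
Qed.

Lemma dilzt1 x : dilzt 1 1 x = x.
Proof. by apply/rowP => j; rewrite mxE if_same mul1r. Qed.

Lemma continuous_dilzt (b c : R) x :
  (fun p : 'rV[R]_m * R => dilzt p.2 b p.1) @ (x, c) --> dilzt c b x.
Proof.
apply: cvg_rV => j.
rewrite mxE; under eq_fun do rewrite mxE.
apply: cvgM; last first.
  apply: (@cvg_comp _ _ _ fst (fun y : 'rV[R]_m => y ord0 j)); first exact: cvg_fst.
  exact: coord_continuous.
by case: ifP => _; [exact: cvg_snd|exact: cvg_cst].
Qed.

Lemma continuous_dilzt_r (b c : R) : continuous (dilzt c b).
Proof.
apply: continuous_rV_intro => x FF; apply: cvg_rV => j.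
rewrite mxE; under eq_fun do rewrite mxE.
by apply: cvgM; [exact: cvg_cst|exact: coord_continuous].
Qed.

(* Replaces the divergence theorem for the field [G x = div (g z)]: the integral of
   l^N g(l z, t) does not depend on l. *)
Lemma radial_divergence (g G : 'rV[R]_m -> R) (M : R) :
  (forall x, 0 <= g x) -> continuous g -> continuous G ->
  (forall x, g x != 0 -> box M x) -> (forall x, G x != 0 -> box M x) ->
  (forall x (l : R), 0 < l ->
     is_derive l 1 (fun l => l ^+ N * g (dilzt l 1 x)) (l ^+ N / l * G (dilzt l 1 x))) ->
  exists2 I : R, 0 <= I &
    iint m (fun x => (Num.max (G x) 0)%:E) 0 = I%:E /\
    iint m (fun x => (Num.max (- G x) 0)%:E) 0 = I%:E.
Proof.
move=> g0 cg cG gM0 GM0 dg.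
have [M' M0 [gM GM]] : exists2 M', 0 <= M' & (forall x, g x != 0 -> box M' x) /\
    (forall x, G x != 0 -> box M' x).
  exists `|M| => //; split => x H j; apply: le_trans (ler_norm M);
  [exact: (gM0 x H)|exact: (GM0 x H)].
have [Ig Ig0 IgE] := iint_fin 0 M0 g0 cg gM.
have cGp : continuous (fun x => Num.max (G x) 0) by exact: continuous_max0.
have cGn : continuous (fun x => Num.max (- G x) 0).
  by apply: (@continuous_max0 _ _ (fun x => - G x)) => x; exact: (continuousN (cG x)).
have Gp0 x : 0 <= Num.max (G x) 0 by rewrite le_max lexx orbT.
have Gn0 x : 0 <= Num.max (- G x) 0 by rewrite le_max lexx orbT.
have [Ip Ip0 IpE] : exists2 I : R, 0 <= I & iint m (fun x => (Num.max (G x) 0)%:E) 0 = I%:E.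
  apply: (iint_fin 0 M0) => // x H; apply: GM; apply: contraNneq H => ->.
  by rewrite maxxx.
have [In In0 InE] : exists2 I : R, 0 <= I & iint m (fun x => (Num.max (- G x) 0)%:E) 0 = I%:E.
  apply: (iint_fin 0 M0) => // x H; apply: GM; apply: contraNneq H => ->.
  by rewrite oppr0 maxxx.
suff E : Ip = In by exists In => //; rewrite -{1}E.
pose V := (M' *+ 2) ^+ m.
have V0 : 0 <= V by rewrite exprn_ge0 // mulrn_wge0.
have key e : 0 < e -> `|Ip - In| <= e * V.
  move=> e0.
  (* Joint continuity in (x, c) at c = 1 and compactness of the box make the choice of [d] uniform
     in x. *)
  have [d /andP[d0 d1] Hd] : exists2 d : R, 0 < d < 1 & forall c x, 1 <= c <= 1 + d ->
      `|c ^+ N / c * G (dilzt c 1 x) - G x| <= e * box_indic M' x.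
    have : \forall c \near (1 : R), box M' `<=`
        (fun x => `|c ^+ N / c * G (dilzt c 1 x) - G x| <= e).
      apply: ((compact_near_coveringP _).1 (@box_compact R m M') R (nbhs (1 : R))
        (fun c x => `|c ^+ N / c * G (dilzt c 1 x) - G x| <= e)) => x Bx.
      have : (fun p : 'rV[R]_m * R => p.2 ^+ N / p.2 * G (dilzt p.2 1 p.1) - G p.1) @
          (x, (1 : R)) --> (0 : R).
        rewrite -(subrr (1 ^+ N / 1 * G x)); apply: cvgB; last first.
          rewrite expr1n divr1 mul1r.
          by apply: (@cvg_comp _ _ _ fst G); [exact: cvg_fst|exact: cG].
        apply: cvgM; last first.
          rewrite -[X in _ --> X](congr1 G (dilzt1 x)).
          apply: (cvg_comp (fun p : 'rV[R]_m * R => dilzt p.2 1 p.1) G); last exact: cG.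
          exact: continuous_dilzt.
        apply: cvgM; last by apply: cvgV; [exact: oner_neq0|exact: cvg_snd].
        apply: (@cvg_comp _ _ _ snd (fun c : R => c ^+ N)); first exact: cvg_snd.
        exact: exprn_continuous.
      by move=> /cvgr0Pnorm_le /(_ _ e0).
    move=> /nbhs_ballP[d /= d0 dP]; exists (Num.min (d / 2) (1 / 2)).
      rewrite lt_min gt_min; apply/andP; split; last by apply/orP; right; lra.
      by rewrite divr_gt0 //=; lra.
    move=> c x /andP[c1 cd].
    have [Bx|nBx] := pselect (box M' x).
      rewrite box_indicT // mulr1; apply: dP => //.
      rewrite /ball /= ltr_distlC.
      have := ge_min (d / 2) (d / 2) (1 / 2); rewrite lexx /= => Hm.
      have := le_trans cd (_ : 1 + _ <= 1 + d / 2); rewrite lerD2l => /(_ Hm); lra.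
    (* A dilation with c >= 1 keeps points outside the box, so both terms vanish there. This is why
       only factors c >= 1 are considered. *)
    have -> : G x = 0 by apply: contrapT => /eqP /GM.
    have -> : G (dilzt c 1 x) = 0.
      apply: contrapT => /eqP /GM H; apply: nBx => j.
      apply: le_trans (H j); rewrite mxE normrM ler_peMl //.
      by case: ifP => _; rewrite ?normr1 // ger0_norm //; lra.
    by rewrite mulr0 subrr normr0 mulr_ge0 ?box_indic_ge0 // ltW.
  pose c := 1 + d.
  have c0 : 0 < c by rewrite /c; lra.
  (* Mean value theorem in l on [1, c]: the increment of l^N g(l z, t) is [d] times its derivative
     at an intermediate l, which is close to [G x]. *)
  have diff x : `|c ^+ N * g (dilzt c 1 x) - g x - d * G x| <= d * (e * box_indic M' x).
    have [|||b] := @MVT_segment _ (fun l => l ^+ N * g (dilzt l 1 x))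
      (fun l => l ^+ N / l * G (dilzt l 1 x)) 1 c; rewrite /c.
    - by lra.
    - by move=> l; rewrite in_itv /= => /andP[l1 _]; apply: dg; lra.
    - apply: derivable_within_continuous => l; rewrite in_itv /= => /andP[l1 _].
      by apply: ex_derive; apply: dg; lra.
    rewrite in_itv /= => b1; rewrite expr1n mul1r dilzt1 => ->.
    rewrite [1 + d - 1]addrAC subrr add0r mulrC -mulrBr normrM (gtr0_norm d0) ler_pM2l //.
    exact: Hd.
  have mE (h : 'rV[R]_m -> R) : continuous h -> rV_measurable (fun x => (h x)%:E).
    by move=> ch; exact: continuous_rV_measurable.
  have cdg : continuous (fun x => g (dilzt c 1 x)).
    by move=> x; apply: continuous_comp; [exact: continuous_dilzt_r|exact: cg].
  have Igc : iint m (fun x => (c ^+ N)%:E * (g (dilzt c 1 x))%:E)%E 0 = Ig%:E.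
    rewrite iintZl ?exprn_ge0 ?ltW //; [|by move=> x; rewrite lee_fin|exact: mE].
    rewrite (@iint_dilzt (fun x => (g x)%:E)) //; last exact: mE.
    have cN0 : c ^+ N != 0 by rewrite expf_neq0 // gt_eqF.
    by rewrite mulr1 IgE -!EFinM mulrA divff // mul1r.
  have rm (h : 'rV[R]_m -> R) : continuous h -> rV_rmeasurable h.
    exact: continuous_rV_rmeasurable.
  have hc : has_iint (fun x => c ^+ N * g (dilzt c 1 x)) Ig.
    split; [by move=> x; rewrite mulr_ge0 // exprn_ge0 // ltW| |exact: Igc].
    by apply: measurable_funM; [exact: measurable_cst|exact: (rm _ cdg)].
  have hg : has_iint g Ig by split => //; exact: rm.
  have hp : has_iint (fun x => d * Num.max (G x) 0) (d * Ip).
    by apply: has_iintZ; [exact: ltW|split => //; exact: rm].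
  have hq : has_iint (fun x => d * Num.max (- G x) 0) (d * In).
    by apply: has_iintZ; [exact: ltW|split => //; exact: rm].
  have hb : has_iint (fun x => (d * e) * box_indic M' x) (d * e * V).
    by apply: has_iintZ; [rewrite mulr_ge0 // ltW|exact: has_iint_box].
  have GE x : d * G x = d * Num.max (G x) 0 - d * Num.max (- G x) 0.
    by rewrite -mulrBr; congr (_ * _); case: (leP (G x) 0) => ?; case: (leP (- G x) 0) => ?; lra.
  (* The two halves of [diff] are integrated separately. The dilate of [g], with its Jacobian, and
     [g] have the same integral [Ig]; it cancels and leaves d |Ip - In| <= d e V. *)
  have := le_has_iint (has_iintD hc hq) (has_iintD (has_iintD hg hp) hb).
  have := le_has_iint (has_iintD hg hp) (has_iintD (has_iintD hc hq) hb).
  move=> H1 H2.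
  have : d * `|Ip - In| <= d * (e * V).
    rewrite -(gtr0_norm d0) -normrM (gtr0_norm d0) ler_norml.
    have {}H1 : Ig + d * Ip <= Ig + d * In + d * e * V.
      apply: H1 => x; have := diff x; rewrite GE ler_norml => /andP[] + _; lra.
    have {}H2 : Ig + d * In <= Ig + d * Ip + d * e * V.
      apply: H2 => x; have := diff x; rewrite GE ler_norml => /andP[] _; lra.
    apply/andP; split; lra.
  by rewrite ler_pM2l.
apply/eqP; rewrite -subr_eq0 -normr_le0; apply/ler_addgt0Pr => e e0.
rewrite add0r; have [V1|V1] := eqVneq V 0.
  by apply: le_trans (key 1 ltr01) _; rewrite V1 mulr0 ltW.
have V2 : 0 < V by rewrite lt_neqAle eq_sym V1.
by apply: le_trans (key _ (divr_gt0 e0 V2)) _; rewrite divfK.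
Qed.

End radial.

(** * One-variable calculus: powers, positive part, radial cutoff *)

Section one_variable.
Context {R : realType}.
Implicit Types (f g : R -> R).

Lemma is_derive1M f g (x a b : R) : is_derive x 1 f a -> is_derive x 1 g b ->
  is_derive x 1 (fun y => f y * g y) (a * g x + f x * b).
Proof.
move=> fa gb; have H := is_deriveM fa gb.
by apply: is_derive_eq => /=; rewrite addrC /GRing.scale /= [g x * a]mulrC.
Qed.

Lemma is_derive1_near f g (x d : R) : (\forall y \near x, f y = g y) ->
  is_derive x 1 f d -> is_derive x 1 g d.
Proof. by move=> fg; exact: near_eq_is_derive. Qed.

Lemma is_derive1_near_eq f g (x d d' : R) : is_derive x 1 f d ->
  (\forall y \near x, f y = g y) -> d = d' -> is_derive x 1 g d'.
Proof. by move=> fd fg <-; exact: is_derive1_near fg fd. Qed.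

Lemma is_derive1_compr f g (x a b : R) : is_derive x 1 g b ->
  is_derive (g x) 1 f a -> is_derive x 1 (fun y => f (g y)) (a * b).
Proof. by move=> gb fa; exact: (@is_derive1_comp _ f g x a b fa gb). Qed.

Lemma is_derive1_near0 f (x : R) : (\forall y \near x, f y = 0) -> is_derive x 1 f 0.
Proof.
move=> f0; apply: (@is_derive1_near (cst 0)).
by apply: filterS f0 => y ->.
Qed.

Lemma cvg_near_eq f g (x l : R) : (\forall y \near x, f y = g y) ->
  f @ x --> l -> g @ x --> l.
Proof. by move=> fg; apply: cvg_trans; exact: near_eq_cvg. Qed.

(** For [a = p - 1] this is |y|^(p-2) y, written so that no negative exponent occurs when p < 2. *)
Definition sgpow (a y : R) := `|y| `^ a * Num.sg y.

Lemma near_gt0 (y : R) : 0 < y -> \forall z \near y, 0 < z.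
Proof. exact: lt_nbhsr. Qed.

Lemma powR_small (a e : R) : 0 < a -> 0 < e -> \forall h \near (0 : R), `|h| `^ a <= e.
Proof.
move=> a0 e0; have d0 : 0 < e `^ a^-1 by exact: powR_gt0.
apply/nbhs_ballP; exists (e `^ a^-1) => //= h; rewrite /ball /= sub0r normrN => he.
have -> : e = (e `^ a^-1) `^ a by rewrite -powRrM mulVf ?gt_eqF // powRr1 // ltW.
by apply: ge0_ler_powR; rewrite ?nnegrE ?powR_ge0 // ltW.
Qed.

Lemma continuous_powR (a y : R) : 0 < y -> (fun z => z `^ a) @ y --> y `^ a.
Proof. by move=> y0; exact: (is_derive1_continuous (is_derive1_powR a y0)). Qed.

Lemma continuous_sgpow (a : R) : 0 < a -> continuous (sgpow a).
Proof.
move=> a0 y; have [y0|y0|->] := ltgtP y 0; last first.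
- rewrite /continuous_at /sgpow sgr0 mulr0; apply/cvgr0Pnorm_le => e e0.
  have := powR_small a0 e0; apply: filterS => h he.
  rewrite /= normrM ger0_norm ?powR_ge0 //; apply: le_trans he.
  by rewrite ler_piMr ?powR_ge0 // normr_sg; case: (h != 0).
- apply: (@cvg_near_eq (fun z => z `^ a)).
    by apply: filterS (near_gt0 y0) => z z0; rewrite /sgpow gtr0_sg // mulr1 gtr0_norm.
  by rewrite /sgpow gtr0_sg // mulr1 gtr0_norm //; exact: continuous_powR.
- have ny0 : 0 < - y by rewrite oppr_gt0.
  apply: (@cvg_near_eq (fun z => - ((- z) `^ a))).
    have : \forall z \near y, z < 0 by exact: lt_nbhsl.
    by apply: filterS => z z0; rewrite /sgpow ltr0_sg // mulrN1 ltr0_norm.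
  rewrite /sgpow ltr0_sg // mulrN1 ltr0_norm //; apply: cvgN.
  apply: (@cvg_comp _ _ _ -%R (fun z => z `^ a)); last exact: continuous_powR.
  exact: opp_continuous.
Qed.

(** At the origin |h|^p = |h|^(p-1) |h| is o(h) because p > 1; elsewhere this is the power rule on
    either half-line. *)
Lemma is_derive_normpow (p y : R) : 1 < p ->
  is_derive y 1 (fun z => `|z| `^ p) (p * sgpow (p - 1) y).
Proof.
move=> p1; have p0 : 0 < p by lra.
have [y0|y0|->] := ltgtP y 0; last first.
- rewrite /sgpow sgr0 !mulr0; apply: is_derive_near_le => e e0.
  have p10 : 0 < p - 1 by lra.
  have := powR_small p10 e0; apply: filterS => h he.
  rewrite add0r normr0 powR0 ?gt_eqF // !subr0 mul0r subr0 ger0_norm ?powR_ge0 //.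
  by rewrite -mulr_powRB1 // mulrC ler_wpM2r.
- apply: (@is_derive1_near (fun z => z `^ p)).
    by apply: filterS (near_gt0 y0) => z z0; rewrite gtr0_norm.
  by rewrite /sgpow gtr0_sg // mulr1 gtr0_norm //; exact: is_derive1_powR.
- have ny0 : 0 < - y by rewrite oppr_gt0.
  apply: (@is_derive1_near (fun z => (- z) `^ p)).
    have : \forall z \near y, z < 0 by exact: lt_nbhsl.
    by apply: filterS => z z0; rewrite ltr0_norm.
  rewrite /sgpow ltr0_sg // ltr0_norm //.
  have := @is_derive1_comp _ (fun z => z `^ p) -%R y _ _ (is_derive1_powR p ny0)
    (is_deriveN (is_derive_id y 1)).
  by rewrite mulrA.
Qed.

Definition hmax (y : R) := Num.max y 0.

Lemma hmax_ge0 y : 0 <= hmax y.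
Proof. by rewrite le_max lexx orbT. Qed.

Lemma continuous_hmax : continuous hmax.
Proof. by move=> y; apply: continuous_max; [exact: cvg_id|exact: cvg_cst]. Qed.

(** Squaring makes the positive part C1. The radial cutoff and the bump of the test functions are
    both built on this square. *)
Lemma is_derive_hmax2 (y : R) : is_derive y 1 (fun z => hmax z ^+ 2) (2 * hmax y).
Proof.
have [y0|y0|->] := ltgtP y 0.
- have -> : hmax y = 0 by rewrite /hmax max_r // ltW.
  apply: (@is_derive1_near (cst 0)); last by rewrite mulr0; exact: is_derive_cst.
  have : \forall z \near y, z < 0 by exact: lt_nbhsl.
  by apply: filterS => z z0; rewrite /hmax max_r ?expr0n //= ltW.
- have -> : hmax y = y by rewrite /hmax max_l // ltW.
  apply: (@is_derive1_near (fun z => z * z)).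
    by apply: filterS (near_gt0 y0) => z z0; rewrite /hmax max_l ?expr2 // ltW.
  have := is_derive1M (is_derive_id y 1) (is_derive_id y 1).
  by rewrite mul1r mulr1 -mulr2n mulr_natl.
- have -> : hmax 0 = 0 by rewrite /hmax maxxx.
  apply: is_derive_near_le => e e0.
  have : \forall h \near (0 : R), `|h| <= e.
    have : (fun h : R => h) @ (0 : R) --> (0 : R) by exact: cvg_id.
    by move=> /cvgr0Pnorm_le /(_ e e0).
  apply: filterS => h he.
  rewrite add0r /hmax maxxx expr0n /= mulr0 mul0r !subr0 ger0_norm ?sqr_ge0 //.
  case: (leP h 0) => h0; first by rewrite expr0n /= mulr_ge0 // ltW.
  by rewrite gtr0_norm // in he *; rewrite expr2 ler_wpM2r // ltW.
Qed.

(* The cutoff ((r - d)_+ / r)^2: nondecreasing in r, vanishing for r <= d,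
   and increasing to 1 as d decreases to 0. *)
Definition cutoff (d r : R) := (hmax (r - d) / r) ^+ 2.

Lemma cutoff_ge0 d r : 0 <= cutoff d r.
Proof. exact: sqr_ge0. Qed.

Lemma hmax_le_div d r : 0 < d -> 0 <= r -> hmax (r - d) / r <= 1.
Proof.
move=> d0; rewrite le_eqVlt => /predU1P[<-|r0]; first by rewrite invr0 mulr0.
rewrite ler_pdivrMr // mul1r /hmax ge_max (ltW r0) andbT; lra.
Qed.

Lemma hmax_div_ge0 d r : 0 <= r -> 0 <= hmax (r - d) / r.
Proof. by move=> r0; rewrite mulr_ge0 ?hmax_ge0 // invr_ge0. Qed.

Lemma cutoff_le1 d r : 0 < d -> 0 <= r -> cutoff d r <= 1.
Proof. by move=> d0 r0; rewrite /cutoff expr_le1 // ?hmax_le_div // hmax_div_ge0. Qed.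

Lemma le_cutoff d1 d2 r : 0 <= r -> d1 <= d2 -> cutoff d2 r <= cutoff d1 r.
Proof.
move=> r0 d12; rewrite /cutoff ler_sqr ?nnegrE ?hmax_div_ge0 //.
rewrite ler_wpM2r ?invr_ge0 // /hmax ge_max !le_max lexx orbT andbT; apply/orP; left; lra.
Qed.

Lemma cutoff_cvg r : 0 < r -> cutoff k.+1%:R^-1 r @[k --> \oo] --> (1 : R).
Proof.
move=> r0.
have H : (fun d : R => cutoff d r) @ (0 : R) --> (1 : R).
  rewrite -(expr1n _ 2) -(divff (lt0r_neq0 r0)).
  apply: (@cvg_comp _ _ _ (fun d => hmax (r - d) / r) (fun z : R => z ^+ 2)); last exact: exprn_continuous.
  apply: cvgMl.
  have {2}-> : r = hmax (r - 0) by rewrite /hmax subr0 max_l // ltW.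
  apply: (@cvg_comp _ _ _ (fun d => r - d) hmax); last exact: continuous_hmax.
  by apply: cvgB; [exact: cvg_cst|exact: cvg_id].
by apply: cvg_comp H; exact: cvg_harmonic.
Qed.

Lemma measurable_hmax : measurable_fun setT (hmax : measurableTypeR R -> R).
Proof. by apply: measurable_maxr. Qed.

Lemma measurable_inv : measurable_fun setT (@GRing.inv R : measurableTypeR R -> R).
Proof.
(* The real power reduces the claim to measurability of [powR]; the identity holds at 0 as well,
   where both sides are 0. *)
rewrite (_ : GRing.inv = fun x : measurableTypeR R => x * (x ^+ 2) `^ (-1)); last first.
  apply/funext => x; rewrite powR_inv1 ?sqr_ge0 //.
  by have [->|x0] := eqVneq x 0; [rewrite invr0 mul0r|field].
apply: measurable_funM; first exact: measurable_id.
apply: (@measurableT_comp _ _ _ _ _ _ (@powR R ^~ (-1)) _ (fun x : measurableTypeR R => x ^+ 2)).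
  exact: measurable_powR.
by apply: measurable_funX.
Qed.

Lemma measurable_cutoff d : measurable_fun setT (cutoff d : measurableTypeR R -> R).
Proof.
apply: measurable_funX; apply: measurable_funM.
  apply: (measurableT_comp measurable_hmax).
  by apply: measurable_funB.
exact: measurable_inv.
Qed.

Definition C1_at f f' (x : R) := (\forall y \near x, is_derive (y : R) 1 f (f' y)) /\ {for x, continuous f'}.

(** The last factor is the derivative of (r - d) / r = 1 - d / r; for r <= d the factor
    [hmax (r - d)] makes the whole product 0. *)
Definition cutoff' (d r : R) := 2 * (hmax (r - d) / r) * (d / r ^+ 2).

Lemma cutoff'_ge0 d r : 0 < d -> 0 <= r -> 0 <= cutoff' d r.
Proof.
move=> d0 r0; rewrite /cutoff' !mulr_ge0 ?hmax_ge0 ?invr_ge0 ?exprn_ge0 //; lra.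
Qed.

Lemma cutoff0 d r : r <= d -> cutoff d r = 0.
Proof.
by move=> rd; rewrite /cutoff /hmax max_r ?mul0r ?expr0n //; lra.
Qed.

Lemma cutoff'0 d r : r <= d -> cutoff' d r = 0.
Proof.
by move=> rd; rewrite /cutoff' /hmax max_r ?mul0r ?mulr0 ?mul0r //; lra.
Qed.

Lemma is_derive1V (r : R) : r != 0 -> is_derive r 1 (fun x : R => x^-1) (- r ^- 2).
Proof.
move=> r0; have := @is_deriveV _ (fun x => x) r 1 1 r0 (is_derive_id r 1).
by rewrite /GRing.scale /= mulr1.
Qed.

Lemma is_derive_cutoff (d r : R) : 0 < d -> 0 < r -> is_derive r 1 (cutoff d) (cutoff' d r).
Proof.
move=> d0 r0.
have rn0 : r != 0 by rewrite gt_eqF.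
have H1 := is_derive1M (is_derive1V rn0) (is_derive1V rn0).
have H2 : is_derive r 1 (fun x => hmax (x - d) ^+ 2) (2 * hmax (r - d)).
  have := @is_derive1_comp _ (fun z => hmax z ^+ 2) (fun x => x - d) r _ _
    (is_derive_hmax2 (r - d)) (is_deriveB (is_derive_id r 1) (is_derive_cst d r 1)).
  by rewrite subr0 mulr1.
have H := is_derive1M H2 H1.
apply: (@is_derive1_near (fun x => hmax (x - d) ^+ 2 * (x^-1 * x^-1))).
  by near=> x; rewrite /cutoff exprMn [x^-1 ^+ 2]expr2.
apply: is_derive_eq; rewrite /cutoff' /hmax.
case: (leP (r - d) 0) => _; first by rewrite expr0n /= !(mul0r, mulr0) addr0.
by field.
Unshelve. all: by end_near.
Qed.

(** Below [d] the product vanishes in a neighbourhood, however singular [v] is there; regularity of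
    [v] is asked for at positive radii only. *)
Lemma C1_at_cutoff (v v' : R -> R) (d x : R) : 0 < d ->
  (x < d \/ 0 < x /\ C1_at v v' x) ->
  C1_at (fun r => v r * cutoff d r) (fun r => v' r * cutoff d r + v r * cutoff' d r) x.
Proof.
move=> d0 [xd|[x0 [vv' cv']]].
  have near_lt (y : R) : y < d -> \forall z \near y, z < d by exact: lt_nbhsl.
  split.
    apply: filterS (near_lt _ xd) => y yd.
    rewrite cutoff0 ?cutoff'0 ?mulr0 ?addr0; try exact: ltW.
    apply: is_derive1_near0.
    by apply: filterS (near_lt _ yd) => z zd; rewrite cutoff0 ?mulr0 // ltW.
  rewrite /prop_for /continuous_at cutoff0 ?cutoff'0 ?mulr0 ?addr0; try exact: ltW.
  apply: (@cvg_near_eq (cst 0)); last exact: cvg_cst.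
  by apply: filterS (near_lt _ xd) => z zd; rewrite cutoff0 ?cutoff'0 ?mulr0 ?addr0 // ltW.
split.
  near=> y; have y0 : 0 < y by near: y; exact: near_gt0.
  by apply: is_derive1M; [near: y|exact: is_derive_cutoff].
have cv : {for x, continuous v}.
  exact: (is_derive1_continuous (nbhs_singleton vv')).
have cc : {for x, continuous (cutoff d)}.
  exact: (is_derive1_continuous (is_derive_cutoff d0 x0)).
rewrite /prop_for /continuous_at; apply: cvgD; first by apply: cvgM; [exact: cv'|exact: cc].
have xn0 : x != 0 by rewrite gt_eqF.
apply: cvgM; first exact: cv.
apply: cvgM; first apply: cvgM; first exact: cvg_cst.
  apply: cvgM; last by apply: cvgV; [|exact: cvg_id].
  apply: (@cvg_comp _ _ _ (fun r => r - d) hmax); last exact: continuous_hmax.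
  by apply: cvgB; [exact: cvg_id|exact: cvg_cst].
apply: cvgM; first exact: cvg_cst.
apply: cvgV; first by rewrite expf_neq0.
exact: exprn_continuous.
Unshelve. all: by end_near.
Qed.

End one_variable.

(** * The radius, the Euler field and the horizontal gradient *)

Section radius.
Context {R : realType} (n : nat).
Local Notation N := n.*2.
Local Notation m := (n.*2.+1).
Implicit Types (x : 'rV[R]_m) (u : 'rV[R]_m -> R).
Local Notation wid := (widen_ord (leqnSn n.*2)).

Definition euler u x : R := \sum_(i < N) x ord0 (wid i) * partial (wid i) u x.

Lemma sum_halves (F : nat -> R) :
  \sum_(k < N) F k = \sum_(i < n) (F i + F (n + i)%N).
Proof.
rewrite -(big_mkord xpredT F) -addnn (@big_cat_nat _ _ _ n) //= ?leq_addr //.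
rewrite -{1}[X in \sum_(X <= _ < _ + _) _]add0n big_addn addnK !big_mkord -big_split /=.
by apply: eq_bigr => i _; rewrite addnC.
Qed.

Lemma wid_inord (i : 'I_N) : wid i = inord i.
Proof. by apply/val_inj; rewrite /= inordK // ltnS ltnW. Qed.

Lemma sqr_rr x : rr x ^+ 2 = \sum_(i < n) (xc x i ^+ 2 + yc x i ^+ 2).
Proof.
rewrite /rr sqr_sqrtr ?sumr_ge0 // => [|i _]; last exact: sqr_ge0.
under eq_bigr do rewrite wid_inord.
exact: (sum_halves (fun k => x ord0 (inord k) ^+ 2)).
Qed.

Lemma rr_ge0 x : 0 <= rr x. Proof. exact: sqrtr_ge0. Qed.

Lemma rr_sqrt x : rr x = Num.sqrt (\sum_(i < n) (xc x i ^+ 2 + yc x i ^+ 2)).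
Proof. by rewrite -sqr_rr sqrtr_sqr ger0_norm ?rr_ge0. Qed.

(** The sum of the squares (Q a_i - S A_i)^2 + (Q b_i - S B_i)^2 equals Q (Q P - S^2). If Q > 0 this
    is the claim; if Q = 0 all A_i and B_i vanish, and S with them. *)
Lemma cauchy_schwarz (a b A B : 'I_n -> R) :
  `|\sum_i (a i * A i + b i * B i)| <=
  Num.sqrt (\sum_i (a i ^+ 2 + b i ^+ 2)) * Num.sqrt (\sum_i (A i ^+ 2 + B i ^+ 2)).
Proof.
set S := \sum_i (a i * A i + _); set P := \sum_i (a i ^+ 2 + _); set Q := \sum_i (A i ^+ 2 + _).
have P0 : 0 <= P by apply: sumr_ge0 => i _; rewrite addr_ge0 ?sqr_ge0.
have Q0 : 0 <= Q by apply: sumr_ge0 => i _; rewrite addr_ge0 ?sqr_ge0.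
have H : 0 <= Q * (Q * P - S ^+ 2).
  have -> : Q * (Q * P - S ^+ 2) = \sum_i ((Q * a i - S * A i) ^+ 2 + (Q * b i - S * B i) ^+ 2).
    transitivity (Q ^+ 2 * P - 2 * Q * S * S + S ^+ 2 * Q); first by ring.
    have -> : Q ^+ 2 * P = \sum_i Q ^+ 2 * (a i ^+ 2 + b i ^+ 2) by rewrite {1}/P mulr_sumr.
    have -> : 2 * Q * S * S = \sum_i 2 * Q * S * (a i * A i + b i * B i).
      by rewrite {2}/S mulr_sumr.
    have -> : S ^+ 2 * Q = \sum_i S ^+ 2 * (A i ^+ 2 + B i ^+ 2) by rewrite {1}/Q mulr_sumr.
    rewrite -sumrB -big_split /=.
    by apply: eq_bigr => i _; ring.
  by apply: sumr_ge0 => i _; rewrite addr_ge0 ?sqr_ge0.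
rewrite -sqrtrM // -sqrtr_sqr ler_wsqrtr //.
move: Q0; rewrite le_eqVlt => /predU1P[Q0|Q0]; last first.
  by move: H; rewrite pmulr_rge0 // subr_ge0 mulrC.
suff -> : S = 0 by rewrite expr0n mulr_ge0 // -Q0.
have AB i : A i ^+ 2 + B i ^+ 2 = 0.
  have /psumr_eq0P : \sum_i (A i ^+ 2 + B i ^+ 2) = 0 by [].
  by apply => // j _; rewrite addr_ge0 ?sqr_ge0.
rewrite /S big1 // => i _.
have /eqP := AB i; rewrite paddr_eq0 ?sqr_ge0 // !sqrf_eq0 => /andP[/eqP -> /eqP ->].
by rewrite !mulr0 addr0.
Qed.

(* The t-component of the horizontal gradient does not contribute to the radial derivative. *)
Lemma normr_euler_le gamma u x : `|euler u x| <= rr x * gradL_norm gamma u x.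
Proof.
rewrite rr_sqrt; have -> : euler u x =
    \sum_(i < n) (xc x i * HG_X gamma i u x + yc x i * HG_Y gamma i u x).
  rewrite /euler; under eq_bigr do rewrite wid_inord.
  rewrite (sum_halves (fun k => x ord0 (inord k) * partial (inord k) u x)).
  by apply: eq_bigr => i _; rewrite /HG_X /HG_Y /xc /yc; ring.
exact: cauchy_schwarz.
Qed.

Lemma rr_dilzt (a b : R) x : 0 <= a -> rr (dilzt a b x) = a * rr x.
Proof.
move=> a0; rewrite /rr -{2}(ger0_norm a0) -sqrtr_sqr -sqrtrM ?sqr_ge0 //.
congr Num.sqrt; rewrite mulr_sumr; apply: eq_bigr => i _.
by rewrite mxE /= ltn_ord exprMn.
Qed.

Lemma continuous_rr : continuous (@rr R n).
Proof.
apply: continuous_rV_intro => x FF; rewrite /rr.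
apply: (@cvg_comp _ _ _ (fun x : 'rV[R]_m => \sum_(i < N) x ord0 (wid i) ^+ 2) Num.sqrt);
  last exact: sqrt_continuous.
apply: cvg_sumr => i.
apply: (@cvg_comp _ _ _ (fun x : 'rV[R]_m => x ord0 (wid i)) (fun z : R => z ^+ 2));
  last exact: exprn_continuous.
exact: coord_continuous.
Qed.

(** The chain rule produces z . grad_z u at the point (l z, t); the factor 1/l compensates for
    writing l z instead of z in the Euler field. *)
Lemma is_derive_dilzt u x (l : R) :
  (forall (k : 'I_m) x, derivable (fun s => u (upd x k s)) (x ord0 k) 1) ->
  (forall k : 'I_m, continuous (partial k u)) -> l != 0 ->
  is_derive l 1 (fun l => u (dilzt l 1 x)) (l^-1 * euler u (dilzt l 1 x)).
Proof.
move=> du cu l0.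
have E a : dilzt 0 1 x + a *: dilzt 1 0 x = dilzt a 1 x.
  by apply/rowP => j; rewrite !mxE; case: ifP => _; ring.
have := is_derive_affine du cu (dilzt 1 0 x) (dilzt 0 1 x) l.
under eq_fun do rewrite E.
rewrite E big_ord_recr /= [dilzt 1 0 x ord0 ord_max]mxE /= ltnn !mul0r addr0.
congr is_derive; rewrite /euler mulr_sumr; apply: eq_bigr => i _.
by rewrite !mxE /= ltn_ord mul1r mulrA mulKf.
Qed.

Lemma gradL_norm_ge0 gamma u x : 0 <= gradL_norm gamma u x.
Proof. exact: sqrtr_ge0. Qed.

Lemma rmeasurable_comp (f : R -> R) (h : 'rV[R]_m -> R) :
  measurable_fun setT (f : measurableTypeR R -> R) -> rV_rmeasurable h ->
  rV_rmeasurable (fun x => f (h x)).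
Proof. by move=> mf mh; exact: (measurableT_comp mf mh). Qed.

Lemma rmeasurable_rr : rV_rmeasurable (@rr R n).
Proof. by apply: continuous_rV_rmeasurable; exact: continuous_rr. Qed.

Lemma rmeasurable_gradL gamma u : (forall k : 'I_m, continuous (partial k u)) ->
  rV_rmeasurable (gradL_norm gamma u).
Proof.
move=> cu; rewrite /gradL_norm.
have mp (k : 'I_m) : rV_rmeasurable (partial k u).
  by apply: continuous_rV_rmeasurable; exact: cu.
have mr : rV_rmeasurable (fun x => rr x `^ (2 * gamma - 2)).
  by apply: (@rmeasurable_comp (fun z => z `^ (2 * gamma - 2))); [exact: measurable_powR|exact: rmeasurable_rr].
apply: (@rmeasurable_comp Num.sqrt).
  by apply: continuous_measurable_fun; exact: sqrt_continuous.
apply: measurable_sum => i; apply: measurable_funD; apply: measurable_funX.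
  apply: measurable_funD; first exact: mp.
  apply: measurable_funM; last exact: mp.
  apply: measurable_funM; last exact: mr.
  apply: measurable_funM; first exact: measurable_cst.
  exact: rV_measurable_coord.
apply: measurable_funB; first exact: mp.
apply: measurable_funM; last exact: mp.
apply: measurable_funM; last exact: mr.
apply: measurable_funM; first exact: measurable_cst.
exact: rV_measurable_coord.
Qed.

Lemma gradL_supp gamma u x : ~ closure [set x | u x != 0] x -> gradL_norm gamma u x = 0.
Proof.
move=> nx; rewrite /gradL_norm big1 ?sqrtr0 // => i _.
by rewrite /HG_X /HG_Y !partial_supp // !mulr0 subrr addr0 expr0n addr0.
Qed.

Lemma near_supp u x : ~ closure [set x | u x != 0] x ->
  \forall y \near x, ~ closure [set x | u x != 0] y.
Proof.
move=> nx.
have : open (~` closure [set x | u x != 0]) by apply: closed_openC; exact: closed_closure.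
by rewrite openE => /(_ _ nx).
Qed.

Lemma supp0 u x : ~ closure [set x | u x != 0] x -> u x = 0.
Proof. by move=> nx; apply: contrapT => /eqP ux; apply: nx; exact: subset_closure. Qed.

End radius.

(** Young's inequality for [a] and b^(p-1) with exponents p and p/(p-1), multiplied by p and
    arranged so that the difference of p-th powers stands alone. *)
Lemma young_powR {R : realType} (p a b : R) : 1 < p -> 0 <= a -> 0 <= b ->
  p * (b `^ (p - 1) * a) - p * b `^ p <= a `^ p - b `^ p.
Proof.
move=> p1 a0 b0; have p0 : 0 < p by lra.
have q0 : 0 < p / (p - 1) by rewrite divr_gt0 // subr_gt0.
have := @conjugate_powR _ a (b `^ (p - 1)) p (p / (p - 1)) a0 (powR_ge0 _ _) p0 q0.
have -> : p^-1 + (p / (p - 1))^-1 = 1 by field; apply/andP; split; lra.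
rewrite -powRrM (_ : (p - 1) * (p / (p - 1)) = p); last by field; lra.
move=> /(_ erefl); rewrite -(ler_pM2l p0) mulrDr.
have -> : p * (a `^ p / p) = a `^ p by field; lra.
have -> : p * (b `^ p / (p / (p - 1))) = (p - 1) * b `^ p by field; apply/andP; split; lra.
rewrite (mulrC a); lra.
Qed.

(** * Hardy inequalities *)

Section hardy.
Context {R : realType} (n : nat).
Local Notation N := n.*2.
Local Notation m := (n.*2.+1).
Implicit Types (x : 'rV[R]_m) (u : 'rV[R]_m -> R).

(** Adding k times the negative part of G on one side and k times its positive part on the other
    turns the hypothesis into an inequality of nonnegative functions. Both additions integrate to
    the finite number k I and cancel, even if [A] has infinite integral. *)
Lemma iint_cancel (A B : 'rV[R]_m -> R) (G : 'rV[R]_m -> R) (k I : R) : 0 <= k ->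
  (forall x, 0 <= A x) -> (forall x, 0 <= B x) -> rV_rmeasurable A -> rV_rmeasurable B ->
  has_iint (fun x => Num.max (G x) 0) I -> has_iint (fun x => Num.max (- G x) 0) I ->
  (forall x, B x - A x <= k * G x) ->
  (iint m (fun x => (B x)%:E) 0 <= iint m (fun x => (A x)%:E) 0)%E.
Proof.
move=> k0 A0 B0 mA mB hp hq AB.
have [kp0 mkp kpI] := has_iintZ k0 hp.
have [kq0 mkq kqI] := has_iintZ k0 hq.
rewrite -(@leeD2rE _ (k * I)%:E) //.
rewrite -{1}kqI -kpI -!iintD //; try by [|exact: rV_measurable_EFin].
apply: le_iint => [x|||x].
- by rewrite adde_ge0 // lee_fin.
- exact: (emeasurable_funD (rV_measurable_EFin mB) (rV_measurable_EFin mkq)).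
- exact: (emeasurable_funD (rV_measurable_EFin mA) (rV_measurable_EFin mkp)).
- rewrite -!EFinD lee_fin; have := AB x.
  have -> : k * G x = k * Num.max (G x) 0 - k * Num.max (- G x) 0.
    by rewrite -mulrBr; congr (_ * _); case: (leP (G x) 0) => ?; case: (leP (- G x) 0) => ?; lra.
  lra.
Qed.

Lemma C1_0_box (Omega : set 'rV[R]_m) u : C1_0 Omega u ->
  exists M, forall x, closure [set x | u x != 0] x -> box M x.
Proof.
move=> [_ _ /compact_bounded [M [_ HM]] _]; exists (M + 1) => x Sx j.
have M1 : M < M + 1 by rewrite ltrDl.
apply: le_trans (HM _ M1 x Sx).
by rewrite [leRHS]/Num.norm /= mx_normrE; apply/bigmax_geP; right => /=; exists (ord0, j).
Qed.

Lemma is_derive_expn (l : R) (k : nat) : l != 0 ->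
  is_derive l 1 (fun x : R => x ^+ k) (k%:R * l ^+ k / l).
Proof.
move=> l0; elim: k => [|k IH].
  by rewrite !mul0r; exact: (is_derive_cst (1 : R) l (1 : R)).
have H := is_derive1M (is_derive_id l (1 : R)) IH.
apply: (is_derive1_near_eq H); first by near=> x; rewrite exprS.
by rewrite exprS -[k.+1]addn1 natrD; field.
Unshelve. all: by end_near.
Qed.

Lemma normr_sgpow (a y : R) : `|sgpow a y| <= `|y| `^ a.
Proof.
rewrite /sgpow normrM ger0_norm ?powR_ge0 // ler_piMr ?powR_ge0 //.
by rewrite normr_sg; case: (y != 0).
Qed.

(* The sign e is -1 only for power weights with 2n + beta < 0, where u vanishes near r = 0
   and no cutoff is needed. *)
Lemma hardy_weighted (gamma p c e : R) (Omega : set 'rV[R]_m) u (tau W V V' : R -> R) :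
  1 < p -> 0 <= c -> e = 1 \/ e = -1 -> C1_0 Omega u ->
  measurable_fun setT (W : measurableTypeR R -> R) ->
  measurable_fun setT (tau : measurableTypeR R -> R) ->
  (forall x, closure [set x | u x != 0] x ->
    [/\ 0 <= W (rr x), 0 <= tau (rr x), V (rr x) = tau (rr x) * W (rr x),
        C1_at V V' (rr x) &
        p * c * W (rr x) <= e * (rr x * V' (rr x) + N%:R * V (rr x))]) ->
  (iint m (fun x => (c `^ p * (`|u x| `^ p * W (rr x)))%:E) 0 <=
   iint m (fun x => (gradL_norm gamma u x `^ p * (rr x `^ p * tau (rr x) `^ p * W (rr x)))%:E) 0)%E.
Proof.
move=> p1 c0 e1 C1u mW mtau HS.
have [M HM] := C1_0_box C1u.
have [du cu _ _] := C1u.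
set S := closure _ in HM HS.
have p0 : 0 < p by lra.
have pn0 : p != 0 by rewrite gt_eqF.
have cu0 : continuous u := C1_continuous du cu.
pose P (y : R) := `|y| `^ p.
pose P' (y : R) := p * sgpow (p - 1) y.
have P0 : P 0 = 0 by rewrite /P normr0 powR0.
have P'0 : P' 0 = 0 by rewrite /P' /sgpow sgr0 !mulr0.
have dP (y : R) : is_derive y 1 P (P' y) by exact: is_derive_normpow.
have cP : continuous P by move=> y; exact: (is_derive1_continuous (dP y)).
have cP' : continuous P'.
  by move=> y; apply: cvgM; [exact: cvg_cst|apply: continuous_sgpow; lra].
pose g x := V (rr x) * P (u x).
pose G x := P (u x) * (rr x * V' (rr x) + N%:R * V (rr x)) + V (rr x) * (P' (u x) * euler u x).
have gS x : ~ S x -> g x = 0 by move=> /supp0 ux; rewrite /g ux P0 mulr0.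
have GS x : ~ S x -> G x = 0.
  by move=> /supp0 ux; rewrite /G ux P0 P'0 !(mul0r, mulr0) addr0.
have ceu : continuous (euler u).
  apply: continuous_rV_intro => x FF; rewrite /euler; apply: cvg_sumr => i.
  by apply: cvgM; [exact: coord_continuous|exact: cu].
have cV x : S x -> (fun x => V (rr x)) @ x --> V (rr x).
  move=> /HS[_ _ _ [dV _] _].
  apply: (@cvg_comp _ _ _ (@rr R n) V); first exact: continuous_rr.
  exact: (is_derive1_continuous (nbhs_singleton dV)).
have cPu : continuous (fun x => P (u x)).
  by move=> x; apply: (@cvg_comp _ _ _ u P); [exact: cu0|exact: cP].
have off0 (h : 'rV[R]_m -> R) x : ProperFilter (nbhs x) -> (forall y, ~ S y -> h y = 0) -> ~ S x -> h @ x --> h x.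
  move=> FF hS nx; rewrite hS //; apply: (@cvg_trans _ ((fun _ : 'rV[R]_m => 0 : R) @ nbhs x)); last exact: cvg_cst.
  apply: near_eq_cvg; apply: filterS (near_supp nx) => y ny; by rewrite hS.
have cg : continuous g.
  apply: continuous_rV_intro => x FF.
  have [Sx|nSx] := pselect (S x); last exact: off0.
  by apply: cvgM; [exact: cV|exact: cPu].
have cG : continuous G.
  apply: continuous_rV_intro => x FF.
  have [Sx|nSx] := pselect (S x); last exact: off0.
  have [_ _ _ [_ cV'] _] := HS _ Sx.
  apply: cvgD; apply: cvgM; [exact: cPu| |exact: cV|].
    apply: cvgD; apply: cvgM; [exact: continuous_rr| |exact: cvg_cst|exact: cV].
    by apply: (@cvg_comp _ _ _ (@rr R n) V'); [exact: continuous_rr|exact: cV'].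
  apply: cvgM; last exact: ceu.
  by apply: (@cvg_comp _ _ _ u P'); [exact: cu0|exact: cP'].
have g0 x : 0 <= g x.
  have [Sx|/gS -> //] := pselect (S x).
  have [W0 t0 VE _ _] := HS _ Sx.
  by rewrite /g VE !mulr_ge0 // /P powR_ge0.
have dg x (l : R) : 0 < l ->
     is_derive l 1 (fun l => l ^+ N * g (dilzt l 1 x)) (l ^+ N / l * G (dilzt l 1 x)).
  move=> l0; have ln0 : l != 0 by rewrite gt_eqF.
  have cd : (fun a : R => dilzt a 1 x) @ l --> dilzt l 1 x.
    apply: cvg_rV => j; rewrite mxE; under eq_fun do rewrite mxE.
    by apply: cvgM; last exact: cvg_cst; case: ifP => _; [exact: cvg_id|exact: cvg_cst].
  have [Sx|nSx] := pselect (S (dilzt l 1 x)); last first.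
    rewrite GS // mulr0; apply: is_derive1_near0.
    have : \forall a \near l, ~ S (dilzt a 1 x) := cd _ (near_supp nSx).
    apply: filterS => a na.
    by rewrite gS ?mulr0.
  have [_ _ _ [dV _] _] := HS _ Sx.
  have {}dV := nbhs_singleton dV.
  rewrite rr_dilzt in dV; last exact: ltW.
  have H1 : is_derive l 1 (fun a => V (a * rr x)) (V' (l * rr x) * rr x).
    have H : is_derive l 1 (fun a : R => a * rr x) (rr x).
      apply: (is_derive1_near_eq (is_derive1M (is_derive_id l (1 : R)) (is_derive_cst (rr x) l (1 : R)))).
        by near=> a.
      by rewrite mul1r mulr0 addr0.
    exact: (is_derive1_compr H dV).
  have H2 := is_derive1_comp (dP (u (dilzt l 1 x))) (is_derive_dilzt x du cu ln0).
  apply: (is_derive1_near_eq (is_derive1M (is_derive_expn N ln0) (is_derive1M H1 H2))).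
    apply: filterS (near_gt0 l0) => a a0; rewrite /g rr_dilzt //; exact: ltW.
  by rewrite /G rr_dilzt ?ltW //=; field.
have [||I I0 [Ip In]] := @radial_divergence _ n g G M g0 cg cG _ _ dg.
- move=> x gx; apply: HM; apply: contrapT => /gS gx0; by rewrite gx0 eqxx in gx.
- move=> x gx; apply: HM; apply: contrapT => /GS gx0; by rewrite gx0 eqxx in gx.
have hp : has_iint (fun x => Num.max (G x) 0) I.
  by split => //; [move=> x; exact: hmax_ge0|apply: continuous_rV_rmeasurable; exact: continuous_max0].
have cnG : continuous (fun x => - G x) by move=> x; exact: (continuousN (cG x)).
have hq : has_iint (fun x => Num.max (- G x) 0) I.
  by split => //; [move=> x; exact: hmax_ge0|apply: continuous_rV_rmeasurable; exact: continuous_max0].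
have mWr : rV_rmeasurable (fun x => W (rr x)) by apply: rmeasurable_comp; last exact: rmeasurable_rr.
have mtr : rV_rmeasurable (fun x => tau (rr x)) by apply: rmeasurable_comp; last exact: rmeasurable_rr.
have mpow (h : 'rV[R]_m -> R) : rV_rmeasurable h -> rV_rmeasurable (fun x => h x `^ p).
  by move=> mh; apply: (@rmeasurable_comp _ _ (fun z => z `^ p)) => //; exact: measurable_powR.
have cp0 : 0 <= c `^ (p - 1) by exact: powR_ge0.
have HAB (e' := e) x : c `^ p * (`|u x| `^ p * W (rr x)) -
  gradL_norm gamma u x `^ p * (rr x `^ p * tau (rr x) `^ p * W (rr x)) <= c `^ (p - 1) * (e * G x).
  have [Sx|nSx] := pselect (S x); last first.
    by rewrite GS // gradL_supp // supp0 // normr0 powR0 // !(mul0r, mulr0) subrr.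
  have [W0 t0 VE _ HV] := HS _ Sx.
  set U := `|u x|; set D := gradL_norm gamma u x; set r := rr x.
  have U0 : 0 <= U by exact: normr_ge0.
  have r0 : 0 <= r by exact: rr_ge0.
  have D0 : 0 <= D by exact: gradL_norm_ge0.
  have a0 : 0 <= tau r * r * D by rewrite !mulr_ge0.
  have b0 : 0 <= c * U by rewrite mulr_ge0.
  (* Young's inequality with a = tau r |nabla_L u| and b = c |u|, weighted by W. The terms other
     than the two p-th powers share the factor c^(p-1), the multiple of G that appears in the
     claim. *)
  have := ler_wpM2l W0 (young_powR p1 a0 b0).
  rewrite !powRM ?mulr_ge0 // -/r.
  have cE : c `^ p = c * c `^ (p - 1) by rewrite mulr_powRB1.
  (* Only the absolute value of the term with E u is estimated, so the bound serves both signs of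
     [e]. *)
  have eV : - (e * (V r * (P' (u x) * euler u x))) <= tau r * W r * (p * U `^ (p - 1)) * (r * D).
    apply: le_trans (ler_norm _) _; rewrite normrN 3!normrM.
    have -> : `|e| = 1 by case: e1 => ->; rewrite ?normrN normr1.
    rewrite mul1r VE (ger0_norm (mulr_ge0 t0 W0)) mulrA ler_pM //.
    - by rewrite mulr_ge0 // mulr_ge0.
    - rewrite ler_wpM2l ?mulr_ge0 // normrM (gtr0_norm p0) ler_wpM2l ?normr_sgpow //; exact: ltW.
    - exact: normr_euler_le.
  have eW : p * c * W r * U `^ p <= U `^ p * (e * (r * V' r + N%:R * V r)).
    by rewrite mulrC ler_wpM2l ?powR_ge0.
  have {}eG : c `^ (p - 1) * (p * c * W r * U `^ p - tau r * W r * (p * U `^ (p - 1)) * (r * D)) <=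
      c `^ (p - 1) * (e * G x).
    rewrite ler_wpM2l // /G -/r; move: eW eV; rewrite /P -/U; lra.
  move=> Y; apply: le_trans eG; move: Y; rewrite cE; lra.
have A0 x : 0 <= gradL_norm gamma u x `^ p * (rr x `^ p * tau (rr x) `^ p * W (rr x)).
  have [Sx|nSx] := pselect (S x); last by rewrite gradL_supp // powR0 // mul0r.
  have [W0 _ _ _ _] := HS _ Sx.
  by rewrite !mulr_ge0 ?powR_ge0.
have B0 x : 0 <= c `^ p * (`|u x| `^ p * W (rr x)).
  have [Sx|nSx] := pselect (S x); last by rewrite supp0 // normr0 powR0 // mul0r mulr0.
  have [W0 _ _ _ _] := HS _ Sx.
  by rewrite !mulr_ge0 ?powR_ge0.
have mA : rV_rmeasurable (fun x => gradL_norm gamma u x `^ p * (rr x `^ p * tau (rr x) `^ p * W (rr x))).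
  apply: measurable_funM; first exact: (mpow _ (rmeasurable_gradL gamma cu)).
  apply: measurable_funM => //; apply: measurable_funM; first exact: (mpow _ (@rmeasurable_rr R n)).
  exact: (mpow _ mtr).
have mB : rV_rmeasurable (fun x => c `^ p * (`|u x| `^ p * W (rr x))).
  apply: measurable_funM; first exact: measurable_cst.
  apply: measurable_funM => //; exact: continuous_rV_rmeasurable cPu.
case: e1 => e1; rewrite e1 in HAB.
  by apply: (iint_cancel cp0 A0 B0 mA mB hp hq) => x; rewrite -[G x]mul1r; exact: HAB.
(* For e = -1 the roles of the positive and negative parts of G are exchanged. *)
apply: (@iint_cancel _ _ (fun x => - G x) _ _ cp0 A0 B0 mA mB hq) => [|x].
  by under eq_fun do rewrite opprK.
by rewrite -[- G x]mulN1r; exact: HAB.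
Unshelve. all: by end_near.
Qed.

End hardy.

Lemma mulr_powRB1_gt0 {R : realType} (b r : R) : 0 < r -> r * r `^ (b - 1) = r `^ b.
Proof.
by move=> r0; rewrite powRB ?(gt_eqF r0) ?implybT // powRr1 ?ltW // mulrCA divff ?mulr1 ?gt_eqF.
Qed.

(** * Hardy inequalities for power and logarithmic weights *)

Section hardy_inequalities.
Context {R : realType} (n : nat).
Hypothesis n0 : (0 < n)%N.
Local Notation N := n.*2.
Local Notation m := (n.*2.+1).
Implicit Types (x : 'rV[R]_m) (u : 'rV[R]_m -> R).

Lemma rr_gt0 x : (forall j : 'I_m, (j : nat) = 0%N -> x ord0 j != 0) -> 0 < rr x.
Proof.
move=> x0; have N0 : (0 < N)%N by rewrite double_gt0.
have xj : x ord0 (widen_ord (leqnSn N) (Ordinal N0)) != 0 by exact: x0.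
rewrite /rr sqrtr_gt0 (bigD1 (Ordinal N0)) //= ltr_pwDl //.
  by rewrite lt_neqAle sqr_ge0 eq_sym sqrf_eq0 xj.
by apply: sumr_ge0 => i _; exact: sqr_ge0.
Qed.

(** With weights w times cutoff the differential inequality for v survives, because v >= 0 and the
    cutoff has nonnegative derivative. On the right the cutoff is bounded by 1 before any limit is
    taken, so only the left side needs monotone convergence. *)
Lemma hardy_cutoff (gamma p c : R) (Omega : set 'rV[R]_m) u (tau w v v' : R -> R) :
  1 < p -> 0 <= c -> C1_0 Omega u ->
  measurable_fun setT (w : measurableTypeR R -> R) ->
  measurable_fun setT (tau : measurableTypeR R -> R) ->
  (forall r, 0 <= w r) ->
  (forall x, closure [set x | u x != 0] x -> 0 <= tau (rr x)) ->
  (forall x, closure [set x | u x != 0] x -> 0 < rr x ->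
    [/\ v (rr x) = tau (rr x) * w (rr x), C1_at v v' (rr x) &
        p * c * w (rr x) <= rr x * v' (rr x) + N%:R * v (rr x)]) ->
  (iint m (fun x => (c `^ p * (`|u x| `^ p * w (rr x)))%:E) 0 <=
   iint m (fun x => (gradL_norm gamma u x `^ p * (rr x `^ p * tau (rr x) `^ p * w (rr x)))%:E) 0)%E.
Proof.
move=> p1 c0 C1u mw mtau w0 tau0 HS.
have p0 : 0 < p by lra.
have [du cu _ _] := C1u.
have cu0 : continuous u := C1_continuous du cu.
pose B x := c `^ p * (`|u x| `^ p * w (rr x)).
pose A x := gradL_norm gamma u x `^ p * (rr x `^ p * tau (rr x) `^ p * w (rr x)).
pose d k : R := k.+1%:R^-1.
have d0 k : 0 < d k by rewrite invr_gt0.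
pose F k x : \bar R := (c `^ p * (`|u x| `^ p * (w (rr x) * cutoff (d k) (rr x))))%:E.
have mr := @rmeasurable_rr R n.
have mpow (h : 'rV[R]_m -> R) : rV_rmeasurable h -> rV_rmeasurable (fun x => h x `^ p).
  by move=> mh; apply: (@rmeasurable_comp _ _ (fun z => z `^ p)) => //; exact: measurable_powR.
have mwr : rV_rmeasurable (fun x => w (rr x)) by apply: rmeasurable_comp.
have mcr k : rV_rmeasurable (fun x => cutoff (d k) (rr x)).
  by apply: rmeasurable_comp => //; exact: measurable_cutoff.
have mA0 : rV_rmeasurable (fun x => gradL_norm gamma u x `^ p).
  exact: (mpow _ (rmeasurable_gradL gamma cu)).
have mA1 : rV_rmeasurable (fun x => rr x `^ p * tau (rr x) `^ p).
  apply: measurable_funM; first exact: mpow.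
  exact: (mpow _ (rmeasurable_comp mtau mr)).
have mA : rV_rmeasurable A by apply: measurable_funM => //; exact: measurable_funM.
have mU : rV_rmeasurable (fun x => `|u x| `^ p).
  apply: mpow; apply: continuous_rV_rmeasurable => x.
  by apply: (@cvg_comp _ _ _ u Num.norm); [exact: cu0|exact: norm_continuous].
have mB : rV_rmeasurable B.
  by apply: measurable_funM; [exact: measurable_cst|exact: measurable_funM].
have mF k : rV_measurable (F k).
  apply: rV_measurable_EFin; apply: measurable_funM; first exact: measurable_cst.
  by apply: measurable_funM => //; apply: measurable_funM; [exact: mwr|exact: mcr].
have wc0 k x : 0 <= w (rr x) * cutoff (d k) (rr x) by apply: mulr_ge0 => //; exact: cutoff_ge0.
have F0 k x : (0 <= F k x)%E.
  by rewrite lee_fin; apply: mulr_ge0; [exact: powR_ge0|apply: mulr_ge0 => //; exact: powR_ge0].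
have FA k : (iint m (F k) 0 <= iint m (fun x => (A x)%:E) 0)%E.
  apply: (@le_trans _ _ (iint m (fun x => (gradL_norm gamma u x `^ p *
      (rr x `^ p * tau (rr x) `^ p * (w (rr x) * cutoff (d k) (rr x))))%:E) 0)).
    apply: (@hardy_weighted _ _ gamma p c 1 Omega u tau (fun r => w r * cutoff (d k) r)
      (fun r => v r * cutoff (d k) r)
      (fun r => v' r * cutoff (d k) r + v r * cutoff' (d k) r)) => //.
    - by left.
    - by apply: measurable_funM => //; exact: measurable_cutoff.
    move=> x Sx; have := rr_ge0 x; rewrite le_eqVlt => /predU1P[r0|r0].
      have rd : rr x <= d k by rewrite -r0 ltW.
      rewrite (cutoff0 rd) (cutoff'0 rd) !(mulr0, addr0); split => //.
        exact: tau0.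
      by apply: C1_at_cutoff => //; left; rewrite -r0.
    have [vE C1v Hv] := HS x Sx r0.
    have v0 : 0 <= v (rr x) by rewrite vE mulr_ge0 // tau0.
    split => //; first exact: tau0.
    - by rewrite vE mulrA.
    - by apply: C1_at_cutoff => //; right.
    - rewrite mul1r.
      have H1 := ler_wpM2r (cutoff_ge0 (d k) (rr x)) Hv.
      have H2 : 0 <= rr x * (v (rr x) * cutoff' (d k) (rr x)).
        apply: mulr_ge0; first exact: ltW.
        by apply: mulr_ge0 => //; apply: cutoff'_ge0 => //; exact: ltW.
      lra.
  apply: le_iint => [x|||x].
  - rewrite lee_fin; apply: mulr_ge0; first exact: powR_ge0.
    by apply: mulr_ge0 => //; rewrite mulr_ge0 ?powR_ge0.
  - apply: rV_measurable_EFin; apply: measurable_funM => //; apply: measurable_funM => //.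
    by apply: measurable_funM; [exact: mwr|exact: mcr].
  - exact: rV_measurable_EFin.
  - rewrite lee_fin /A !ler_wpM2l ?mulr_ge0 ?powR_ge0 //.
    by rewrite ler_piMr // cutoff_le1 // rr_ge0.
(* Every cutoff vanishes at r = 0, so the monotone limit is [B] times the indicator of r > 0. It
   differs from [B] only on the axis. *)
pose pos (r : R) : R := \1_(`]0, +oo[%classic) r.
have pos1 r : 0 < r -> pos r = 1.
  by move=> r0; rewrite /pos indicE mem_set //= in_itv /= r0.
have pos0 : pos 0 = 0 by rewrite /pos indicE memNset //= in_itv /= ltxx.
pose F' x : \bar R := (B x * pos (rr x))%:E.
have FF' x : F ^~ x @ \oo --> F' x.
  rewrite /F'; have := rr_ge0 x; rewrite le_eqVlt => /predU1P[r0|r0].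
    rewrite -r0 pos0 mulr0; apply: cvg_near_cst; near=> k.
    by rewrite /F -r0 cutoff0 ?mulr0 // ltW.
  rewrite pos1 // mulr1; apply: cvg_EFin; first by near=> k.
  have -> : B x = c `^ p * (`|u x| `^ p * (w (rr x) * 1)) by rewrite mulr1.
  by do 3 (apply: cvgM; first exact: cvg_cst); exact: cutoff_cvg.
have mF' : rV_measurable F'.
  apply: rV_measurable_EFin; apply: measurable_funM => //.
  by apply: rmeasurable_comp => //; exact: measurable_indic.
have B0 x : 0 <= B x by rewrite !mulr_ge0 ?powR_ge0.
have -> : iint m (fun x => (B x)%:E) 0 = iint m F' 0.
  apply: eq_iint_off0 => // [x||x xn0].
  - by rewrite lee_fin mulr_ge0.
  - exact: rV_measurable_EFin.
  - by rewrite /F' pos1 ?mulr1 // rr_gt0.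
have cF : iint m (F k) 0 @[k --> \oo] --> iint m F' 0.
  apply: iint_cvg => // x i j ij; rewrite lee_fin !ler_wpM2l ?powR_ge0 //.
  apply: le_cutoff; first exact: rr_ge0.
  by rewrite lef_pV2 ?posrE // ler_nat ltnS.
rewrite -(cvg_lim _ cF) //; apply: lime_le; first by apply/cvg_ex; eexists; exact: cF.
by near=> k; exact: FA.
Unshelve. all: by end_near.
Qed.

Lemma integral_onE (Omega : set 'rV[R]_m) (f : 'rV[R]_m -> R) :
  (forall x, ~ Omega x -> f x = 0) -> integral_on Omega f = iint m (fun x => (f x)%:E) 0.
Proof.
move=> f0; rewrite /integral_on; congr iint; apply/funext => x.
case: ifP => // /negbT xO; rewrite f0 // => Ox.
by move: xO; rewrite mem_set.
Qed.

(** The function max(f, g) dominates [f] everywhere and equals [g] off the axis, which reduces a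
    comparison off the axis to a comparison everywhere. *)
Lemma le_iint_off0 (f g : 'rV[R]_m -> R) : (forall x, 0 <= f x) -> (forall x, 0 <= g x) ->
  rV_rmeasurable f -> rV_rmeasurable g -> (forall x, 0 < rr x -> f x <= g x) ->
  (iint m (fun x => (f x)%:E) 0 <= iint m (fun x => (g x)%:E) 0)%E.
Proof.
move=> f0 g0 mf mg fg.
have mh : rV_measurable (fun x => (Num.max (f x) (g x))%:E).
  by apply: rV_measurable_EFin; exact: measurable_maxr.
have -> : iint m (fun x => (g x)%:E) 0 = iint m (fun x => (Num.max (f x) (g x))%:E) 0.
  apply: eq_iint_off0 => // [x||x xn0].
  - by rewrite lee_fin le_max f0.
  - exact: rV_measurable_EFin.
  - by rewrite max_r // fg // rr_gt0.
apply: le_iint => // [|x]; rewrite ?lee_fin //; first exact: rV_measurable_EFin.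
by rewrite le_max lexx.
Qed.

Lemma C1_0_off (Omega : set 'rV[R]_m) u x : C1_0 Omega u -> ~ Omega x ->
  ~ closure [set x | u x != 0] x.
Proof. by move=> [_ _ _ SO] nO /SO. Qed.

Lemma rmeasurable_powR (p : R) (h : 'rV[R]_m -> R) : rV_rmeasurable h ->
  rV_rmeasurable (fun x => h x `^ p).
Proof. by move=> mh; apply: (@rmeasurable_comp _ _ (fun z => z `^ p)) => //; exact: measurable_powR. Qed.

Lemma rmeasurable_normpow (p : R) u : continuous u -> rV_rmeasurable (fun x => `|u x| `^ p).
Proof.
move=> cu; apply: rmeasurable_powR; apply: continuous_rV_rmeasurable => x.
by apply: (@cvg_comp _ _ _ u Num.norm); [exact: cu|exact: norm_continuous].
Qed.

Lemma rmeasurableM (f g : 'rV[R]_m -> R) : rV_rmeasurable f -> rV_rmeasurable g ->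
  rV_rmeasurable (fun x => f x * g x).
Proof. by move=> mf mg; exact: measurable_funM. Qed.

Lemma rmeasurable_inv (h : 'rV[R]_m -> R) : rV_rmeasurable h ->
  rV_rmeasurable (fun x => (h x)^-1).
Proof. by move=> mh; apply: (@rmeasurable_comp _ _ GRing.inv) => //; exact: measurable_inv. Qed.

Lemma C1_at_powR (b r : R) : 0 < r ->
  C1_at (fun z => z `^ b) (fun z => b * z `^ (b - 1)) r.
Proof.
move=> r0; split.
  by apply: filterS (near_gt0 r0) => z z0; exact: is_derive1_powR.
by apply: cvgM; [exact: cvg_cst|exact: continuous_powR].
Qed.

Lemma iint_EFin_ge0 (f : 'rV[R]_m -> R) : (forall x, 0 <= f x) ->
  (0 <= iint m (fun x => (f x)%:E) 0)%E.
Proof. by move=> f0; apply: iint_ge0 => x; rewrite lee_fin. Qed.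

(** For V = r^beta one has r V' + 2n V = (2n + beta) r^beta exactly, so the differential inequality
    holds with equality for c = |2n + beta| / p and e the sign of 2n + beta. When that sign is
    negative the support of [u] avoids r = 0 by the hypothesis on Omega. *)
Lemma hardy_power (gamma beta p : R) (Omega : set 'rV[R]_m) u : 1 < p ->
  (N%:R + beta < 0 -> Omega `<=` [set xi | rr xi != 0]) -> C1_0 Omega u ->
  (((`|N%:R + beta| / p) `^ p)%:E
     * integral_on Omega (fun xi => `|u xi| `^ p * rr xi `^ beta)%R
   <= integral_on Omega (fun xi => gradL_norm gamma u xi `^ p * rr xi `^ (p + beta))%R)%E.
Proof.
move=> p1 Om0 C1u; have p0 : 0 < p by lra.
have pn0 : p != 0 by rewrite gt_eqF.
have [du cu _ SO] := C1u.
have cu0 : continuous u := C1_continuous du cu.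
rewrite !integral_onE; last 2 first.
- by move=> x /(C1_0_off C1u) nS; rewrite gradL_supp // powR0 // mul0r.
- by move=> x /(C1_0_off C1u) nS; rewrite supp0 // normr0 powR0 // mul0r.
set B := iint m _ 0; set A := iint m _ 0.
have A0 : (0 <= A)%E by apply: iint_EFin_ge0 => x; rewrite mulr_ge0 ?powR_ge0.
set b := N%:R + beta in Om0 *.
(* Here the constant on the left is 0^p = 0. *)
have [b0|b0] := eqVneq b 0; first by rewrite b0 normr0 mul0r powR0 // mul0e.
set c := `|b| / p.
have c0 : 0 <= c by rewrite divr_ge0 // ltW.
have mr := @rmeasurable_rr R n.
have mB : rV_rmeasurable (fun x => `|u x| `^ p * rr x `^ beta).
  by apply: measurable_funM; [exact: rmeasurable_normpow|exact: rmeasurable_powR].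
pose A' := iint m (fun x => (gradL_norm gamma u x `^ p * (rr x `^ p * 1 `^ p * rr x `^ beta))%:E) 0.
have A'A : (A' <= A)%E.
  apply: le_iint => [x|||x]; rewrite ?lee_fin.
  - by rewrite !mulr_ge0 ?powR_ge0.
  - apply: rV_measurable_EFin; apply: measurable_funM.
      exact: (rmeasurable_powR _ (rmeasurable_gradL gamma cu)).
    apply: measurable_funM; last exact: rmeasurable_powR.
    by apply: measurable_funM; [exact: rmeasurable_powR|exact: measurable_cst].
  - apply: rV_measurable_EFin; apply: measurable_funM.
      exact: (rmeasurable_powR _ (rmeasurable_gradL gamma cu)).
    exact: rmeasurable_powR.
  - rewrite ler_wpM2l ?powR_ge0 // powR1 mulr1.
    (* Off the axis the two weights agree. At r = 0 the factor 0^p makes the left one 0, whereas the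
       right one is 1 by default if p + beta = 0. *)
    have := rr_ge0 x; rewrite le_eqVlt => /predU1P[<-|r0].
      by rewrite powR0 // mul0r powR_ge0.
    by rewrite powRD ?lexx // (gt_eqF r0) implybT.
apply: le_trans A'A.
rewrite /B -iintZl ?powR_ge0 //; last 2 first.
- by move=> x; rewrite lee_fin mulr_ge0 ?powR_ge0.
- exact: rV_measurable_EFin.
under [X in iint _ X _]funext do rewrite -EFinM.
have mw : measurable_fun setT ((fun r => r `^ beta) : measurableTypeR R -> R).
  exact: measurable_powR.
have [bn|bp] : b < 0 \/ 0 < b.
- by move: b0; rewrite neq_lt => /orP.
- apply: (@hardy_weighted _ _ gamma p c (-1) Omega u (fun=> 1) (fun r => r `^ beta)
    (fun r => r `^ beta) (fun r => beta * r `^ (beta - 1))) => //; first by right.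
  move=> x /SO /(Om0 bn) /= rn0.
  have r0 : 0 < rr x by rewrite lt_neqAle eq_sym rn0 rr_ge0.
  split; rewrite ?powR_ge0 ?ler01 ?mul1r //; first exact: C1_at_powR.
  rewrite /c ltr0_norm // mulrCA divff // mulr1 mulrCA mulr_powRB1_gt0 //.
  rewrite /b; lra.
- apply: (@hardy_cutoff gamma p c Omega u (fun=> 1) (fun r => r `^ beta)
    (fun r => r `^ beta) (fun r => beta * r `^ (beta - 1))) => //.
    by move=> r; exact: powR_ge0.
  move=> x _ r0; split; rewrite ?mul1r //; first exact: C1_at_powR.
  rewrite /c gtr0_norm // mulrCA divff // mulr1 mulrCA mulr_powRB1_gt0 //.
  rewrite /b; lra.
Qed.

Lemma le_rr_NN gamma x : 1 <= gamma -> rr x <= NN gamma x.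
Proof.
move=> g1; have g0 : 0 < 4 * gamma by lra.
have -> : rr x = (rr x `^ (4 * gamma)) `^ (4 * gamma)^-1.
  by rewrite -powRrM divff ?gt_eqF // powRr1 // rr_ge0.
apply: ge0_ler_powR; rewrite ?nnegrE ?invr_ge0 ?addr_ge0 ?powR_ge0 ?sqr_ge0 //; first exact: ltW.
by rewrite lerDl sqr_ge0.
Qed.

(** Pointwise r <= N gives the comparison wherever r > 0. It may fail on the axis, where 1 / 0 = 0
    makes the integrand with r vanish. *)
Lemma hardy_gauge_le (gamma p C : R) (Omega : set 'rV[R]_m) u : 1 < p -> 1 <= gamma ->
  0 <= C -> C1_0 Omega u ->
  (C%:E * integral_on Omega (fun xi => `|u xi| `^ p / NN gamma xi `^ p)%R
   <= C%:E * integral_on Omega (fun xi => `|u xi| `^ p / rr xi `^ p)%R)%E.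
Proof.
move=> p1 g1 C0 C1u; have p0 : 0 < p by lra.
have [du cu _ SO] := C1u.
have cu0 : continuous u := C1_continuous du cu.
rewrite !integral_onE; last 2 first.
- by move=> x /(C1_0_off C1u) nS; rewrite supp0 // normr0 powR0 ?gt_eqF // mul0r.
- by move=> x /(C1_0_off C1u) nS; rewrite supp0 // normr0 powR0 ?gt_eqF // mul0r.
have mr := @rmeasurable_rr R n.
apply: lee_wpmul2l; first by rewrite lee_fin.
apply: le_iint_off0 => [x|x|||x r0].
- by rewrite mulr_ge0 ?invr_ge0 ?powR_ge0.
- by rewrite mulr_ge0 ?invr_ge0 ?powR_ge0.
- apply: rmeasurableM; first exact: rmeasurable_normpow.
  apply: rmeasurable_inv; apply: rmeasurable_powR; apply: rmeasurable_powR.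
  apply: measurable_funD; first exact: rmeasurable_powR.
  by apply: measurable_funX; exact: rV_measurable_coord.
- apply: rmeasurableM; first exact: rmeasurable_normpow.
  by apply: rmeasurable_inv; exact: rmeasurable_powR.
- have H := le_rr_NN x g1.
  have NN0 : 0 < NN gamma x by exact: lt_le_trans H.
  have P1 : 0 < NN gamma x `^ p by exact: powR_gt0.
  have P2 : 0 < rr x `^ p by exact: powR_gt0.
  rewrite ler_wpM2l ?powR_ge0 // lef_pV2 ?posrE //.
  by apply: ge0_ler_powR; rewrite ?nnegrE ?rr_ge0 ?powR_ge0 // ltW.
Qed.

(** As p = 2n, the field z r^(-p) is divergence free away from r = 0: in r v' + 2n v the two terms
    with factor p cancel, and the derivative of tau^(beta + 1) leaves -(beta + 1) w. This is p c w,
    positive because beta < -1. *)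
Lemma hardy_log (gamma beta Rad : R) u : 0 < Rad -> beta < -1 ->
  let p : R := N%:R in
  let Omega := [set xi : 'rV[R]_m | rr xi < Rad] in
  C1_0 Omega u ->
  (((`|beta + 1| / p) `^ p)%:E
    * integral_on Omega (fun xi => `|u xi| `^ p / rr xi `^ p * ln (Rad / rr xi) `^ beta)%R
  <= integral_on Omega (fun xi => gradL_norm gamma u xi `^ p * ln (Rad / rr xi) `^ (p + beta))%R)%E.
Proof.
move=> Rad0 b1 p Omega C1u.
have p2 : 2 <= p by rewrite /p ler_nat -[2%N]/(1.*2) leq_double.
have p0 : 0 < p by lra.
have p1 : 1 < p by lra.
have pn0 : p != 0 by rewrite gt_eqF.
have [du cu _ SO] := C1u.
have cu0 : continuous u := C1_continuous du cu.
rewrite !integral_onE; last 2 first.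
- by move=> x /(C1_0_off C1u) nS; rewrite gradL_supp // powR0 // mul0r.
- by move=> x /(C1_0_off C1u) nS; rewrite supp0 // normr0 powR0 // !mul0r.
set c := `|beta + 1| / p.
have c0 : 0 <= c by rewrite divr_ge0 // ltW.
pose tau r := ln (Rad / r).
pose w r := (r `^ p)^-1 * tau r `^ beta.
pose v r := r `^ (- p) * tau r `^ (beta + 1).
pose v' r := (- p * r `^ (- p - 1)) * tau r `^ (beta + 1) +
  r `^ (- p) * ((beta + 1) * tau r `^ (beta + 1 - 1) * - r^-1).
have mr := @rmeasurable_rr R n.
have mtau : measurable_fun setT (tau : measurableTypeR R -> R).
  apply: (@measurableT_comp _ _ _ _ _ _ (@ln R) _ (fun r : measurableTypeR R => Rad / r)).
    exact: measurable_ln.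
  by apply: measurable_funM => //; exact: measurable_inv.
have mw : measurable_fun setT (w : measurableTypeR R -> R).
  apply: measurable_funM.
    apply: (@measurableT_comp _ _ _ _ _ _ (@GRing.inv R) _ (fun r : measurableTypeR R => r `^ p)).
      exact: measurable_inv.
    exact: measurable_powR.
  apply: (@measurableT_comp _ _ _ _ _ _ (@powR R ^~ beta) _ tau) => //; exact: measurable_powR.
have mwr : rV_rmeasurable (fun x => w (rr x)) by apply: rmeasurable_comp.
have mtr : rV_rmeasurable (fun x => tau (rr x)) by apply: rmeasurable_comp.
have w0 r : 0 <= w r by rewrite mulr_ge0 ?invr_ge0 ?powR_ge0.
have tau_gt0 r : 0 < r -> r < Rad -> 0 < tau r.
  by move=> r0 rR; apply: ln_gt0; rewrite ltr_pdivlMr // mul1r.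
have mg := rmeasurable_powR p (rmeasurable_gradL gamma cu).
apply: (@le_trans _ _ (iint m (fun x => (gradL_norm gamma u x `^ p *
    (rr x `^ p * tau (rr x) `^ p * w (rr x)))%:E) 0)); last first.
  apply: le_iint => [x|||x]; rewrite ?lee_fin.
  - by rewrite !mulr_ge0 ?invr_ge0 ?powR_ge0.
  - apply: rV_measurable_EFin; apply: rmeasurableM => //; apply: rmeasurableM => //.
    by apply: rmeasurableM; exact: rmeasurable_powR.
  - by apply: rV_measurable_EFin; apply: rmeasurableM => //; exact: (rmeasurable_powR _ mtr).
  - have [Sx|nSx] := pselect (closure [set x | u x != 0] x); last first.
      by rewrite gradL_supp // powR0 // !mul0r.
    have rR : rr x < Rad := SO x Sx.
    rewrite ler_wpM2l ?powR_ge0 //.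
    have := rr_ge0 x; rewrite le_eqVlt => /predU1P[<-|r0].
      by rewrite [0 `^ p]powR0 // !mul0r powR_ge0.
    have t0 := tau_gt0 _ r0 rR.
    rewrite powRD ?(gt_eqF t0) ?implybT // /w -/(tau _).
    rewrite [X in X <= _](_ : _ = tau (rr x) `^ p * tau (rr x) `^ beta) //.
    by field; rewrite gt_eqF // powR_gt0.
rewrite -iintZl ?powR_ge0 //; last 2 first.
- by move=> x; rewrite lee_fin !mulr_ge0 ?invr_ge0 ?powR_ge0.
- apply: rV_measurable_EFin; rewrite /rV_rmeasurable.
  under eq_fun do rewrite -mulrA.
  by apply: measurable_funM => //; exact: rmeasurable_normpow.
rewrite (_ : iint m _ 0 = iint m (fun x => (c `^ p * (`|u x| `^ p * w (rr x)))%:E) 0); last first.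
  by congr iint; apply/funext => x; rewrite -EFinM /w /tau -!mulrA.
apply: (@hardy_cutoff gamma p c Omega u tau w v v') => // x Sx.
  (* On the axis the default values 1 / 0 = 0 and ln 0 = 0 give tau = 0, which is still
     nonnegative. *)
  have := rr_ge0 x; rewrite le_eqVlt => /predU1P[<-|r0].
    by rewrite /tau invr0 mulr0 ln0.
  by apply/ltW/tau_gt0 => //; exact: SO.
move=> r0; have rR : rr x < Rad := SO x Sx.
have t0 := tau_gt0 _ r0 rR.
have rn0 : rr x != 0 by rewrite gt_eqF.
have tE : tau (rr x) `^ (beta + 1) = tau (rr x) * tau (rr x) `^ beta.
  by rewrite -[beta in RHS](addrK 1) mulr_powRB1_gt0.
have near_pos : \forall r \near rr x, 0 < r < Rad.
  near=> r; apply/andP; split; near: r; [exact: near_gt0|exact: lt_nbhsl].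
have dtau r : 0 < r < Rad -> is_derive r 1 tau (- r^-1).
  move=> /andP[r00 rRad].
  have rr0 : r != 0 by rewrite gt_eqF.
  have H := is_derive1M (is_derive_cst Rad r (1 : R)) (is_derive1V rr0).
  apply: (is_derive1_near_eq (is_derive1_compr H (is_derive1_ln _))).
  - by rewrite divr_gt0.
  - by near=> z.
  - by rewrite mul0r add0r /=; field; rewrite rr0 gt_eqF.
split.
- by rewrite /v /w tE powRN mulrCA.
- split.
    apply: filterS near_pos => r /[dup] rI /andP[r00 rRad]; apply: is_derive1M; first exact: is_derive1_powR.
    exact: (is_derive1_compr (dtau r rI) (is_derive1_powR _ (tau_gt0 _ r00 rRad))).
  have ct : {for rr x, continuous tau} by apply: is_derive1_continuous (dtau _ _); rewrite r0.
  have ctp a : (fun r => tau r `^ a) @ rr x --> tau (rr x) `^ a.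
    by apply: (@cvg_comp _ _ _ tau (fun z => z `^ a)); [exact: ct|exact: continuous_powR].
  rewrite /prop_for /continuous_at; apply: cvgD.
    apply: cvgM; last exact: ctp.
    by apply: cvgM; [exact: cvg_cst|exact: continuous_powR].
  apply: cvgM; first exact: continuous_powR.
  apply: cvgM; first by apply: cvgM; [exact: cvg_cst|exact: ctp].
  by apply: cvgN; apply: cvgV => //; exact: cvg_id.
- have -> : p * c = - (beta + 1).
    by rewrite /c mulrCA divff // mulr1 ltr0_norm //; lra.
  rewrite /v' /v addrK tE /w -/p.
  have -> : rr x `^ (- p - 1) = rr x `^ (- p) / rr x.
    by rewrite -(mulr_powRB1_gt0 (- p) r0) mulrAC divff // mul1r.
  rewrite powRN le_eqVlt; apply/orP; left; apply/eqP; field.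
  by rewrite rn0 gt_eqF // powR_gt0.
Unshelve. all: by end_near.
Qed.

End hardy_inequalities.

(** * Test functions separated in r and t *)

Section test_function.
Context {R : realType} (n : nat).
Local Notation N := n.*2.
Local Notation m := (n.*2.+1).
Implicit Types (x : 'rV[R]_m) (u : 'rV[R]_m -> R).
Local Notation wid := (widen_ord (leqnSn n.*2)).

Variables (k k' phi phi' : R -> R) (a b T : R).
Hypothesis a0 : 0 < a.
Hypothesis dk : forall r : R, is_derive r 1 k (k' r).
Hypothesis ck' : continuous k'.
Hypothesis ksupp : forall r, ~ (a <= r <= b) -> k r = 0 /\ k' r = 0.
Hypothesis dphi : forall t : R, is_derive t 1 phi (phi' t).
Hypothesis cphi' : continuous phi'.
Hypothesis phisupp : forall t, T < `|t| -> phi t = 0.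

Definition separated x : R := k (rr x) * phi (tt x).
Local Notation u := separated.

Lemma is_derive_rr x (i : 'I_N) : 0 < rr x ->
  is_derive (x ord0 (wid i)) 1 (fun s => rr (upd x (wid i) s)) (x ord0 (wid i) / rr x).
Proof.
move=> r0.
pose q : R := \sum_(j < N | j != i) x ord0 (wid j) ^+ 2.
have rE s : rr (upd x (wid i) s) = Num.sqrt (s ^+ 2 + q).
  rewrite /rr (bigD1 i) //= mxE eqxx; congr (Num.sqrt (_ + _)).
  apply: eq_bigr => j ji; rewrite mxE /=; case: eqP => // /val_inj ji'.
  by rewrite ji' eqxx in ji.
have rxE : rr x = Num.sqrt (x ord0 (wid i) ^+ 2 + q) by rewrite -rE upd_id.
have q0 : 0 < x ord0 (wid i) ^+ 2 + q by rewrite -sqrtr_gt0 -rxE.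
have H1 := is_deriveD (is_derive1M (is_derive_id (x ord0 (wid i)) (1 : R)) (is_derive_id (x ord0 (wid i)) (1 : R)))
  (is_derive_cst q (x ord0 (wid i)) (1 : R)).
have H2 := is_derive1_sqrt q0; rewrite expr2 in H2.
apply: (is_derive1_near_eq (is_derive1_compr H1 H2)).
  by near=> s; rewrite rE expr2.
by rewrite -expr2 -rxE; field; rewrite gt_eqF.
Unshelve. all: by end_near.
Qed.

Lemma normr_le_rr x (i : 'I_N) : `|x ord0 (wid i)| <= rr x.
Proof.
rewrite -sqrtr_sqr ler_wsqrtr // (bigD1 i) //= lerDl.
by apply: sumr_ge0 => j _; exact: sqr_ge0.
Qed.

Lemma tt_upd_wid x (i : 'I_N) s : tt (upd x (wid i) s) = tt x.
Proof. by rewrite /tt mxE /=; case: eqP => // Ni; have := ltn_ord i; rewrite -Ni ltnn. Qed.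

Lemma rr_upd_max x s : rr (upd x (@ord_max N) s) = rr x.
Proof.
rewrite /rr; congr Num.sqrt; apply: eq_bigr => i _; rewrite mxE /=.
by case: eqP => // iN; have := ltn_ord i; rewrite iN ltnn.
Qed.

Lemma near_rr_lt x : rr x < a -> \forall y \near x, rr y < a.
Proof.
move=> ra; have H : \forall z \near rr x, z < a by exact: lt_nbhsl.
exact: (@continuous_rr R n x _ H).
Qed.

Lemma continuous_upd x (j : 'I_m) : (fun s => upd x j s) @ x ord0 j --> x.
Proof.
apply: cvg_rV => i; rewrite /upd; under eq_fun do rewrite mxE.
by case: eqP => [/val_inj ->|_]; [exact: cvg_id|exact: cvg_cst].
Qed.

Lemma k_small r : r < a -> k r = 0 /\ k' r = 0.
Proof. by move=> ra; apply: ksupp => /andP[]; rewrite leNgt ra. Qed.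

(** The radius is not differentiable at 0, but for r < a the function [k] is 0, so [u] vanishes near
    every such point and the formula holds there as well. *)
Lemma is_derive_separated_wid x (i : 'I_N) :
  is_derive (x ord0 (wid i)) 1 (fun s => u (upd x (wid i) s))
    (k' (rr x) * (x ord0 (wid i) / rr x) * phi (tt x)).
Proof.
have [ra|ar] := ltP (rr x) a.
  have [_ ->] := k_small ra; rewrite !mul0r; apply: is_derive1_near0.
  have : \forall s \near x ord0 (wid i), rr (upd x (wid i) s) < a.
    exact: (@continuous_upd x (wid i)) _ (near_rr_lt ra).
  by apply: filterS => s /k_small[ks _]; rewrite /u ks mul0r.
have r0 : 0 < rr x by exact: lt_le_trans ar.
have dkr : is_derive (rr (upd x (wid i) (x ord0 (wid i)))) 1 k (k' (rr x)).
  by rewrite upd_id.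
have H := is_derive1M (is_derive1_compr (is_derive_rr i r0) dkr)
  (is_derive_cst (phi (tt x)) (x ord0 (wid i)) (1 : R)).
apply: (is_derive1_near_eq H); last by rewrite mulr0 addr0.
by near=> s; rewrite /u tt_upd_wid.
Unshelve. all: by end_near.
Qed.

Lemma is_derive_separated_max x :
  is_derive (x ord0 ord_max) 1 (fun s => u (upd x (@ord_max N) s)) (k (rr x) * phi' (tt x)).
Proof.
have H := is_derive1M (is_derive_cst (k (rr x)) (x ord0 ord_max) (1 : R)) (dphi (tt x)).
apply: (is_derive1_near_eq H); last by rewrite mul0r add0r.
by near=> s; rewrite /u rr_upd_max /tt updE.
Unshelve. all: by end_near.
Qed.

Lemma partial_separated_wid x i :
  partial (wid i) u x = k' (rr x) * (x ord0 (wid i) / rr x) * phi (tt x).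
Proof.
by rewrite /partial derive1E; exact: (@derive_val _ _ _ _ _ _ _ (is_derive_separated_wid x i)).
Qed.

Lemma partial_separated_max x : partial ord_max u x = k (rr x) * phi' (tt x).
Proof.
by rewrite /partial derive1E; exact: (@derive_val _ _ _ _ _ _ _ (is_derive_separated_max x)).
Qed.

Lemma ord_cases (j : 'I_m) : (exists i, j = wid i) \/ j = ord_max.
Proof.
have [jN|jN] := ltnP j N; [left; exists (Ordinal jN)|right]; apply/val_inj => //=.
by apply/eqP; rewrite eqn_leq jN -ltnS ltn_ord.
Qed.

Lemma continuous_tt : continuous (@tt R n).
Proof. exact: coord_continuous. Qed.

Lemma continuous_k : continuous k.
Proof. by move=> r; exact: (is_derive1_continuous (dk r)). Qed.

Lemma continuous_phi : continuous phi.
Proof. by move=> r; exact: (is_derive1_continuous (dphi r)). Qed.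

Lemma separated_C1_0 (Omega : set 'rV[R]_m) :
  (forall x, a <= rr x <= b -> `|tt x| <= T -> Omega x) -> C1_0 Omega u.
Proof.
move=> SO.
have crr (f : R -> R) x : continuous f -> (fun y : 'rV[R]_m => f (rr y)) @ x --> f (rr x).
  by move=> cf; apply: (@cvg_comp _ _ _ (@rr R n) f); [exact: continuous_rr|exact: cf].
have ctt (f : R -> R) x : continuous f -> (fun y : 'rV[R]_m => f (tt y)) @ x --> f (tt x).
  by move=> cf; apply: (@cvg_comp _ _ _ (@tt R n) f); [exact: continuous_tt|exact: cf].
have SK : closure [set x | u x != 0] `<=` [set x | a <= rr x <= b /\ `|tt x| <= T].
  have cl : closed [set x : 'rV[R]_m | a <= rr x <= b /\ `|tt x| <= T].
    have -> : [set x : 'rV[R]_m | a <= rr x <= b /\ `|tt x| <= T] =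
        @rr R n @^-1` `[a, b]%classic `&` @tt R n @^-1` `[- T, T]%classic.
      by apply/seteqP; split => x /=; rewrite !in_itv /= -ler_norml.
    apply: closedI; apply: closed_comp.
    - by move=> x _; exact: continuous_rr.
    - exact: itv_closed.
    - by move=> x _; exact: continuous_tt.
    - exact: itv_closed.
  rewrite ((closure_id _).1 cl); apply: closureS => x /= ux; split.
    by apply: contrapT => /ksupp[kr _]; move: ux; rewrite /u kr mul0r eqxx.
  by rewrite leNgt; apply/negP => /phisupp p0; move: ux; rewrite /u p0 mulr0 eqxx.
split.
- move=> j x; have [[i ->]|->] := ord_cases j.
    exact: (@ex_derive _ _ _ _ _ _ _ (is_derive_separated_wid x i)).
  exact: (@ex_derive _ _ _ _ _ _ _ (is_derive_separated_max x)).
- move=> j; have [[i ->]|->] := ord_cases j; apply: continuous_rV_intro => x FF; last first.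
    rewrite (_ : partial ord_max u = fun y => k (rr y) * phi' (tt y)); last first.
      by apply/funext => y; rewrite partial_separated_max.
    by apply: cvgM; [exact: crr continuous_k|exact: ctt].
  rewrite (_ : partial (wid i) u =
    fun y => k' (rr y) * (y ord0 (wid i) / rr y) * phi (tt y)); last first.
    by apply/funext => y; rewrite partial_separated_wid.
  have [ra|ar] := ltP (rr x) a.
    have [_ ->] := k_small ra; rewrite !mul0r.
    apply: (@cvg_trans _ ((fun _ : 'rV[R]_m => 0 : R) @ nbhs x)); last exact: cvg_cst.
    apply: near_eq_cvg; apply: filterS (near_rr_lt ra) => y /k_small[_ ->].
    by rewrite !mul0r.
  apply: cvgM; last exact: ctt continuous_phi.
  apply: cvgM; first exact: crr.
  apply: cvgM; first exact: coord_continuous.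
  by apply: cvgV; [rewrite gt_eqF //; exact: lt_le_trans ar|exact: continuous_rr].
- pose M := Num.max b T.
  apply: (@subclosed_compact _ _ (box M)); [exact: closed_closure|exact: box_compact|].
  move=> x /SK /= [/andP[_ rb] tT] j; have [[i ->]|->] := ord_cases j; rewrite le_max.
    by apply/orP; left; apply: le_trans rb; exact: normr_le_rr.
  by apply/orP; right.
- by move=> x /SK [/SO H /H].
Qed.

(** Here X_i u = al x_i + be y_i and Y_i u = al y_i - be x_i. In the sum of squares the mixed terms
    cancel, so |nabla_L u|^2 = (al^2 + be^2) r^2 exactly; the inequality only bounds the root by
    |al| + |be|. *)
Lemma gradL_separated_le gamma x : 0 <= gamma ->
  gradL_norm gamma u x <=
    rr x * (`|k' (rr x) * phi (tt x)| / rr x + 2 * gamma * rr x `^ (2 * gamma - 2) * `|k (rr x) * phi' (tt x)|).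
Proof.
move=> g0; set al := k' (rr x) / rr x * phi (tt x).
set be := 2 * gamma * rr x `^ (2 * gamma - 2) * (k (rr x) * phi' (tt x)).
have -> : gradL_norm gamma u x = Num.sqrt ((al ^+ 2 + be ^+ 2) * rr x ^+ 2).
  rewrite /gradL_norm sqr_rr mulr_sumr; congr Num.sqrt; apply: eq_bigr => i _.
  have iN : (i < N)%N by rewrite -addnn ltn_addr.
  have niN : (n + i < N)%N by rewrite -addnn ltn_add2l.
  have E1 : inord i = wid (Ordinal iN) by rewrite wid_inord.
  have E2 : inord (n + i) = wid (Ordinal niN) by rewrite wid_inord.
  have P1 : partial (inord i) u x = k' (rr x) * (x ord0 (inord i) / rr x) * phi (tt x).
    by rewrite E1 partial_separated_wid.
  have P2 : partial (inord (n + i)) u x = k' (rr x) * (x ord0 (inord (n + i)) / rr x) * phi (tt x).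
    by rewrite E2 partial_separated_wid.
  rewrite /HG_X /HG_Y /xc /yc P1 P2 partial_separated_max.
  by rewrite /al /be; ring.
rewrite sqrtrM ?addr_ge0 ?sqr_ge0 // sqrtr_sqr ger0_norm ?rr_ge0 // mulrC ler_wpM2l ?rr_ge0 //.
have -> : `|k' (rr x) * phi (tt x)| / rr x = `|al|.
  by rewrite /al mulrAC [RHS]normrM normfV (ger0_norm (rr_ge0 x)).
have -> : 2 * gamma * rr x `^ (2 * gamma - 2) * `|k (rr x) * phi' (tt x)| = `|be|.
  have b0 : 0 <= 2 * gamma * rr x `^ (2 * gamma - 2) by rewrite !mulr_ge0 ?powR_ge0.
  by rewrite /be [in RHS]normrM (ger0_norm b0).
rewrite -[leRHS]ger0_norm ?addr_ge0 // -sqrtr_sqr ler_wsqrtr // sqrrD !real_normK ?num_real //.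
by rewrite addrAC lerDl mulrn_wge0 // mulr_ge0.
Qed.

End test_function.

(** * Sharpness *)

Section bump.
Context {R : realType}.

(** The truncation eta of the overview: a C1 bump supported in [-1, 1], with slope at most 4 and at
    least (3/4)^2 = 9/16 on [-1/2, 1/2]. *)
Definition bumpf (v : R) := hmax (1 - v ^+ 2) ^+ 2.
Definition bumpf' (v : R) := - 4 * v * hmax (1 - v ^+ 2).

Lemma is_derive_bump (v : R) : is_derive v 1 bumpf (bumpf' v).
Proof.
have H0 := is_derive1M (is_derive_id v (1 : R)) (is_derive_id v (1 : R)).
have H1 := is_deriveB (is_derive_cst (1 : R) v (1 : R)) H0.
have H2 := is_derive_hmax2 (1 - v * v).
apply: (is_derive1_near_eq (is_derive1_compr H1 H2)).
  by near=> z; rewrite /bumpf expr2.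
by rewrite /bumpf' /= mul1r mulr1 sub0r expr2; ring.
Unshelve. all: by end_near.
Qed.

Lemma continuous_bump' : continuous bumpf'.
Proof.
move=> v; apply: cvgM; first by apply: cvgM; [exact: cvg_cst|exact: cvg_id].
apply: (@cvg_comp _ _ _ (fun v => 1 - v ^+ 2) hmax); last exact: continuous_hmax.
by apply: cvgB; [exact: cvg_cst|exact: exprn_continuous].
Qed.

Lemma bump_ge0 v : 0 <= bumpf v. Proof. exact: sqr_ge0. Qed.

Lemma hmax_bump_le1 (v : R) : hmax (1 - v ^+ 2) <= 1.
Proof. by rewrite /hmax ge_max ler01 andbT lerBlDl lerDr sqr_ge0. Qed.

Lemma bump_le1 v : bumpf v <= 1.
Proof. by rewrite /bumpf expr_le1 ?hmax_ge0 // hmax_bump_le1. Qed.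

Lemma bump_supp v : 1 <= `|v| -> bumpf v = 0 /\ bumpf' v = 0.
Proof.
move=> v1; have h0 : hmax (1 - v ^+ 2) = 0.
  by rewrite /hmax max_r // subr_le0 -real_normK ?num_real // exprn_ege1.
by rewrite /bumpf /bumpf' h0 expr0n mulr0.
Qed.

Lemma normr_bump' v : `|bumpf' v| <= 4.
Proof.
have [v1|v1] := ltP `|v| 1; last by rewrite (bump_supp v1).2 normr0.
rewrite /bumpf' !normrM normrN (@ger0_norm _ 4) // (ger0_norm (hmax_ge0 _)).
rewrite -mulrA ler_piMr // mulr_ile1 ?hmax_ge0 ?hmax_bump_le1 //; exact: ltW.
Qed.

Lemma bump_ge v : `|v| <= 1 / 2 -> 9 / 16 <= bumpf v.
Proof.
move=> v2; have H : 3 / 4 <= 1 - v ^+ 2.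
  have : `|v| ^+ 2 <= (1 / 2) ^+ 2 by rewrite lerXn2r ?nnegrE //; lra.
  rewrite real_normK ?num_real //; lra.
rewrite /bumpf /hmax max_l; last by lra.
have -> : 9 / 16 = (3 / 4) ^+ 2 :> R by field.
by rewrite lerXn2r ?nnegrE //; lra.
Qed.

(** Half-open, so that consecutive unit translates tile an interval without overlap. *)
Definition unit_indic (a z : R) : R := (nat_of_bool (a <= z < a + 1)%R)%:R.

Lemma sum_unit_indic (a z : R) (k : nat) :
  \sum_(i < k) unit_indic (a + i%:R) z = (nat_of_bool (a <= z < a + k%:R)%R)%:R.
Proof.
elim: k => [|k IH].
  by rewrite big_ord0 addr0; case: ltP; rewrite ?andbF // andbT => /le_gtF ->.
rewrite big_ord_recr /= IH /unit_indic -[k.+1]addn1 natrD addrA.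
have k0 : 0 <= k%:R :> R by [].
case: (leP a z) => H1; case: (ltP z (a + k%:R)) => H2 /=;
  case: (leP (a + k%:R) z) => H3 /=; case: (ltP z (a + k%:R + 1)) => H4 //=;
  rewrite ?addr0 ?add0r //; lra.
Qed.

Lemma measurable_unit_indic a : measurable_fun setT (unit_indic a : measurableTypeR R -> R).
Proof.
rewrite (_ : unit_indic a = \1_(`[a, a + 1[%classic)); first exact: measurable_indic.
apply/funext => z; rewrite /unit_indic indicE; congr (nat_of_bool _)%:R.
by apply/idP/idP => [H|]; [apply/mem_set; rewrite /= in_itv|rewrite inE /= in_itv].
Qed.

End bump.

(** * Measure of logarithmic rings *)

Section rings.
Context {R : realType} (n : nat).
Hypothesis n0 : (0 < n)%N.
Local Notation N := n.*2.
Local Notation m := (n.*2.+1).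
Implicit Types (x : 'rV[R]_m).

Definition tind (T : R) x : R := \1_(`[- T, T]%classic) (tt x).

(* The density of the dilation invariant measure r^(-2n) dz dt on the unit logarithmic ring
   a <= - ln r < a + 1 with |t| <= T. *)
Definition ring_density (a T : R) x : R :=
  (rr x ^+ N)^-1 * unit_indic a (- ln (rr x)) * tind T x.

Lemma rmeasurable_tind T : rV_rmeasurable (tind T).
Proof.
by apply: (@rmeasurable_comp _ _ (\1_(`[- T, T]%classic))); [exact: measurable_indic|exact: rV_measurable_coord].
Qed.

Lemma rmeasurable_density : rV_rmeasurable (fun x => (rr x ^+ N)^-1).
Proof. by apply: rmeasurable_inv; apply: measurable_funX; exact: rmeasurable_rr. Qed.

Lemma ring_density_ge0 a T x : 0 <= ring_density a T x.
Proof. by rewrite !mulr_ge0 ?invr_ge0 ?exprn_ge0 ?rr_ge0 // /unit_indic ?ler0n. Qed.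

Lemma rmeasurable_ring_density a T : rV_rmeasurable (ring_density a T).
Proof.
apply: rmeasurableM; last exact: rmeasurable_tind.
apply: rmeasurableM; first exact: rmeasurable_density.
apply: (@rmeasurable_comp _ _ (fun r => unit_indic a (- ln r))); last exact: rmeasurable_rr.
apply: (measurableT_comp (measurable_unit_indic a)).
by apply: (@measurableT_comp _ _ _ _ _ _ (@GRing.opp R)) => //; exact: measurable_ln.
Qed.

Lemma rr_le (b : R) x : 0 <= b -> (forall i : 'I_N, `|x ord0 (widen_ord (leqnSn N) i)| <= b) ->
  rr x ^+ 2 <= N%:R * b ^+ 2.
Proof.
move=> b0 xb; rewrite /rr sqr_sqrtr ?sumr_ge0 // => [|i _]; last exact: sqr_ge0.
apply: (@le_trans _ _ (\sum_(i < N) b ^+ 2)); last by rewrite sumr_const card_ord mulr_natl.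
by apply: ler_sum => i _; rewrite -real_normK ?num_real // lerXn2r ?nnegrE.
Qed.

Lemma rr_ge (b : R) x : 0 <= b -> (forall i : 'I_N, b <= `|x ord0 (widen_ord (leqnSn N) i)|) ->
  N%:R * b ^+ 2 <= rr x ^+ 2.
Proof.
move=> b0 xb; rewrite /rr sqr_sqrtr ?sumr_ge0 // => [|i _]; last exact: sqr_ge0.
apply: (@le_trans _ _ (\sum_(i < N) b ^+ 2)); first by rewrite sumr_const card_ord mulr_natl.
by apply: ler_sum => i _; rewrite -[leRHS]real_normK ?num_real // lerXn2r ?nnegrE.
Qed.

Lemma le_has_iint_ex (f g : 'rV[R]_m -> R) J : (forall x, 0 <= f x) -> rV_rmeasurable f ->
  has_iint g J -> (forall x, f x <= g x) -> exists2 I, has_iint f I & I <= J.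
Proof.
move=> f0 mf hg fg; have [g0 mg gJ] := hg.
have : (iint m (fun x => (f x)%:E) 0 <= J%:E)%E.
  rewrite -gJ; apply: le_iint => [x|||x]; rewrite ?lee_fin //; exact: rV_measurable_EFin.
have : (0 <= iint m (fun x => (f x)%:E) 0)%E by apply: iint_ge0 => x; rewrite lee_fin.
case E : iint => [I| |] //; rewrite !lee_fin => I0 IJ.
by exists I.
Qed.

(** Finite, because on the ring r > 1/e bounds the density by e^(2n) and r <= 1 confines it to a
    box. Positive, because the ring contains a product of intervals on which 3/4 <= r <= 1; there -
    ln r < 1 since 3/4 > 1/e, and the density is at least 1. *)
Lemma ring0_measure : exists2 M : R, 0 < M & has_iint (ring_density 0 1) M.
Proof.
have e2 : (expR (-1) : R) <= 1 / 2.
  rewrite expRN -[1 / 2]mul1r -[leLHS]mul1r.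
  have : 2 <= expR 1 :> R by have := expR_ge1Dx (1 : R); lra.
  move=> H; rewrite !mul1r lef_pV2 ?posrE ?expR_gt0 //.
have lt x : 0 <= - ln (rr x) < 1 -> 0 < rr x -> expR (-1) < rr x <= 1.
  move=> /andP[l0 l1] r0; rewrite -[rr x]lnK ?posrE // ltr_expR -[leRHS]expR0 ler_expR.
  apply/andP; split; lra.
have ub x : ring_density 0 1 x <= expR 1 ^+ N * box_indic 1 x.
  rewrite /ring_density /unit_indic /tind add0r.
  have B0 : 0 <= expR 1 ^+ N * box_indic 1 x by rewrite mulr_ge0 ?exprn_ge0 ?expR_ge0 ?box_indic_ge0.
  have := rr_ge0 x; rewrite le_eqVlt => /predU1P[<-|r0].
    by rewrite expr0n double_eq0 (gtn_eqF n0) invr0 !mul0r.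
  case: (boolP (0 <= - ln (rr x) < 1)) => H; last by rewrite mulr0 mul0r.
  have /andP[r1 r2] := lt x H r0.
  rewrite mulr1 indicE; case: (boolP (_ \in _)); last by rewrite mulr0.
  rewrite inE /= in_itv /= -ler_norml => t1.
  rewrite mulr1 box_indicT ?mulr1.
    rewrite -exprVn lerXn2r ?nnegrE ?expR_ge0 ?invr_ge0 ?rr_ge0 //.
    rewrite -[expR 1]invrK lef_pV2 ?posrE ?invr_gt0 ?expR_gt0 // -expRN; exact: ltW.
  move=> j; have [[i ->]|->] := ord_cases j; last exact: t1.
  exact: le_trans (normr_le_rr x i) r2.
have hb := has_iintZ (exprn_ge0 N (expR_ge0 1)) (@has_iint_box R m 1 ler01).
have [M hM _] := le_has_iint_ex (@ring_density_ge0 0 1) (@rmeasurable_ring_density 0 1) hb ub.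
exists M => //.
(* Normalized by 2n b^2 = 1: coordinates of z between 3b/4 and b then give 3/4 <= r <= 1. *)
pose b : R := (Num.sqrt N%:R)^-1.
have N0 : 0 < N%:R :> R by rewrite ltr0n double_gt0.
have b0 : 0 < b by rewrite invr_gt0 sqrtr_gt0.
have b2 : N%:R * b ^+ 2 = 1 by rewrite /b exprVn sqr_sqrtr ?ltW // divff // gt_eqF.
pose ph (j : 'I_m) : R -> R := if (j < N)%N then \1_(`[3 / 4 * b, b]%classic) else \1_(`[-1, 1]%classic).
pose Ij (j : 'I_m) : R := if (j < N)%N then b / 4 else 2.
have hp : has_iint (fun x => \prod_j ph j (x ord0 j)) (\prod_j Ij j).
  have ph0 j s : 0 <= ph j s by rewrite /ph; case: ifP => _; rewrite indicE.
  have mph j : measurable_fun setT (ph j : measurableTypeR R -> R).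
    by rewrite /ph; case: ifP => _; exact: measurable_indic.
  split; first by move=> x; exact: prodr_ge0.
    exact: rV_rmeasurable_prod.
  rewrite (@iint_prod R m m ph Ij) //.
  - by congr EFin; apply: eq_bigr => j _; rewrite ltn_ord.
  - move=> j; rewrite /ph /Ij; case: ifP => _.
      rewrite integral_indic //= setIT lebesgue_measure_itv /= lte_fin ifT; last by lra.
      by rewrite -EFinD; congr EFin; field.
    rewrite integral_indic //= setIT lebesgue_measure_itv /= lte_fin ifT; last by lra.
    by rewrite -EFinD; congr EFin; lra.
  - by move=> j; rewrite /Ij; case: ifP => _; lra.
apply: (@lt_le_trans _ _ (\prod_j Ij j)).
  by apply: prodr_gt0 => j _; rewrite /Ij; case: ifP => _; lra.
apply: (le_has_iint hp hM) => x.
have [/allP/= xin|] := boolP (all (fun j => ph j (x ord0 j) != 0) (enum 'I_m)); last first.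
  move=> /allPn[j _ /negPn/eqP pj].
  by rewrite (bigD1 j) //= pj mul0r ring_density_ge0.
have {}xin j : ph j (x ord0 j) != 0 by apply: xin; rewrite mem_enum.
have zi (i : 'I_N) : 3 / 4 * b <= x ord0 (widen_ord (leqnSn N) i) <= b.
  have := xin (widen_ord (leqnSn N) i); rewrite /ph /= ltn_ord indicE.
  case: (boolP (_ \in _)); last by rewrite eqxx.
  by rewrite inE /= in_itv.
have tin : tt x \in `[-1, 1]%classic.
  have := xin ord_max; rewrite /ph /= ltnn indicE.
  by case: (boolP (_ \in _)) => //; rewrite eqxx.
have r2 : (3 / 4) ^+ 2 <= rr x ^+ 2 <= 1 ^+ 2.
  apply/andP; split.
    rewrite (_ : (3 / 4) ^+ 2 = N%:R * (3 / 4 * b) ^+ 2); last by rewrite [in RHS]exprMn mulrCA b2 mulr1.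
    apply: rr_ge => [|i]; first by lra.
    by have /andP[zi1 _] := zi i; apply: le_trans zi1 (ler_norm _).
  rewrite expr1n -b2; apply: rr_le => [|i]; first exact: ltW.
  have /andP[zi1 zi2] := zi i; rewrite ger0_norm //; lra.
have {r2}/andP[r34 r1] : 3 / 4 <= rr x <= 1.
  by move: r2; rewrite !ler_sqr ?nnegrE ?rr_ge0 //; lra.
have r0 : 0 < rr x by lra.
have l1 : - ln (rr x) < 1.
  rewrite ltrNl -ltr_expR lnK ?posrE //; lra.
have l0 : 0 <= - ln (rr x) by rewrite oppr_ge0 ln_le0.
rewrite /ring_density /unit_indic /tind add0r l0 l1 indicE tin !mulr1.
apply: (@le_trans _ _ 1).
  rewrite big1 // => j _; have := xin j.
  by rewrite /ph; case: ifP => _; rewrite indicE; case: (_ \in _); rewrite ?eqxx.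
by rewrite invf_ge1 ?exprn_gt0 // exprn_ile1 // ltW.
Qed.

(** The map (z, t) |-> (e^a z, t / T) carries this ring to the one with a = 0 and T = 1. The
    Jacobian in z cancels against r^(-2n), so only the factor T remains and the measure is
    independent of [a]. *)
Lemma ring_measure (M a T : R) : has_iint (ring_density 0 1) M -> 0 < T ->
  has_iint (ring_density a T) (T * M).
Proof.
move=> [_ _ fM] T0; split; [exact: ring_density_ge0|exact: rmeasurable_ring_density|].
have ea0 : 0 < expR a by exact: expR_gt0.
have Ti0 : 0 < T^-1 by rewrite invr_gt0.
have E x : ring_density 0 1 (dilzt (expR a) T^-1 x) = (expR a ^+ N)^-1 * ring_density a T x.
  rewrite /ring_density rr_dilzt ?ltW //.
  have := rr_ge0 x; rewrite le_eqVlt => /predU1P[<-|r0].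
    by rewrite mulr0 expr0n double_eq0 (gtn_eqF n0) invr0 !mul0r mulr0.
  rewrite exprMn invfM -!mulrA; congr (_ * (_ * (_ * _))).
    rewrite lnM ?posrE // expRK /unit_indic add0r; congr ((_ : bool) : nat)%:R.
    by apply/andP/andP => -[H1 H2]; split; lra.
  rewrite /tind !indicE; congr ((_ : bool) : nat)%:R.
  rewrite /tt /dilzt mxE /= ltnn.
  apply/idP/idP; rewrite !inE /= !in_itv /= -!ler_norml normrM (gtr0_norm Ti0) mulrC ler_pdivrMr // mul1r //.
have := @iint_dilzt R n (fun x => (ring_density 0 1 x)%:E) (expR a) T^-1 ea0 Ti0.
rewrite fM => /(_ _ _) H.
have {}H : ((expR a ^+ N)^-1%:E * iint m (fun x => (ring_density a T x)%:E) 0 =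
    (expR a ^+ N * T^-1)^-1%:E * M%:E)%E.
  rewrite -H; last 2 first.
  - by move=> x; rewrite lee_fin ring_density_ge0.
  - by apply: rV_measurable_EFin; exact: rmeasurable_ring_density.
  rewrite -iintZl; last 3 first.
  - by rewrite invr_ge0 exprn_ge0 // ltW.
  - by move=> x; rewrite lee_fin ring_density_ge0.
  - by apply: rV_measurable_EFin; exact: rmeasurable_ring_density.
  by congr iint; apply/funext => x; rewrite -EFinM -E.
have c0 : expR a ^+ N != 0 by rewrite expf_neq0 // gt_eqF.
have {}H := congr1 (fun z => (expR a ^+ N)%:E * z)%E H.
move: H; rewrite muleA -EFinM divff // mul1e => ->.
by rewrite -!EFinM; congr EFin; field; rewrite gt_eqF.
Qed.

End rings.

(** * Splitting main term and error *)

Section choice.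
Context {R : realType}.

(** If b <= th a the sum is at most (1 + th) a, otherwise at most (1 + 1/th) b. The point is that
    the factor of the main term tends to 1 with th, at the price of a large factor on the error
    [b]. *)
Lemma powRD_le (p th a b : R) : 0 < p -> 0 < th -> 0 <= a -> 0 <= b ->
  (a + b) `^ p <= (1 + th) `^ p * a `^ p + (1 + th^-1) `^ p * b `^ p.
Proof.
move=> p0 th0 a0 b0.
have i0 : 0 < th^-1 by rewrite invr_gt0.
have [ba|ab] := leP b (th * a).
  apply: (@le_trans _ _ ((1 + th) `^ p * a `^ p)).
    rewrite -powRM ?ge0_ler_powR ?nnegrE ?mulr_ge0 ?addr_ge0 // ?(ltW p0) ?(ltW th0) //.
    by rewrite mulrDl mul1r lerD2l.
  by rewrite lerDl; apply: mulr_ge0; exact: powR_ge0.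
apply: (@le_trans _ _ ((1 + th^-1) `^ p * b `^ p)).
  rewrite -powRM ?ge0_ler_powR ?nnegrE ?mulr_ge0 ?addr_ge0 // ?(ltW p0) ?(ltW i0) //.
  by rewrite mulrDl mul1r addrC lerD2l mulrC ler_pdivlMr // mulrC ltW.
by rewrite lerDr; apply: mulr_ge0; exact: powR_ge0.
Qed.

(** First [th] is fixed by continuity of the power at 1; the now fixed factor of the error is then
    beaten by a small [kap]. *)
Lemma exists_perturbation_lt (p c K C : R) : 1 < p -> 0 < K -> c `^ p < C ->
  exists th kap : R, [/\ 0 < th, 0 < kap &
    (1 + th) `^ p * c `^ p + (1 + th^-1) `^ p * kap `^ p * K < C].
Proof.
move=> p1 K0 cC; have p0 : 0 < p by lra.
have [th th0 thC] : exists2 th : R, 0 < th & (1 + th) `^ p * c `^ p < C.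
  have H : (fun z => z `^ p * c `^ p) @ (1 : R) --> (1 `^ p * c `^ p : R).
    by apply: cvgM; [exact: continuous_powR|exact: cvg_cst].
  rewrite powR1 mul1r in H.
  have : \forall z \near (1 : R), z `^ p * c `^ p < C by exact: (H _ (lt_nbhsl cC)).
  move=> /nbhs_ballP[e /= e0 He]; exists (e / 2); first by rewrite divr_gt0.
  apply: He; rewrite /ball /= opprD addrA subrr sub0r normrN gtr0_norm ?divr_gt0 //; lra.
have k0 : 0 < (1 + th^-1) `^ p by apply: powR_gt0; rewrite addr_gt0 ?invr_gt0.
(* This is kap^p, chosen so that the error term is half of the remaining gap. *)
pose e := (C - (1 + th) `^ p * c `^ p) / (2 * ((1 + th^-1) `^ p * K)).
have e0 : 0 < e by rewrite divr_gt0 ?subr_gt0 // !mulr_gt0.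
exists th, (e `^ p^-1); split => //; first exact: powR_gt0.
rewrite -powRrM mulVf ?gt_eqF // powRr1 ?ltW // /e.
rewrite (_ : _ * K = (C - (1 + th) `^ p * c `^ p) / 2); last by field; rewrite !gt_eqF.
lra.
Qed.

End choice.

Lemma is_derive_scale {R : realType} (f f' : R -> R) (a b v : R) : is_derive ((v - a) / b) 1 f (f' ((v - a) / b)) ->
  is_derive v 1 (fun v => f ((v - a) / b)) (f' ((v - a) / b) / b).
Proof.
move=> df.
have H := is_derive1M (is_deriveB (is_derive_id v (1 : R)) (is_derive_cst a v (1 : R))) (is_derive_cst b^-1 v (1 : R)).
have H1 := is_derive1_compr H df.
by apply: (is_derive1_near_eq H1); [near=> z|rewrite /= subr0 mul1r mulr0 addr0].
Unshelve. all: by end_near.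
Qed.

(** * The quotient of the test function in an abstract logarithmic scale *)

Section ratio.
Context {R : realType} (n : nat).
Hypothesis n0 : (0 < n)%N.
Local Notation N := n.*2.
Local Notation m := (n.*2.+1).
Implicit Types (x : 'rV[R]_m).

(* y is a logarithmic scale of r with inverse vrho, meaningful only where 0 < y r: the
   junk values of ln make y r <= 0 at r <= 0.  WB and WA are the weights of |u|^p and |nabla_L u|^p. *)
Variables (p c d gamma M : R) (y tau vrho WA WB : R -> R).
Hypothesis p1 : 1 < p.
Hypothesis g1 : 1 <= gamma.
Hypothesis d0 : 0 < d.
Hypothesis M0 : 0 < M.
Hypothesis vrho0 : forall v, 0 < vrho v.
Hypothesis vrho_le : forall v w, v <= w -> vrho w <= vrho v.
Hypothesis yK : forall r, 0 < y r -> r = vrho (y r).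
Hypothesis y_gt0 : forall v r, 0 < v -> 0 < r -> r <= vrho v -> 0 < y r.
Hypothesis dy : forall r : R, 0 < y r -> is_derive r 1 y (- (r * tau r)^-1).
Hypothesis tau0 : forall r, 0 < y r -> 0 < tau r.
Hypothesis ctau : forall r : R, 0 < y r -> {for r, continuous tau}.
Hypothesis mWA : measurable_fun setT (WA : measurableTypeR R -> R).
Hypothesis mWB : measurable_fun setT (WB : measurableTypeR R -> R).
Hypothesis WA0 : forall r, 0 <= WA r.
Hypothesis WB0 : forall r, 0 <= WB r.
(** Under this weight e^(c y) has mass density 1 / (r^(2n) tau), that is, |dy| times a surface
    measure on spheres and dt. With [WAE], and because r tau |y'| = 1, its radial energy density is
    |c|^p times its mass density. *)
Hypothesis WBE : forall r, 0 < y r -> WB r = (r ^+ N * tau r)^-1 * expR (- (p * c * y r)).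
Hypothesis WAE : forall r, 0 < y r -> WA r = (r * tau r) `^ p * WB r.

Definition layer (j : nat) (S : R) x : R :=
  (rr x ^+ N * tau (rr x))^-1 * unit_indic j%:R (y (rr x) / d) * tind S x.

(** The factor 2 is the oscillation of tau over a layer: none if tau = 1, and from 2^j to 2^(j+1) if
    y = ln tau and d = ln 2. *)
Hypothesis layer_measure : forall (j : nat) (S : R), (0 < j)%N -> 0 < S ->
  exists2 I, has_iint (layer j S) I & S * M / 2 <= I <= S * M.

(* With L the scale of the test function, 8 bounds the ratio of the measures of
   {L < y < 3L, |t| < T} and {3L/2 <= y < 5L/2, |t| <= T/2}; on the latter set the truncation
   is at least (9/16)^2. *)
Definition sharp_cst : R := 8 / ((9 / 16) ^+ 2) `^ p.

Section test_function.
Variables (T : R) (J : nat).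
Hypothesis T0 : 0 < T.
Hypothesis J0 : (0 < J)%N.

(** An even multiple of [d], so that 3L/2 = 3 J d and 5L/2 = 5 J d are layer boundaries, like L and
    3L. *)
Local Notation L := (J.*2%:R * d).

Let scale_gt0 : 0 < L.
Proof. by rewrite mulr_gt0 // ltr0n double_gt0. Qed.

Let p0 : 0 < p.
Proof. exact: lt_trans ltr01 p1. Qed.

Lemma y_gt0_pos r : 0 < y r -> 0 < r.
Proof. by move=> yr; rewrite (yK yr). Qed.

Definition profile v := expR (c * v) * bumpf ((v - 2 * L) / L).
Definition profile' v := expR (c * v) * (c * bumpf ((v - 2 * L) / L) + bumpf' ((v - 2 * L) / L) / L).

Definition radial_factor r := profile (y r).
Definition radial_factor' r := profile' (y r) * - (r * tau r)^-1.
Definition time_factor t := bumpf (t / T).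
Definition time_factor' t := bumpf' (t / T) / T.

Definition test_fun : 'rV[R]_m -> R := separated radial_factor time_factor.

Lemma is_derive_profile (v : R) : is_derive v 1 profile (profile' v).
Proof.
have H1 := @is_derive_scale R bumpf bumpf' (2 * L) L v (is_derive_bump _).
have H2 := is_derive1M (is_derive_cst c v (1 : R)) (is_derive_id v (1 : R)).
have H3 := is_derive1_compr H2 (is_derive_expR _).
apply: (is_derive1_near_eq (is_derive1M H3 H1)); first by near=> z.
by rewrite /profile' /=; ring.
Unshelve. all: by end_near.
Qed.

Lemma continuous_profile' : continuous profile'.
Proof.
have cs : continuous (fun v => (v - 2 * L) / L).
  by move=> v; apply: cvgM; [apply: cvgB; [exact: cvg_id|exact: cvg_cst]|exact: cvg_cst].
move=> v; apply: cvgM.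
  apply: (@cvg_comp _ _ _ (fun v => c * v) expR); last exact: continuous_expR.
  by apply: cvgM; [exact: cvg_cst|exact: cvg_id].
apply: cvgD; apply: cvgM; try exact: cvg_cst.
  apply: (@cvg_comp _ _ _ (fun v => (v - 2 * L) / L) bumpf); first exact: cs.
  exact: (is_derive1_continuous (is_derive_bump _)).
apply: (@cvg_comp _ _ _ (fun v => (v - 2 * L) / L) bumpf'); first exact: cs.
exact: continuous_bump'.
Qed.

Lemma profile_off v : ~ (L < v < 3 * L) -> profile v = 0 /\ profile' v = 0.
Proof.
move=> nv; have v1 : 1 <= `|(v - 2 * L) / L|.
  rewrite normrM normfV (gtr0_norm scale_gt0) ler_pdivlMr // mul1r leNgt; apply/negP => vL; apply: nv.
  by move: vL; rewrite ltr_norml => /andP[? ?]; apply/andP; split; lra.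
by have [b0 b'0] := bump_supp v1; rewrite /profile /profile' b0 b'0 mul0r !mulr0 addr0 mulr0.
Qed.

(** Where the profile is nonzero, y r exceeds L > 0, so r is recovered as vrho (y r). Default values
    of [y] thus never meet the support. *)
Lemma radial_factor_supp r : ~ (vrho (3 * L) <= r <= vrho L) -> radial_factor r = 0 /\ radial_factor' r = 0.
Proof.
move=> nr; have [] := @profile_off (y r); last by rewrite /radial_factor /radial_factor' => -> ->; rewrite mul0r.
move=> /andP[y1 y2]; apply: nr; have yr : 0 < y r by exact: lt_trans scale_gt0 y1.
by rewrite {1 2}(yK yr) !vrho_le // ltW.
Qed.

Lemma is_derive_continuous_radial_factor (r : R) : is_derive r 1 radial_factor (radial_factor' r) /\ {for r, continuous radial_factor'}.
Proof.
have [rin|] := pselect (vrho (3 * L) <= r <= vrho L).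
  have /andP[r1 r2] := rin.
  have yr : 0 < y r by apply: (y_gt0 scale_gt0) r2; exact: lt_le_trans r1.
  have dyr := dy yr.
  split; first exact: (is_derive1_compr dyr (is_derive_profile (y r))).
  have c1 : (fun z => profile' (y z)) @ r --> profile' (y r).
    apply: (@cvg_comp _ _ _ y profile'); last exact: continuous_profile'.
    exact: (is_derive1_continuous dyr).
  have rt : r * tau r != 0 by rewrite gt_eqF // (mulr_gt0 (y_gt0_pos yr) (tau0 yr)).
  have c2 : (fun z => z * tau z) @ r --> r * tau r by apply: cvgM; [exact: cvg_id|exact: ctau].
  exact: (cvgM c1 (cvgN (cvgV rt c2))).
move=> nr.
have nz : \forall z \near r, radial_factor z = 0 /\ radial_factor' z = 0.
  have [rb|br] := ltP (vrho L) r.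
    have : \forall z \near r, vrho L < z by exact: lt_nbhsr.
    by apply: filterS => z bz; apply: radial_factor_supp => /andP[_]; rewrite leNgt bz.
  have ra : r < vrho (3 * L) by rewrite ltNge; apply/negP => ar; apply: nr; rewrite ar.
  have : \forall z \near r, z < vrho (3 * L) by exact: lt_nbhsl.
  by apply: filterS => z bz; apply: radial_factor_supp => /andP[]; rewrite leNgt bz.
have [_ kr] := radial_factor_supp nr; rewrite kr; split.
  by apply: is_derive1_near0; apply: filterS nz => z [].
rewrite /prop_for /continuous_at kr; apply: (@cvg_near_eq _ (fun=> 0)); last exact: cvg_cst.
by apply: filterS nz => z [_ ->].
Qed.

Lemma is_derive_time_factor (t : R) : is_derive t 1 time_factor (time_factor' t).
Proof.
have H := @is_derive_scale R bumpf bumpf' 0 T t (is_derive_bump _).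
apply: (is_derive1_near_eq H); last by rewrite subr0.
by near=> z; rewrite subr0.
Unshelve. all: by end_near.
Qed.

Lemma continuous_time_factor' : continuous time_factor'.
Proof.
move=> t; apply: cvgM; last exact: cvg_cst.
apply: (@cvg_comp _ _ _ (fun t => t / T) bumpf'); last exact: continuous_bump'.
by apply: cvgM; [exact: cvg_id|exact: cvg_cst].
Qed.

Lemma time_factor_supp t : T <= `|t| -> time_factor t = 0 /\ time_factor' t = 0.
Proof.
move=> tT; have t1 : 1 <= `|t / T| by rewrite normrM normfV (gtr0_norm T0) ler_pdivlMr // mul1r.
by rewrite /time_factor /time_factor' (bump_supp t1).1 (bump_supp t1).2 mul0r.
Qed.

Lemma test_C1_0 (Omega : set 'rV[R]_m) :
  (forall x, 0 < rr x <= vrho L -> `|tt x| <= T -> Omega x) -> C1_0 Omega test_fun.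
Proof.
move=> SO; apply: (@separated_C1_0 R n radial_factor radial_factor' time_factor time_factor' (vrho (3 * L)) (vrho L) T) => //.
- by move=> r; exact: (is_derive_continuous_radial_factor r).1.
- by move=> r; exact: (is_derive_continuous_radial_factor r).2.
- exact: radial_factor_supp.
- exact: is_derive_time_factor.
- exact: continuous_time_factor'.
- by move=> t tT; exact: (time_factor_supp (ltW tT)).1.
- move=> x /andP[x1 x2]; apply: SO; rewrite x2 andbT; exact: lt_le_trans x1.
Qed.

Variable kap : R.
Hypothesis kap0 : 0 < kap.
(** The first term comes from differentiating the truncation in y, the second from the t-derivative;
    both use the bound 4 on the slope of the bump, and 8 is 2 times 4. *)
Hypothesis kapE : forall r, L <= y r ->
  4 / L + 8 * gamma * (tau r * r `^ (2 * gamma)) / T <= kap.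

Definition amplitude x := bumpf ((y (rr x) - 2 * L) / L) * time_factor (tt x).

(** Multiplication by r tau cancels y' = -1 / (r tau): the radial part becomes the derivative of the
    profile, with main term c and error at most 4 / L. In the t part the powers of r combine to tau
    r^(2 gamma). *)
Lemma gradL_test x : L <= y (rr x) ->
  rr x * tau (rr x) * gradL_norm gamma test_fun x <= expR (c * y (rr x)) * (`|c| * amplitude x + kap).
Proof.
move=> Ly; have yr : 0 < y (rr x) by exact: lt_le_trans Ly.
have r_gt0 := y_gt0_pos yr; have t_gt0 := tau0 yr.
have gm0 : 0 <= gamma by exact: le_trans ler01 g1.
have H := @gradL_separated_le R n radial_factor radial_factor' time_factor time_factor' (vrho (3 * L)) (vrho L) (vrho0 _)
  (fun r => (is_derive_continuous_radial_factor r).1) radial_factor_supp is_derive_time_factor gamma x gm0.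
apply: (@le_trans _ _ (rr x * tau (rr x) * (rr x * (`|radial_factor' (rr x) * time_factor (tt x)| / rr x +
   2 * gamma * rr x `^ (2 * gamma - 2) * `|radial_factor (rr x) * time_factor' (tt x)|)))).
  by rewrite ler_pM2l // mulr_gt0.
set v := y (rr x) in Ly yr *; set B : R := bumpf ((v - 2 * L) / L); set B' : R := bumpf' ((v - 2 * L) / L).
have B0 : 0 <= B by exact: bump_ge0.
have B1 : B <= 1 by exact: bump_le1.
have B'4 : `|B'| <= 4 by exact: normr_bump'.
have F0 : 0 <= time_factor (tt x) by exact: bump_ge0.
have F1 : time_factor (tt x) <= 1 by exact: bump_le1.
have F'4 : `|time_factor' (tt x)| <= 4 / T.
  by rewrite /time_factor' normrM normfV (gtr0_norm T0) ler_pM2r ?invr_gt0 //; exact: normr_bump'.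
have E0 : 0 < expR (c * v) by exact: expR_gt0.
have powE : rr x `^ (2 * gamma) = rr x * rr x * rr x `^ (2 * gamma - 2).
  rewrite -mulrA (_ : 2 * gamma - 2 = 2 * gamma - 1 - 1); last by ring.
  by rewrite !mulr_powRB1_gt0.
rewrite [radial_factor _]/radial_factor /radial_factor' -/v /profile /profile' -/B -/B'.
have amplitudeE : amplitude x = B * time_factor (tt x) by [].
move: amplitudeE F0 F1 F'4; move: (time_factor (tt x)) (time_factor' (tt x)) (amplitude x) => F F' am amplitudeE F0 F1 F'4.
move: amplitudeE B0 B1 B'4; clearbody B B' => amplitudeE B0 B1 B'4.
rewrite !normrM normrN normfV (gtr0_norm E0) (ger0_norm B0) (ger0_norm F0) normrM.
rewrite (gtr0_norm r_gt0) (gtr0_norm t_gt0).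
have -> : rr x * tau (rr x) * (rr x * (expR (c * v) * `|c * B + B' / L| * (rr x * tau (rr x))^-1 *
     F / rr x + 2 * gamma * rr x `^ (2 * gamma - 2) * (expR (c * v) * B * `|F'|)))
  = expR (c * v) * (`|c * B + B' / L| * F +
     2 * gamma * (tau (rr x) * rr x `^ (2 * gamma)) * (B * `|F'|)).
  by rewrite powE; field; rewrite !gt_eqF.
rewrite ler_pM2l //.
apply: (le_trans _ (_ : `|c| * am + (4 / L + 8 * gamma * (tau (rr x) * rr x `^ (2 * gamma)) / T) <= _));
  last by rewrite lerD2l kapE.
rewrite addrA amplitudeE mulrA; apply: lerD.
  apply: (@le_trans _ _ ((`|c| * B + 4 / L) * F)).
    rewrite ler_wpM2r //; apply: (le_trans (ler_normD _ _)); apply: lerD.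
      by rewrite normrM (ger0_norm B0).
    by rewrite normrM normfV (gtr0_norm scale_gt0) ler_pM2r ?invr_gt0.
  by rewrite mulrDl mulrA lerD2l ler_piMr // divr_ge0 // ltW.
have -> : 8 * gamma * (tau (rr x) * rr x `^ (2 * gamma)) / T =
  2 * gamma * (tau (rr x) * rr x `^ (2 * gamma)) * (1 * (4 / T)) by lra.
rewrite -mulrA ler_wpM2l ?ler_pM //.
by apply: mulr_ge0; [apply: mulr_ge0 => //|apply: mulr_ge0; [exact: ltW|exact: powR_ge0]].
Qed.

Definition layers (i k : nat) (S : R) x := \sum_(j < k) layer (i + j) S x.

Lemma layersE i k S x : layers i k S x =
  (rr x ^+ N * tau (rr x))^-1 * (nat_of_bool (i%:R <= y (rr x) / d < i%:R + k%:R)%R)%:R * tind S x.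
Proof.
rewrite -sum_unit_indic mulr_sumr mulr_suml; apply: eq_bigr => j _.
by rewrite /layer natrD.
Qed.

Lemma has_iint_layers i k S : (0 < i)%N -> 0 < S ->
  exists2 I, has_iint (layers i k S) I & k%:R * (S * M / 2) <= I <= k%:R * (S * M).
Proof.
move=> i0 S0; elim: k => [|k [I hI /andP[I1 I2]]].
  exists 0; last by rewrite !mul0r lexx.
  have -> : layers i 0 S = fun=> 0 by apply/funext => x; rewrite /layers big_ord0.
  by split => //; [exact: measurable_cst|rewrite iint0].
have [I' hI' /andP[I1' I2']] : exists2 I, has_iint (layer (i + k) S) I & S * M / 2 <= I <= S * M.
  by apply: layer_measure => //; rewrite addn_gt0 i0.
exists (I + I').
  have -> : layers i k.+1 S = fun x => layers i k S x + layer (i + k) S x.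
    by apply/funext => x; rewrite /layers big_ord_recr.
  exact: has_iintD.
by rewrite -addn1 natrD; apply/andP; split; lra.
Qed.

Definition energy_density x := gradL_norm gamma test_fun x `^ p * WA (rr x).
Definition mass_density x := `|test_fun x| `^ p * WB (rr x).

Lemma amplitude_ge0 x : 0 <= amplitude x.
Proof. by apply: mulr_ge0; exact: bump_ge0. Qed.

Lemma amplitude_le1 x : amplitude x <= 1.
Proof. by apply: mulr_ile1; rewrite ?bump_ge0 ?bump_le1. Qed.

Lemma mass_density_in x : 0 < y (rr x) -> mass_density x = (rr x ^+ N * tau (rr x))^-1 * amplitude x `^ p.
Proof.
move=> yr; rewrite /mass_density (WBE yr) /test_fun /separated /radial_factor /profile -mulrA -/(amplitude x) normrM.
rewrite (gtr0_norm (expR_gt0 _)) (ger0_norm (amplitude_ge0 x)) powRM ?expR_ge0 ?amplitude_ge0 //.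
rewrite -[expR (c * _)]/(expR (c * y (rr x))) -expRM.
set D := (_ * tau _)^-1.
have -> : expR (c * y (rr x) * p) * amplitude x `^ p * (D * expR (- (p * c * y (rr x)))) =
   expR (c * y (rr x) * p) * expR (- (p * c * y (rr x))) * (D * amplitude x `^ p) by ring.
by rewrite -expRD (_ : _ + _ = 0) ?expR0 ?mul1r //; ring.
Qed.

Lemma gradL_test0 x : ~ (L < y (rr x) < 3 * L /\ `|tt x| < T) -> gradL_norm gamma test_fun x = 0.
Proof.
move=> nx; apply/eqP; rewrite eq_le gradL_norm_ge0 andbT.
have gm0 : 0 <= gamma by exact: le_trans ler01 g1.
have := @gradL_separated_le R n radial_factor radial_factor' time_factor time_factor' (vrho (3 * L)) (vrho L) (vrho0 _)
  (fun r => (is_derive_continuous_radial_factor r).1) radial_factor_supp is_derive_time_factor gamma x gm0.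
suff -> : rr x * (`|radial_factor' (rr x) * time_factor (tt x)| / rr x +
   2 * gamma * rr x `^ (2 * gamma - 2) * `|radial_factor (rr x) * time_factor' (tt x)|) = 0 by [].
have [tT|tT] := ltP `|tt x| T; last first.
  by have [-> ->] := time_factor_supp tT; rewrite !mulr0 normr0 mul0r mulr0 addr0 mulr0.
have [|pr pr'] := @profile_off (y (rr x)); first by move=> yL; apply: nx.
by rewrite /radial_factor /radial_factor' pr pr' !mul0r normr0 mul0r mulr0 addr0 mulr0.
Qed.

Lemma amplitude0 x : ~ (L < y (rr x) < 3 * L /\ `|tt x| < T) -> amplitude x = 0.
Proof.
move=> nx; rewrite /amplitude.
have [tT|tT] := ltP `|tt x| T; last by have [-> _] := time_factor_supp tT; rewrite mulr0.
have [|pr _] := @profile_off (y (rr x)); first by move=> yL; apply: nx.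
by move/eqP: pr; rewrite /profile mulf_eq0 gt_eqF ?expR_gt0 //= => /eqP ->; rewrite mul0r.
Qed.

Lemma mass_density_off x : ~ (L < y (rr x) < 3 * L /\ `|tt x| < T) -> mass_density x = 0.
Proof.
move=> /amplitude0 a0; rewrite /mass_density /test_fun /separated /radial_factor /profile -mulrA -/(amplitude x) a0 mulr0 normr0.
by rewrite powR0 ?mul0r // gt_eqF.
Qed.

Lemma layers_in x : L < y (rr x) < 3 * L -> `|tt x| < T ->
  layers J.*2 (2 * J.*2) T x = (rr x ^+ N * tau (rr x))^-1.
Proof.
move=> /andP[y1 y2] tT; rewrite layersE ler_pdivlMr // ltr_pdivrMr // (ltW y1) natrM.
have -> : y (rr x) < (J.*2%:R + 2%:R * J.*2%:R) * d by lra.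
rewrite /= mulr1 /tind indicE mem_set ?mulr1 //= in_itv /= -ler_norml; exact: ltW.
Qed.

Lemma layers_ge0 i k S x : (0 < i)%N -> 0 <= layers i k S x.
Proof.
move=> i0; rewrite layersE; case: (boolP (_ <= _ < _)) => [/andP[H _]|]; last by rewrite mulr0 mul0r.
have yr : 0 < y (rr x).
  by move: H; rewrite ler_pdivlMr //; apply: lt_le_trans; rewrite mulr_gt0 ?ltr0n.
by rewrite mulr1 mulr_ge0 // /tind ?indicE // invr_ge0 mulr_ge0 ?exprn_ge0 ?rr_ge0 // ltW ?tau0.
Qed.

Lemma mass_density_le x : mass_density x <= layers J.*2 (2 * J.*2) T x.
Proof.
have [[xy xt]|nx] := pselect (L < y (rr x) < 3 * L /\ `|tt x| < T); last first.
  by rewrite mass_density_off // layers_ge0 ?double_gt0.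
have yr : 0 < y (rr x) by case/andP: xy => + _; exact: lt_trans.
rewrite (mass_density_in yr) (layers_in xy xt) ler_piMr //.
  by rewrite invr_ge0 mulr_ge0 ?exprn_ge0 ?rr_ge0 // ltW ?tau0.
have one1 : (1 : R) `^ p = 1 by rewrite powR1.
by rewrite -[leRHS]one1 ge0_ler_powR ?nnegrE ?amplitude_ge0 ?amplitude_le1 // ltW.
Qed.

Lemma mass_density_ge x : ((9 / 16) ^+ 2) `^ p * layers (3 * J) (2 * J) (T / 2) x <= mass_density x.
Proof.
rewrite layersE /tind indicE.
have B0 : 0 <= mass_density x by rewrite mulr_ge0 ?powR_ge0.
case: (boolP (_ <= _ < _)) => [/andP[]|]; last by rewrite mulr0 mul0r mulr0.
rewrite ler_pdivlMr // ltr_pdivrMr // => y1 y2.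
case: (boolP (_ \in _)); last by rewrite !mulr0.
rewrite inE /= in_itv /= -ler_norml => t1.
have JE : J.*2%:R = 2 * J%:R :> R by rewrite -muln2 natrM mulrC.
have J0' : 0 < J%:R * d by rewrite mulr_gt0 ?ltr0n.
rewrite !natrM in y1 y2.
have yr : 0 < y (rr x) by lra.
rewrite !mulr1 (mass_density_in yr) mulrC ler_wpM2l //.
  by rewrite invr_ge0 mulr_ge0 ?exprn_ge0 ?rr_ge0 // ltW ?tau0.
apply: ge0_ler_powR; rewrite ?nnegrE ?amplitude_ge0 ?(ltW p0) //.
rewrite expr2; apply: ler_pM => //; apply: bump_ge.
  rewrite normrM normfV (gtr0_norm scale_gt0) ler_pdivrMr // ler_norml JE.
  by apply/andP; split; lra.
by rewrite normrM normfV (gtr0_norm T0) ler_pdivrMr // mulrC mulrA mulr1.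
Qed.

(** The exponentials cancel against the weight, leaving the p-th power of |c| [amplitude] + kap.
    Since kap does not decay with the amplitude, its share is charged to the full layers and not to
    the mass. *)
Lemma energy_density_le th x : 0 < th -> energy_density x <= (1 + th) `^ p * `|c| `^ p * mass_density x +
  (1 + th^-1) `^ p * kap `^ p * layers J.*2 (2 * J.*2) T x.
Proof.
move=> th0; rewrite /energy_density.
have [[xy xt]|nx] := pselect (L < y (rr x) < 3 * L /\ `|tt x| < T); last first.
  rewrite gradL_test0 // powR0 ?gt_eqF // mul0r addr_ge0 // mulr_ge0 ?layers_ge0 ?double_gt0 //;
    rewrite ?mulr_ge0 ?powR_ge0 //.
have [Ly _] := andP xy.
have yr : 0 < y (rr x) by exact: lt_trans Ly.
rewrite (layers_in xy xt) (mass_density_in yr) (WAE yr) (WBE yr).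
have r_gt0 := y_gt0_pos yr; have t_gt0 := tau0 yr.
have rt0 : 0 <= rr x * tau (rr x) by rewrite mulr_ge0 ?ltW.
have Q0 : 0 <= `|c| * amplitude x + kap.
  by apply: addr_ge0; [apply: mulr_ge0; [exact: normr_ge0|exact: amplitude_ge0]|exact: ltW].
set D := (_ * tau (rr x))^-1.
have D0 : 0 <= D by rewrite invr_ge0 mulr_ge0 ?exprn_ge0 ?ltW.
rewrite mulrA -powRM ?gradL_norm_ge0 // [gradL_norm _ _ _ * _]mulrC.
apply: (@le_trans _ _ ((expR (c * y (rr x)) * (`|c| * amplitude x + kap)) `^ p * (D * expR (- (p * c * y (rr x)))))).
  apply: ler_wpM2r; first by rewrite mulr_ge0 ?expR_ge0.
  apply: ge0_ler_powR; rewrite ?nnegrE ?(ltW p0) //.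
  - by rewrite mulr_ge0 ?gradL_norm_ge0.
  - by apply: mulr_ge0; [exact: expR_ge0|exact: Q0].
  - by apply: gradL_test; exact: ltW.
rewrite (@powRM _ _ _ p (expR_ge0 _) Q0) -expRM.
have -> : expR (c * y (rr x) * p) * (`|c| * amplitude x + kap) `^ p * (D * expR (- (p * c * y (rr x)))) =
   expR (c * y (rr x) * p) * expR (- (p * c * y (rr x))) * ((`|c| * amplitude x + kap) `^ p * D) by ring.
rewrite -expRD (_ : _ + _ = 0) ?expR0 ?mul1r; last by ring.
have H := @powRD_le R p th (`|c| * amplitude x) kap p0 th0 (mulr_ge0 (normr_ge0 _) (amplitude_ge0 x)) (ltW kap0).
apply: (le_trans (ler_wpM2r D0 H)).
by rewrite (@powRM _ _ _ p (normr_ge0 _) (amplitude_ge0 x)) le_eqVlt; apply/orP; left; apply/eqP; ring.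
Qed.

(** The error lives on all layers between L and 3L, whose measure is compared with that of the
    middle layers, where the mass is bounded below. The resulting factor [sharp_cst] is independent
    of T and J. *)
Lemma test_ratio (Omega : set 'rV[R]_m) : C1_0 Omega test_fun ->
  exists IA IB, [/\ has_iint energy_density IA, has_iint mass_density IB, 0 < IB &
    forall th, 0 < th ->
      IA <= ((1 + th) `^ p * `|c| `^ p + (1 + th^-1) `^ p * kap `^ p * sharp_cst) * IB].
Proof.
move=> [du cu _ _].
have mu : rV_rmeasurable mass_density.
  apply: rmeasurableM; last exact: (rmeasurable_comp mWB (@rmeasurable_rr R n)).
  by apply: rmeasurable_normpow; exact: (C1_continuous du cu).
have mg : rV_rmeasurable energy_density.
  apply: rmeasurableM; last exact: (rmeasurable_comp mWA (@rmeasurable_rr R n)).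
  by apply: rmeasurable_powR; exact: rmeasurable_gradL.
have JJ0 : (0 < J.*2)%N by rewrite double_gt0.
have J30 : (0 < 3 * J)%N by rewrite muln_gt0.
have T20 : 0 < T / 2 by rewrite divr_gt0.
have [D hD /andP[_ D2]] := @has_iint_layers J.*2 (2 * J.*2) T JJ0 T0.
have [D' hD' /andP[D1' _]] := @has_iint_layers (3 * J) (2 * J) (T / 2) J30 T20.
have fB0 x : 0 <= mass_density x by rewrite /mass_density; apply: mulr_ge0; [exact: powR_ge0|exact: WB0].
have fA0 x : 0 <= energy_density x by rewrite /energy_density; apply: mulr_ge0; [exact: powR_ge0|exact: WA0].
have [IB hB _] := le_has_iint_ex fB0 mu hD mass_density_le.
have k10 : 0 < ((9 / 16) ^+ 2) `^ p :> R by apply: powR_gt0; rewrite exprn_gt0 // divr_gt0.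
have IBD' := le_has_iint (has_iintZ (ltW k10) hD') hB mass_density_ge.
have JR : 0 < J%:R :> R by rewrite ltr0n.
have JTM : 0 < J%:R * (T * M) by rewrite !mulr_gt0.
(* 4J layers of height T, each of measure at most T M; next, 2J layers of height T / 2, each of
   measure at least T M / 4. *)
have DJ : D <= 4 * (J%:R * (T * M)).
  by apply: (le_trans D2); rewrite -muln2 !natrM; lra.
have D'J : J%:R * (T * M) / 2 <= D'.
  by apply: le_trans D1'; rewrite !natrM; lra.
have DD' : D <= 8 * D' by lra.
have DB : D <= sharp_cst * IB.
  apply: (le_trans DD'); rewrite /sharp_cst -mulrA ler_pM2l // mulrC ler_pdivlMr // mulrC.
  exact: IBD'.
have IB0 : 0 < IB.
  by apply: lt_le_trans IBD'; rewrite mulr_gt0 //; lra.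
have C0 th : 0 <= (1 + th) `^ p * `|c| `^ p by apply: mulr_ge0; exact: powR_ge0.
have C1 th : 0 <= (1 + th^-1) `^ p * kap `^ p by apply: mulr_ge0; exact: powR_ge0.
have hC th := has_iintD (has_iintZ (C0 th) hB) (has_iintZ (C1 th) hD).
have [IA hA _] := le_has_iint_ex fA0 mg (hC 1) (fun x => @energy_density_le 1 x ltr01).
exists IA, IB; split=> // th th0.
apply: (le_trans (le_has_iint hA (hC th) (fun x => @energy_density_le th x th0))).
by rewrite mulrDl lerD2l -[leRHS]mulrA ler_wpM2l.
Qed.

End test_function.

(** The gap between |c|^p and C determines th and kap; as [sharp_cst] involves neither T nor J,
    these can be chosen afterwards to make the errors smaller than kap. *)
Lemma sharp_constant (C : R) (Omega : set 'rV[R]_m) : `|c| `^ p < C ->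
  (forall kap : R, 0 < kap -> exists (T : R) (J : nat), [/\ 0 < T, (0 < J)%N,
    forall r, J.*2%:R * d <= y r ->
      4 / (J.*2%:R * d) + 8 * gamma * (tau r * r `^ (2 * gamma)) / T <= kap &
    forall x, 0 < rr x <= vrho (J.*2%:R * d) -> `|tt x| <= T -> Omega x]) ->
  exists u, C1_0 Omega u /\
    (integral_on Omega (fun x => gradL_norm gamma u x `^ p * WA (rr x))%R
     < C%:E * integral_on Omega (fun x => `|u x| `^ p * WB (rr x))%R)%E.
Proof.
move=> cC HT; have k0 : 0 < sharp_cst.
  by rewrite divr_gt0 // powR_gt0 // exprn_gt0 // divr_gt0.
have [th [kap [th0 kap0 thC]]] := exists_perturbation_lt p1 k0 cC.
have [T [J [T0 J0 kapE TO]]] := HT _ kap0.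
have C1u := test_C1_0 T0 J0 TO.
exists (test_fun T J); split => //.
have [IA [IB [[_ _ hA] [_ _ hB] IB0 AB]]] := test_ratio T0 J0 kap0 kapE C1u.
have pn0 : p != 0 by rewrite gt_eqF // (lt_trans ltr01 p1).
have off x : ~ Omega x -> ~ closure [set x | test_fun T J x != 0] x by exact: C1_0_off C1u.
rewrite !integral_onE; last 2 first.
- by move=> x /off /supp0 ux; rewrite ux normr0 (powR0 pn0) mul0r.
- by move=> x /off /(gradL_supp gamma) ux; rewrite ux (powR0 pn0) mul0r.
rewrite [X in (X < _)%E]hA [X in (_ < _ * X)%E]hB -EFinM lte_fin.
by apply: (le_lt_trans (AB _ th0)); rewrite ltr_pM2r.
Qed.

End ratio.

Section powR_expR.
Context {R : realType}.

Lemma powRE_gt0 (r b : R) : 0 < r -> r `^ b = expR (b * ln r).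
Proof. by move=> r0; rewrite /powR gt_eqF. Qed.

Lemma exprn_expR (r : R) (k : nat) : 0 < r -> r ^+ k = expR (k%:R * ln r).
Proof. by move=> r0; rewrite -powR_mulrn ?ltW // powRE_gt0. Qed.

Lemma large_nat (A : R) : exists2 J : nat, (0 < J)%N & A <= J%:R.
Proof.
have /archi_boundP : 0 <= `|A| by [].
set J := Num.bound _ => AJ; exists J; last by rewrite (le_trans (ler_norm A)) // ltW.
by rewrite lt0n; apply/eqP => J0; move: AJ; rewrite J0 ltNge normr_ge0.
Qed.

Lemma ln_gt0_gt1 (r : R) : 0 < ln r -> 1 < r.
Proof. by move=> l0; rewrite ltNge; apply/negP => /ln_le0; rewrite leNgt l0. Qed.

End powR_expR.

(** * Choice of scale for the two weights *)

Section sharpness.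
Context {R : realType} (n : nat).
Hypothesis n0 : (0 < n)%N.
Local Notation N := n.*2.
Local Notation m := (n.*2.+1).
Implicit Types (x : 'rV[R]_m).

(** Scale y = - ln r with tau = 1 and c = (2n + beta) / p. The cylinder inside Omega limits the
    height, so the t-error is made small through r^(2 gamma) <= 1 / L on the support. *)
Lemma sharp_power (gamma p beta rho C : R) (Omega : set 'rV[R]_m) :
  1 < p -> 1 <= gamma -> 0 < rho ->
  [set x | 0 < rr x < rho /\ `|tt x| < rho] `<=` Omega ->
  (`|N%:R + beta| / p) `^ p < C ->
  exists u, C1_0 Omega u /\
    (integral_on Omega (fun x => gradL_norm gamma u x `^ p * rr x `^ (p + beta))%R
     < C%:E * integral_on Omega (fun x => `|u x| `^ p * rr x `^ beta)%R)%E.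
Proof.
move=> p1 g1 rho0 rhoO; have p0 : 0 < p by lra.
have -> : `|N%:R + beta| / p = `|(N%:R + beta) / p| by rewrite normrM normfV (gtr0_norm p0).
move=> cC; have [M M0 hM] := @ring0_measure R n n0.
have y_pos (r : R) : 0 < - ln r -> 0 < r.
  by move=> yr; rewrite ltNge; apply/negP => /ln0 lr; rewrite lr oppr0 ltxx in yr.
apply: (@sharp_constant R n p _ 1 gamma M (fun r => - ln r) (fun=> 1) (fun v => expR (- v))
  (fun r => r `^ (p + beta)) (fun r => r `^ beta) p1 g1 _ _ _ _ _ _ _ _ _ _ _ _ _ _ _ _ _ _ cC) => //.
- by move=> v; exact: expR_gt0.
- by move=> v w vw; rewrite ler_expR lerN2.
- by move=> r yr; rewrite opprK lnK // posrE y_pos.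
- move=> v r v0 r_gt0 rv; apply: (lt_le_trans v0).
  by rewrite lerNr -[leRHS]expRK ler_ln ?posrE ?expR_gt0.
- move=> r /y_pos r_gt0; rewrite mulr1; have H := is_deriveN (is_derive1_ln r_gt0).
  exact: H.
- by move=> r _; exact: cvg_cst.
- by move=> r; exact: powR_ge0.
- by move=> r; exact: powR_ge0.
- move=> r /y_pos r_gt0; rewrite mulr1 powRE_gt0 // exprn_expR // -expRN -expRD.
  by congr expR; field; rewrite gt_eqF.
- move=> r /y_pos r_gt0; rewrite mulr1 powRD //.
  by rewrite (gt_eqF r_gt0) implybT.
- move=> j S _ S0; exists (S * M).
    have := ring_measure n0 j%:R hM S0; congr has_iint; apply/funext => x.
    by rewrite /layer /ring_density mulr1 divr1.
  by rewrite lexx andbT ler_pdivrMr // ler_peMr ?mulr_ge0 ?ltW //; lra.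
move=> kap kap0; pose T := rho / 2.
have T0 : 0 < T by rewrite divr_gt0.
(* The first bound makes (4 + 8 gamma / T) / L at most kap; the second gives e^(-L) < 1 / L < rho,
   which keeps the support inside the cylinder. *)
have [J J0 JA] := large_nat (Num.max ((4 + 8 * gamma / T) / kap) (1 / rho)).
exists T, J; rewrite mulr1; set L : R := J.*2%:R.
have JR : 0 < J%:R :> R by rewrite ltr0n.
have LJ : L = 2 * J%:R by rewrite /L -muln2 natrM mulrC.
have L0 : 0 < L by rewrite LJ mulr_gt0.
have eL : expR (- L) < L^-1.
  by rewrite expRN ltf_pV2 ?posrE ?expR_gt0 //; have := expR_ge1Dx L; lra.
move: JA; rewrite ge_max => /andP[J1 J2].
split => //.
- move=> r Lr; have r_gt0 : 0 < r by apply: y_pos; exact: lt_le_trans Lr.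
  have rL : r `^ (2 * gamma) <= L^-1.
    rewrite powRE_gt0 // (le_trans _ (ltW eL)) // ler_expR.
    have : (2 * gamma) * L <= (2 * gamma) * - ln r by rewrite ler_wpM2l //; lra.
    have : L <= (2 * gamma) * L by rewrite ler_peMl //; lra.
    lra.
  apply: (@le_trans _ _ ((4 + 8 * gamma / T) / L)).
    rewrite [leRHS]mulrDl lerD2l mul1r mulrAC ler_wpM2l //.
    by rewrite divr_ge0 ?(ltW T0) //; lra.
  move: J1; rewrite !ler_pdivrMr // LJ => J1.
  by have := mulr_gt0 JR kap0; lra.
- move=> x /andP[r_gt0 rL] tT; apply: rhoO; split; last first.
    by apply: (le_lt_trans tT); rewrite /T; lra.
  rewrite r_gt0 /= (le_lt_trans rL) // (lt_trans eL) //.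
  rewrite -[rho]invrK ltf_pV2 ?posrE ?invr_gt0 //.
  by rewrite LJ; move: J2; rewrite mul1r; lra.
Qed.

(** Scale y = ln (ln (Rad / r)) and c = -(beta + 1) / p, so the virtual extremal is ln (Rad / r)^c.
    Its scale is positive only where ln (Rad / r) > 1. *)
Lemma sharp_log (gamma beta Rad C : R) : 0 < Rad -> 1 <= gamma ->
  let p : R := N%:R in
  let Omega := [set x : 'rV[R]_m | rr x < Rad] in
  (`|beta + 1| / p) `^ p < C ->
  exists u, C1_0 Omega u /\
    (integral_on Omega (fun x => gradL_norm gamma u x `^ p * ln (Rad / rr x) `^ (p + beta))%R
     < C%:E * integral_on Omega (fun x => `|u x| `^ p / rr x `^ p * ln (Rad / rr x) `^ beta)%R)%E.
Proof.
move=> Rad0 g1 p Omega.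
have p1 : 1 < p by rewrite ltr1n; case: n n0 => // k _; rewrite doubleS.
have p0 : 0 < p by lra.
have -> : `|beta + 1| / p = `|- (beta + 1) / p| by rewrite normrM normrN normfV (gtr0_norm p0).
move=> cC; have [M M0 hM] := @ring0_measure R n n0.
pose s (r : R) := ln (Rad / r).
have s_pos (r : R) : 0 < ln (s r) -> 1 < s r /\ 0 < r.
  move=> /ln_gt0_gt1 s1; split => //; have /ln_gt0_gt1 : 0 < ln (Rad / r) by exact: lt_trans s1.
  by move=> Rr; rewrite -invr_gt0 -(pmulr_rgt0 _ Rad0); exact: lt_trans Rr.
have sE (r : R) : 0 < r -> s r = ln Rad - ln r.
  by move=> r_gt0; rewrite /s lnM ?posrE ?invr_gt0 // lnV ?posrE.
have ms : measurable_fun setT (s : measurableTypeR R -> R).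
  apply: (measurableT_comp (@measurable_ln R)); apply: measurable_funM => //.
  exact: measurable_inv.
have l2 : 0 < ln 2 :> R by rewrite ln_gt0 // ltr1n.
pose WB (r : R) := (r `^ p)^-1 * s r `^ beta.
have [u [C1u H]] : exists u, C1_0 Omega u /\
    (integral_on Omega (fun x => gradL_norm gamma u x `^ p * s (rr x) `^ (p + beta))%R
     < C%:E * integral_on Omega (fun x => `|u x| `^ p * WB (rr x))%R)%E; last first.
  exists u; split => //; move: H; congr (_ < _ * integral_on _ _)%E.
  by apply/funext => x; rewrite /WB mulrA.
apply: (@sharp_constant R n p _ (ln 2) gamma M (fun r => ln (s r)) s (fun v => Rad * expR (- expR v))
  (fun r => s r `^ (p + beta)) WB p1 g1 _ _ _ _ _ _ _ _ _ _ _ _ _ _ _ _ _ _ cC) => //.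
- by move=> v; rewrite mulr_gt0 ?expR_gt0.
- by move=> v w vw; rewrite ler_pM2l // ler_expR lerN2 ler_expR.
- move=> r /s_pos[s1 r_gt0]; rewrite lnK ?posrE ?(lt_trans ltr01 s1) // expRN /s lnK ?posrE ?divr_gt0 //.
  by rewrite invf_div mulrC divfK // gt_eqF.
- move=> v r v0 r_gt0 rv; apply: ln_gt0; apply: (@lt_le_trans _ _ (expR v)).
    by rewrite -expR0 ltr_expR.
  rewrite -[leLHS]expRK ler_ln ?posrE ?expR_gt0 ?divr_gt0 // ler_pdivlMr // mulrC.
  by rewrite -ler_pdivlMr ?expR_gt0 // -expRN.
- move=> r /s_pos[s1 r_gt0]; have s0 : 0 < s r by exact: lt_trans s1.
  have Hln := is_deriveB (is_derive_cst (ln Rad) r (1 : R)) (is_derive1_ln r_gt0).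
  have Hs : is_derive r 1 s (- r^-1).
    apply: (is_derive1_near_eq Hln); last by rewrite sub0r.
    by apply: filterS (near_gt0 r_gt0) => z z0; rewrite sE.
  apply: (is_derive1_near_eq (is_derive1_compr Hs (is_derive1_ln s0))); first by near=> z.
  by rewrite invfM mulrN mulrC.
- by move=> r /s_pos[s1 _]; exact: lt_trans s1.
- move=> r /s_pos[_ r_gt0]; rewrite /prop_for /continuous_at sE //.
  apply: (@cvg_near_eq _ (fun z => ln Rad - ln z)).
    by apply: filterS (near_gt0 r_gt0) => z z0; rewrite sE.
  by apply: cvgB; [exact: cvg_cst|exact: continuous_ln].
- by apply: (@measurableT_comp _ _ _ _ _ _ (@powR R ^~ (p + beta)) _ s) => //; exact: measurable_powR.
- apply: measurable_funM.
    apply: (measurableT_comp (@measurable_inv R)); exact: measurable_powR.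
  apply: (@measurableT_comp _ _ _ _ _ _ (@powR R ^~ beta) _ s) => //; exact: measurable_powR.
- by move=> r; exact: powR_ge0.
- by move=> r; rewrite mulr_ge0 ?invr_ge0 ?powR_ge0.
- move=> r /s_pos[s1 r_gt0]; have s0 : 0 < s r by exact: lt_trans s1.
  rewrite /WB (powRE_gt0 _ r_gt0) (powRE_gt0 _ s0) exprn_expR // -[X in (_ * X)^-1](lnK s0).
  rewrite -expRD -!expRN -!expRD.
  by congr expR; rewrite -/p; field; rewrite gt_eqF.
- move=> r /s_pos[s1 r_gt0]; have s0 : 0 < s r by exact: lt_trans s1.
  rewrite /WB (powRE_gt0 _ r_gt0) !(powRE_gt0 _ s0) powRE_gt0 ?mulr_gt0 // lnM ?posrE //.
  by rewrite -!expRN -!expRD; congr expR; ring.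
- move=> j S j0 S0.
  (* The layer 2^j <= ln (Rad / r) < 2^(j+1) is a union of 2^j unit logarithmic rings. *)
  pose Q x := \sum_(i < 2 ^ j) ring_density (2 ^+ j - ln Rad + i%:R) S x.
  have hQ : has_iint Q (2 ^+ j * (S * M)).
    have E k : has_iint (fun x => \sum_(i < k) ring_density (2 ^+ j - ln Rad + i%:R) S x) (k%:R * (S * M)).
      elim: k => [|k IH].
        have -> : (fun x : 'rV[R]_m => \sum_(i < 0) ring_density (2 ^+ j - ln Rad + i%:R) S x) = fun=> 0.
          by apply/funext => x; rewrite big_ord0.
        by split => //; [exact: measurable_cst|rewrite iint0 mul0r].
      have -> : (fun x : 'rV[R]_m => \sum_(i < k.+1) ring_density (2 ^+ j - ln Rad + i%:R) S x) =
          fun x => \sum_(i < k) ring_density (2 ^+ j - ln Rad + i%:R) S x + ring_density (2 ^+ j - ln Rad + k%:R) S x.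
        by apply/funext => x; rewrite big_ord_recr.
      rewrite (_ : k.+1%:R = k%:R + 1) ?mulrDl ?mul1r; last by rewrite -natr1.
      apply: has_iintD IH _; exact: ring_measure.
    by rewrite -natrX; exact: E.
  have QE x : 0 < rr x -> Q x = (rr x ^+ N)^-1 * unit_indic j%:R (ln (s (rr x)) / ln 2) * tind S x.
    move=> r_gt0; rewrite /Q /ring_density -mulr_suml -mulr_sumr sum_unit_indic; congr (_ * _ * _).
    rewrite /unit_indic natrX ler_pdivlMr // ltr_pdivrMr //; congr ((_ : bool) : nat)%:R.
    have lE (k : nat) : k%:R * ln 2 = ln (2 ^+ k) :> R by rewrite lnXn // mulr_natl.
    have -> : j%:R + 1 = j.+1%:R :> R by rewrite -addn1 natrD.
    rewrite !lE exprS; have := sE _ r_gt0; move: (s (rr x)) => z zE.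
    have e0 : 1 < 2 ^+ j :> R by rewrite exprn_egt1 ?ltr1n // -lt0n.
    (* Values z <= 1 lie in neither layer: 2^j > 1 because j > 0, while ln z <= 0, with ln z = 0 by
       default for z <= 0. *)
    have [z0|z0] := leP z 1.
      have lz := ln_le0 z0.
      have -> : (ln (2 ^+ j) <= ln z) = false.
        by apply/negbTE; rewrite -ltNge (le_lt_trans lz) // ln_gt0.
      by apply/negbTE/negP => /andP[? _]; lra.
    rewrite ler_ln ?posrE ?(lt_trans ltr01) // ltr_ln ?posrE ?mulr_gt0 ?(lt_trans ltr01) ?ltr1n //.
    by apply/andP/andP => -[? ?]; split; lra.
  have ml : rV_rmeasurable (@layer R n (ln 2) (fun r => ln (s r)) s j S).
    apply: rmeasurableM; last exact: rmeasurable_tind.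
    apply: rmeasurableM.
      apply: rmeasurable_inv; apply: rmeasurableM; last exact: (rmeasurable_comp ms (@rmeasurable_rr R n)).
      by apply: measurable_funX; exact: rmeasurable_rr.
    apply: (@rmeasurable_comp _ _ (fun r => unit_indic j%:R (ln (s r) / ln 2))); last exact: rmeasurable_rr.
    apply: (measurableT_comp (measurable_unit_indic _)); apply: measurable_funM => //.
    exact: (measurableT_comp (@measurable_ln R)).
  (* On the layer tau lies between 2^j and 2^(j+1), so the layer density is squeezed between two
     multiples of the sum of unit rings. *)
  have lQ x : (2 * 2 ^+ j)^-1 * Q x <= layer (ln 2) (fun r => ln (s r)) s j S x <= (2 ^+ j)^-1 * Q x.
    have := rr_ge0 x; rewrite le_eqVlt => /predU1P[r0|r_gt0].
      have z0 : 0 ^+ N = 0 :> R by rewrite expr0n double_eq0 (gtn_eqF n0).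
      rewrite /layer /Q big1 => [|i _]; last by rewrite /ring_density -r0 z0 invr0 !mul0r.
      by rewrite -r0 z0 !(mul0r, invr0) !mulr0 lexx.
    rewrite QE // /layer /unit_indic.
    case: (boolP (_ <= _ < _)) => [/andP[H1 H2]|]; last by rewrite !(mulr0, mul0r) lexx.
    have ly : 0 < ln (s (rr x)).
      by move: H1; rewrite ler_pdivlMr //; apply: lt_le_trans; rewrite mulr_gt0 // ltr0n.
    have [s1 _] := s_pos _ ly; have s0 : 0 < s (rr x) by exact: lt_trans s1.
    move: H1 H2; rewrite ler_pdivlMr // ltr_pdivrMr // !mulr1.
    have lE (k : nat) : k%:R * ln 2 = ln (2 ^+ k) :> R by rewrite lnXn // mulr_natl.
    have -> : j%:R + 1 = j.+1%:R :> R by rewrite -addn1 natrD.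
    rewrite !lE exprS ler_ln ?posrE ?exprn_gt0 // ltr_ln ?posrE ?mulr_gt0 ?exprn_gt0 // => H1 H2.
    have D0 : 0 <= (rr x ^+ N)^-1 * tind S x.
      by rewrite mulr_ge0 // ?invr_ge0 ?exprn_ge0 ?ltW // /tind indicE.
    have -> : (rr x ^+ N * s (rr x))^-1 * tind S x = (s (rr x))^-1 * ((rr x ^+ N)^-1 * tind S x).
      by rewrite invfM; ring.
    by rewrite !ler_wpM2r // lef_pV2 ?posrE ?mulr_gt0 ?exprn_gt0 //; exact: ltW.
  have l0 x : 0 <= layer (ln 2) (fun r => ln (s r)) s j S x.
    have /andP[+ _] := lQ x; apply: le_trans; rewrite mulr_ge0 ?invr_ge0 ?mulr_ge0 ?exprn_ge0 //.
    by apply: sumr_ge0 => i _; exact: ring_density_ge0.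
  have e0 : 0 < 2 ^+ j :> R by rewrite exprn_gt0.
  have i1 : 0 <= (2 * 2 ^+ j)^-1 :> R by rewrite invr_ge0 mulr_ge0 ?ltW.
  have i2 : 0 <= (2 ^+ j)^-1 :> R by rewrite invr_ge0 ltW.
  have [I hI I2] := le_has_iint_ex l0 ml (has_iintZ i2 hQ) (fun x => proj2 (andP (lQ x))).
  have I1 := le_has_iint (has_iintZ i1 hQ) hI (fun x => proj1 (andP (lQ x))).
  exists I => //; move: I1 I2; rewrite mulKf ?gt_eqF // => I1 ->; rewrite andbT.
  apply: le_trans I1; rewrite le_eqVlt; apply/orP; left; apply/eqP; field.
  by rewrite gt_eqF.
move=> kap kap0.
(* Chosen so that 8 gamma Rad^(2 gamma) / T = kap / 2; the other half of kap is left for 4 / L,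
   which fixes J. No bound on T is imposed by Omega. *)
pose T := 16 * gamma * Rad `^ (2 * gamma) / kap.
have P0 : 0 < Rad `^ (2 * gamma) by exact: powR_gt0.
have T0 : 0 < T by rewrite divr_gt0 // !mulr_gt0 //; lra.
have [J J0 J1] := large_nat (4 / (kap * ln 2)).
exists T, J; have JR : 0 < J%:R :> R by rewrite ltr0n.
have -> : J.*2%:R = 2 * J%:R :> R by rewrite -muln2 natrM mulrC.
split => //; last first.
  move=> x /andP[_ rL] _; apply: (le_lt_trans rL); rewrite /= -[ltRHS]mulr1 ltr_pM2l //.
  by rewrite -expR0 ltr_expR oppr_lt0 expR_gt0.
move=> r Lr; have L0 : 0 < 2 * J%:R * ln 2 :> R by rewrite !mulr_gt0.
have [s1 r_gt0] := s_pos r (lt_le_trans L0 Lr).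
(* With s = ln (Rad / r): s <= e^s <= e^(2 gamma s) = (Rad / r)^(2 gamma). *)
have sr : s r * r `^ (2 * gamma) <= Rad `^ (2 * gamma).
  rewrite (powRE_gt0 _ r_gt0) (powRE_gt0 _ Rad0).
  have es : s r <= expR (2 * gamma * s r).
    apply: (@le_trans _ _ (expR (s r))); first by have := expR_ge1Dx (s r); lra.
    by rewrite ler_expR ler_peMl //; lra.
  apply: (@le_trans _ _ (expR (2 * gamma * s r) * expR (2 * gamma * ln r))).
    by rewrite ler_wpM2r // expR_ge0.
  by rewrite -expRD ler_expR sE // le_eqVlt; apply/orP; left; apply/eqP; ring.
have K1 : 4 / (2 * J%:R * ln 2) <= kap / 2.
  rewrite ler_pdivrMr //; move: J1; rewrite ler_pdivrMr ?mulr_gt0 //; lra.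
have K2 : 8 * gamma * (s r * r `^ (2 * gamma)) / T <= kap / 2.
  rewrite ler_pdivrMr //.
  have -> : kap / 2 * T = 8 * gamma * Rad `^ (2 * gamma) by rewrite /T; field; rewrite gt_eqF.
  by rewrite ler_wpM2l //; lra.
lra.
Unshelve. all: by end_near.
Qed.

End sharpness.

(** * The inverse-logarithm case and the final assembly *)

Lemma eq_integral_on {R : realType} (m : nat) (Omega : set 'rV[R]_m) (f g : 'rV[R]_m -> R) :
  (forall x, Omega x -> f x = g x) -> integral_on Omega f = integral_on Omega g.
Proof.
move=> fg; rewrite /integral_on; congr iint; apply/funext => x.
by case: ifPn => //; rewrite inE => /fg ->.
Qed.

(** The case beta = -p, for which |beta + 1| = p - 1. On Omega the logarithm is nonnegative, with
    default value 0 on the axis, so the power of the product splits. *)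
Lemma hardy_log_inverse {R : realType} (n : nat) (gamma Rad : R) (u : 'rV[R]_(n.*2.+1) -> R) :
  (0 < n)%N -> 0 < Rad ->
  let p : R := (n.*2)%:R in
  let Omega := [set xi : 'rV[R]_(n.*2.+1) | rr xi < Rad] in
  C1_0 Omega u ->
  ((((p - 1) / p) `^ p)%:E
    * integral_on Omega (fun xi => `|u xi| `^ p / (rr xi * ln (Rad / rr xi)) `^ p)%R
   <= integral_on Omega (fun xi => gradL_norm gamma u xi `^ p)%R)%E.
Proof.
move=> n0 Rad0 p Omega C1u.
have p1 : 1 < p by rewrite ltr1n; case: n n0 @p Omega u C1u => // k; rewrite doubleS.
have := @hardy_log R n n0 gamma (- p) Rad u Rad0 (_ : - p < -1) C1u; rewrite -/p -/Omega => /(_ _) H.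
have {}H := H (ltac:(by rewrite ltrN2)).
have E1 : `|- p + 1| = p - 1 by rewrite addrC distrC gtr0_norm // subr_gt0.
rewrite E1 in H.
rewrite (@eq_integral_on _ _ Omega _ (fun xi => `|u xi| `^ p / rr xi `^ p * ln (Rad / rr xi) `^ (- p))).
  apply: (le_trans H); rewrite le_eqVlt; apply/orP; left; apply/eqP; apply: eq_integral_on => x _.
  by rewrite subrr powRr0 mulr1.
move=> x; rewrite /Omega /= => xR; have r0 := rr_ge0 x.
have l0 : 0 <= ln (Rad / rr x).
  move: r0; rewrite le_eqVlt => /predU1P[<-|r_gt0]; first by rewrite invr0 mulr0 ln0.
  by rewrite ln_ge0 // ler_pdivlMr // mul1r ltW.
by rewrite powRM // invfM mulrA powRN.
Qed.

Theorem mainTheorem12 (R : realType) (n : nat) (gamma beta : R) :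
  (0 < n)%N -> 1 <= gamma ->
  (* Part (1) *)
  (forall (p : R) (Omega : set 'rV[R]_(n.*2.+1)),
    1 < p -> open Omega ->
    ((n.*2)%:R + beta < 0 -> Omega `<=` [set xi | rr xi != 0]) ->
    (forall u, C1_0 Omega u ->
       ((`|(n.*2)%:R + beta| / p) `^ p)%:E
         * integral_on Omega (fun xi => `|u xi| `^ p * rr xi `^ beta)%R
       <= integral_on Omega (fun xi => gradL_norm gamma u xi `^ p * rr xi `^ (p + beta))%R)%E
    /\
    ((exists rho : R, 0 < rho /\
        [set xi | 0 < rr xi < rho /\ `|tt xi| < rho] `<=` Omega) ->
     forall C : R, (`|(n.*2)%:R + beta| / p) `^ p < C ->
     exists u, C1_0 Omega u /\
       (integral_on Omega (fun xi => gradL_norm gamma u xi `^ p * rr xi `^ (p + beta))%R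
        < C%:E * integral_on Omega (fun xi => `|u xi| `^ p * rr xi `^ beta)%R)%E)) /\
  (* Part (1), particular case beta = -p *)
  (forall (p : R) (Omega : set 'rV[R]_(n.*2.+1)),
    1 < p -> open Omega ->
    ((n.*2)%:R - p < 0 -> Omega `<=` [set xi | rr xi != 0]) ->
    forall u, C1_0 Omega u ->
      (((`|(n.*2)%:R - p| / p) `^ p)%:E
         * integral_on Omega (fun xi => `|u xi| `^ p / NN gamma xi `^ p)%R
       <= ((`|(n.*2)%:R - p| / p) `^ p)%:E
         * integral_on Omega (fun xi => `|u xi| `^ p / rr xi `^ p)%R)%E /\
      (((`|(n.*2)%:R - p| / p) `^ p)%:E
         * integral_on Omega (fun xi => `|u xi| `^ p / rr xi `^ p)%R
       <= integral_on Omega (fun xi => gradL_norm gamma u xi `^ p)%R)%E) /\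
  (* Part (2) *)
  (forall Rad : R, 0 < Rad -> beta < -1 ->
    let p : R := (n.*2)%:R in
    let Omega := [set xi : 'rV[R]_(n.*2.+1) | rr xi < Rad] in
    (forall u, C1_0 Omega u ->
      ((`|beta + 1| / p) `^ p)%:E
        * integral_on Omega (fun xi => `|u xi| `^ p / rr xi `^ p * ln (Rad / rr xi) `^ beta)%R
      <= integral_on Omega (fun xi => gradL_norm gamma u xi `^ p * ln (Rad / rr xi) `^ (p + beta))%R)%E
    /\
    (forall u, C1_0 Omega u ->
      (((p - 1) / p) `^ p)%:E
        * integral_on Omega (fun xi => `|u xi| `^ p / (rr xi * ln (Rad / rr xi)) `^ p)%R
      <= integral_on Omega (fun xi => gradL_norm gamma u xi `^ p)%R)%E
    /\
    (forall C : R, (`|beta + 1| / p) `^ p < C ->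
     exists u, C1_0 Omega u /\
       (integral_on Omega (fun xi => gradL_norm gamma u xi `^ p * ln (Rad / rr xi) `^ (p + beta))%R
        < C%:E * integral_on Omega
              (fun xi => `|u xi| `^ p / rr xi `^ p * ln (Rad / rr xi) `^ beta)%R)%E)).
Proof.
move=> n0 g1; split; last split.
- move=> p Omega p1 _ Om0; split; first by move=> u C1u; exact: hardy_power.
  by move=> [rho [rho0 rhoO]] C; exact: sharp_power rhoO.
- move=> p Omega p1 _ Om0 u C1u; split; first by apply: hardy_gauge_le => //; exact: powR_ge0.
  have := @hardy_power R n n0 gamma (- p) p Omega u p1 Om0 C1u.
  rewrite (_ : (fun xi => _ * _ `^ (- p)) = fun xi => `|u xi| `^ p / rr xi `^ p); last first.
    by apply/funext => x; rewrite powRN.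
  rewrite (_ : (fun xi => _ * _ `^ (p - p)) = fun xi => gradL_norm gamma u xi `^ p) //.
  by apply/funext => x; rewrite subrr powRr0 mulr1.
- move=> Rad Rad0 beta1 p Omega; split; first by move=> u C1u; exact: hardy_log.
  split; first by move=> u C1u; exact: hardy_log_inverse.
  by move=> C; exact: sharp_log.
Qed.
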